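(* Let $d\ge 3$ be a fixed integer and let $G\sim\mathcal{G}(n,d)$. Then with high probability (as $n\to\infty$) the non-backtracking random walk on $G$ has cutoff at time $\log_{d-1}(dn)$ with a constant-size window. More precisely, for any fixed $0<\epsilon<1$, the worst-case total-variation mixing time of the non-backtracking random walk on $G$ satisfies, with high probability, $$t_{\mathrm{mix}}(1-\epsilon)\ \ge\ \lceil\log_{d-1}(dn)\rceil-\lceil\log_{d-1}(1/\epsilon)\rceil,$$ $$t_{\mathrm{mix}}(\epsilon)\ \le\ \lceil\log_{d-1}(dn)\rceil+3\lceil\log_{d-1}(1/\epsilon)\rceil+4.$$
   Context: $\mathcal{G}(n,d)$ is the uniform distribution over all simple $d$-regular graphs on $n$ labelled vertices ($dn$ even). ''With high probability'' means with probability tending to $1$ as $n\to\infty$. The non-backtracking random walk on a graph $G$ is the Markov chain whose state space is the set $\bar E$ of directed edges (each edge of $G$ appears in both orientations, so $|\bar E|=dn$), which moves from $(x,y)$ to a uniformly chosen directed edge $(y,z)$ with $z\ne x$. Its stationary distribution $\pi$ is uniform on $\bar E$. For a Markov chain $(X_t)$ on a finite state space $\Omega$ with stationary distribution $\pi$, let $d(t)=\max_{x\in\Omega}\|\mathbb{P}_x(X_t\in\cdot)-\pi\|_{\mathrm{TV}}$, where $\|\mu-\nu\|_{\mathrm{TV}}=\frac12\sum_{x}|\mu(x)-\nu(x)|$, and for $0<s<1$ let $t_{\mathrm{mix}}(s)=\min\{t: d(t)<s\}$. Cutoff at $t_n$ with constant-size window, with high probability, means: for every $0<\epsilon<1$ there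 is a constant $\lambda>0$ such that with high probability $d(t_n-\lambda)\ge1-\epsilon$ and $d(t_n+\lambda)\le\epsilon$ (times rounded down to integers). *)

(* Defs.v *)
From mathcomp Require Import all_boot all_order all_algebra.
From mathcomp Require Import all_classical all_reals all_analysis.

Set Implicit Arguments.
Unset Strict Implicit.
Unset Printing Implicit Defensive.

Import Order.TTheory GRing.Theory Num.Theory.
Import numFieldNormedType.Exports.

Local Open Scope ring_scope.

Section MarkovChain.
Variables (R : realType) (T : finType).

Definition tv_dist (mu nu : T -> R) : R :=
  2^-1 * \sum_(x : T) `|mu x - nu x|.

(* [mc_law P t x] is the law of X_t for the chain with transition
   probabilities [P] started at X_0 = x. *)
Fixpoint mc_law (P : T -> T -> R) (t : nat) (x : T) : T -> R :=
  if t is t'.+1 then fun y => \sum_(z : T) mc_law P t' x z * P z y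
  else fun y => (x == y)%:R.

(* Total variation distances are nonnegative, so 0 is a neutral starting value
   for the maximum over a nonempty state space. *)
Definition mc_dist (P : T -> T -> R) (pi : T -> R) (t : nat) : R :=
  \big[Num.max/0]_(x : T) tv_dist (mc_law P t x) pi.

(* The infimum of a nonempty set of natural numbers is its minimum; the value
   is +oo when the distance never goes below [s], as may happen on a
   disconnected or periodic chain. *)
Definition mc_tmix (P : T -> T -> R) (pi : T -> R) (s : R) : \bar R :=
  ereal_inf [set (t%:R : R)%:E | t in [set t : nat | mc_dist P pi t < s]]%classic.

End MarkovChain.

(* A graph on the vertex set 'I_n is encoded by its set of directed edges: each
   edge {x, y} is represented by both (x, y) and (y, x). *)
Definition regular_graphs (n d : nat) : {set {set 'I_n * 'I_n}} :=
  [set G : {set 'I_n * 'I_n} |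
    [&& [forall x, (x, x) \notin G],
        [forall x, forall y, ((x, y) \in G) == ((y, x) \in G)]
      & [forall x, #|[set y | (x, y) \in G]| == d]]].

Definition prob_regular (R : realType) (n d : nat)
    (A : pred {set 'I_n * 'I_n}) : R :=
  #|[set G in regular_graphs n d | A G]|%:R / #|regular_graphs n d|%:R.

(* The limit is along those n for which d * n is even. *)
Definition whp (R : realType) (d : nat)
    (A : forall n, pred {set 'I_n * 'I_n}) : Prop :=
  (prob_regular R d (A n) @[n --> within [set n | ~~ odd (d * n)] \oo]
     --> (1 : R))%classic.

Section NonBacktracking.
Variables (R : realType) (n : nat) (G : {set 'I_n * 'I_n}).

Definition dedge : finType := {e : 'I_n * 'I_n | e \in G}.

Definition nb_succ (e : dedge) : {set dedge} :=
  [set f : dedge | ((val f).1 == (val e).2) && ((val f).2 != (val e).1)].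

Definition nb_step (e f : dedge) : R :=
  if f \in nb_succ e then #|nb_succ e|%:R^-1 else 0.

Definition nb_stat (e : dedge) : R := #|dedge|%:R^-1.

Definition nb_dist (t : nat) : R := mc_dist nb_step nb_stat t.

Definition nb_tmix (s : R) : \bar R := mc_tmix nb_step nb_stat s.

End NonBacktracking.

Definition logb (R : realType) (b x : R) : R := ln x / ln b.

(* [Num.truncn] is the floor on nonnegative reals and 0 on negative ones; since
   [tn n] tends to infinity in applications, [tn n - lambda] is negative for
   finitely many n only. *)
Definition nb_cutoff_const_window (R : realType) (d : nat) (tn : nat -> R) :
    Prop :=
  forall eps : R, 0 < eps < 1 ->
  exists2 lambda : R, 0 < lambda &
    whp R d (fun n G =>
      (1 - eps <= nb_dist R G (Num.truncn (tn n - lambda))) &&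
      (nb_dist R G (Num.truncn (tn n + lambda)) <= eps)).

(* Main.v *)
(* Let b = d - 1 and let pr F be the number of d-regular graphs containing the
   edge set F. Switching uv with a second edge of the graph shows that
   pr (F + uv) / pr F is at most (d - deg_F u)(d - deg_F v) / (dn - O(|F| + 1)).
   Reveal non-backtracking walks edge by edge: old edges cost nothing, an edge
   to an unused vertex costs about b, and a coincidence (a new edge between used
   vertices) costs an additional factor O(|F| / n). This bounds the expected
   number of pairs of walks of length t from a fixed edge that meet at time t by
   (1 + o(1)) b^(2t) / (dn). The bound holds conditionally on any small set F of
   revealed edges, so it can be iterated to bound a high moment, and Markov's
   inequality beats a union bound over the dn starting edges.

   The history F creates pairs inside F, which is why there are three scales,
   with n about b^(13q). By time 4q no edge is reached by three walks from the
   same start, because three such walks span at least two cycles. Hence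
   sigma = 4q, kappa = 2 controls the number of pairs meeting at time 7q. Then
   the walks whose edge at time sigma = 7q is reached more than kappa = q times
   carry little mass, and the l^2 norm of the remaining mass at time
   t = log_b(dn) + O(1) is almost that of the uniform law; Cauchy-Schwarz gives
   the upper bound. For the lower bound, the walk reaches at most b^t of the dn
   directed edges. *)
Require Import Defs.
From mathcomp Require Import all_boot all_order all_algebra.
From mathcomp Require Import zify ring lra.

Set Implicit Arguments.
Unset Strict Implicit.
Unset Printing Implicit Defensive.

Import Order.TTheory GRing.Theory Num.Theory.

Local Open Scope ring_scope.

(** * Switchings *)

(** Write Q = b^q, so n is about Q^13. Each coincidence carries a weight y, and dividing by y^2
    counts the configurations with at least two of them. Two constraints limit y: up to powers of q
    it must stay below n, so that a step still costs about b, and y A kappa must stay below b^sigma,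
    to pay for walks that begin inside the revealed set. For the three walks at time 4q only the
    starting edge is revealed beforehand, so y can be nearly n, and a first moment gives Q^12 / n:
    this needs 3 * 4 < 13. With sigma = 4q, y is about Q^4, and the bound Q^14 y^-2 on pairs at time
    7q stays below Q^7 because 7 < 2 * 4. With sigma = 7q, y is about Q^7, and y^-2 is negligible
    against 1 / n because 13 < 2 * 7. Each inequality leaves a spare factor Q, which absorbs all
    powers of q. The moment order q^2 is large enough that exceeding the expectation bound by a
    constant factor has probability below 1 / n, and A = q^4 leaves room for the edges of q^2 pairs
    of walks of length O(q). *)

Section EdgeSets.
Variable n : nat.
Implicit Types (F G : {set 'I_n * 'I_n}) (u v w : 'I_n).

Definition symset F := forall u v, ((u, v) \in F) = ((v, u) \in F).
Definition nbrs F u := [set v | (u, v) \in F].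
Definition deg F u := #|nbrs F u|.
Definition link F u v := (u, v) |: ((v, u) |: F).

Lemma in_nbrs F u v : (v \in nbrs F u) = ((u, v) \in F).
Proof. by rewrite inE. Qed.

Lemma in_link F u v x y :
  ((x, y) \in link F u v) =
  [|| (x == u) && (y == v), (x == v) && (y == u) | (x, y) \in F].
Proof. by rewrite !in_setU1 !xpair_eqE. Qed.

Lemma link_sym F u v : symset F -> symset (link F u v).
Proof.
move=> sF x y; rewrite !in_link sF.
by case: (x == u); case: (x == v); case: (y == u); case: (y == v); rewrite ?orbT.
Qed.

Lemma sub_link F u v : F \subset link F u v.
Proof. by rewrite /link setUA subsetUr. Qed.

Lemma link_id F u v : symset F -> (u, v) \in F -> link F u v = F.
Proof.
move=> sF uvF; apply/setP => -[x y]; rewrite in_link.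
by case: andP => [[/eqP-> /eqP->] | _]; rewrite ?uvF //=;
  case: andP => [[/eqP-> /eqP->] | _]; rewrite // -sF uvF.
Qed.

Lemma card_link F u v : (#|link F u v| <= #|F| + 2)%N.
Proof.
rewrite !cardsU1 addnA addnC leq_add2l.
by case: (_ \notin _); case: (_ \notin _).
Qed.

Lemma link_subset F G u v : symset G ->
  (link F u v \subset G) = ((u, v) \in G) && (F \subset G).
Proof.
move=> sG; rewrite !subUset !sub1set (sG v u).
by case: ((u, v) \in G).
Qed.

Lemma degS F F' u : F \subset F' -> (deg F u <= deg F' u)%N.
Proof.
move=> /subsetP s; apply/subset_leq_card/subsetP => v; rewrite !in_nbrs; exact: s.
Qed.

Lemma deg_gt0 F u : (0 < deg F u)%N = [exists v, (u, v) \in F].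
Proof.
apply/card_gt0P/existsP => -[v]; first by rewrite in_nbrs => ?; exists v.
by move=> ?; exists v; rewrite in_nbrs.
Qed.

Lemma deg_gt0_mem F u v : (u, v) \in F -> (0 < deg F u)%N.
Proof. by move=> h; rewrite deg_gt0; apply/existsP; exists v. Qed.

Lemma sum_deg F : (\sum_u deg F u = #|F|)%N.
Proof.
transitivity (\sum_u \sum_(v | (u, v) \in F) 1)%N.
  by apply: eq_bigr => u _; rewrite /deg -sum1_card; apply: eq_bigl => v; rewrite in_nbrs.
by rewrite pair_big_dep -sum1_card; apply: eq_bigl => -[].
Qed.

Lemma card_support F : (#|[set u | deg F u != 0]| <= #|F|)%N.
Proof.
rewrite -sum_deg -sum1_card big_mkcond /=.
by apply: leq_sum => u _; rewrite inE; case: (deg F u).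
Qed.

Variable d : nat.

Lemma regularP G :
  reflect [/\ forall u, (u, u) \notin G, symset G & forall u, deg G u = d]
          (G \in regular_graphs n d).
Proof.
rewrite inE; apply: (iffP and3P) => -[h1 h2 h3]; split.
- by move=> u; have /forallP := h1.
- by move=> u v; have /forallP/(_ u)/forallP/(_ v)/eqP := h2.
- by move=> u; have /forallP/(_ u)/eqP := h3.
- exact/forallP.
- by apply/forallP => u; apply/forallP => v; rewrite h2.
- by apply/forallP => u; apply/eqP/h3.
Qed.

Definition exts F := [set G in regular_graphs n d | F \subset G].
Definition npr F := #|exts F|.

Lemma in_exts F G : (G \in exts F) = (G \in regular_graphs n d) && (F \subset G).
Proof. exact: in_set. Qed.

Lemma in_exts_link F u v G :
  (G \in exts (link F u v)) = (G \in exts F) && ((u, v) \in G).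
Proof.
rewrite !in_exts -andbA; case: (boolP (G \in _)) => // /regularP[_ sG _].
by rewrite link_subset //= andbC.
Qed.

Lemma npr_link_le F u v : (npr (link F u v) <= npr F)%N.
Proof.
apply/subset_leq_card/subsetP => G.
by rewrite in_exts_link => /andP[].
Qed.

Lemma npr_loop F u : npr (link F u u) = 0%N.
Proof.
apply/eqP; rewrite cards_eq0; apply/eqP/setP => G; rewrite in_exts_link in_exts in_set0.
by apply/negP => /andP[/andP[/regularP[h _ _] _]]; rewrite (negbTE (h u)).
Qed.

Lemma npr_deg F u : (0 < npr F)%N -> (deg F u <= d)%N.
Proof.
case/card_gt0P => G; rewrite in_exts => /andP[/regularP[_ _ h] s].
by rewrite -(h u) degS.
Qed.

Lemma card_regular G : G \in regular_graphs n d -> #|G| = (d * n)%N.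
Proof.
case/regularP => _ _ h; rewrite -sum_deg (eq_bigr (fun=> d)) //.
by rewrite sum_nat_const card_ord mulnC.
Qed.

Section Switch.
Variables (F : {set 'I_n * 'I_n}) (u v : 'I_n).
Hypotheses (sF : symset F) (uvF : (u, v) \notin F) (neq_uv : u != v).

Definition switch G (e : 'I_n * 'I_n) :=
  link (link (G :\: link (link set0 u v) e.1 e.2) u e.1) v e.2.

(** These conditions keep [F] inside the switched graph and prevent loops and double edges. Since v
    is a neighbour of u in the graphs considered, they also keep the four endpoints distinct. *)
Definition switchable G (e : 'I_n * 'I_n) :=
  [&& e \in G, e \notin F, e.1 \notin u |: nbrs G u & e.2 \notin v |: nbrs G v].

Definition switchback G (e : 'I_n * 'I_n) :=
  link (link (G :\: link (link set0 u e.1) v e.2) u v) e.1 e.2.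

(** The closed neighbourhood of u has d + 1 vertices, so (d + 1) d directed edges start in it; as
    many end in that of v. *)
Lemma switchable_card G : G \in exts (link F u v) ->
  (d * n - (#|F| + 2 * (d.+1 * d)) <= #|[set e | switchable G e]|)%N.
Proof.
rewrite in_exts_link in_exts -andbA => /and3P[rG FG uvG].
have [irr sG dG] := regularP G rG.
have cardN (w : 'I_n) : #|[set e in G | e.1 \in w |: nbrs G w]| = (d.+1 * d)%N.
  have -> : [set e in G | e.1 \in w |: nbrs G w] =
      \bigcup_(x in w |: nbrs G w) [set (x, y) | y in nbrs G x].
    apply/setP => -[x y]; rewrite in_set; apply/andP/bigcupP.
      by case=> h1 h2; exists x => //; apply/imsetP; exists y; rewrite ?in_nbrs.
    by case=> x' h1 /imsetP[y' +  [-> ->]]; rewrite in_nbrs.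
  transitivity (\sum_(x in w |: nbrs G w) d)%N.
    rewrite (eq_bigr (fun x => #|[set (x, y) | y in nbrs G x]|)); last first.
      by move=> x _; rewrite card_imset -?/(deg G x) ?dG // => ? ? [].
    rewrite -sum1_card (partition_big (fun e : 'I_n * 'I_n => e.1) (fun x => x \in w |: nbrs G w)) /=.
      apply: eq_bigr => x xw; rewrite -sum1_card; apply: eq_bigl => -[a b] /=.
      apply/andP/imsetP.
        case=> /bigcupP[x' _ /imsetP[y yx' [-> ->]]] /eqP<-; by exists y.
      case=> y yx [-> ->]; split=> //; apply/bigcupP; exists x => //.
      exact: imset_f.
    by move=> e /bigcupP[x' h /imsetP[y _ ->]].
  by rewrite sum_nat_const cardsU1 in_nbrs (negbTE (irr w)) /= -/(deg G w) dG add1n.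
have swapN (w : 'I_n) : #|[set e in G | e.2 \in w |: nbrs G w]| = (d.+1 * d)%N.
  rewrite -(cardN w) -(card_imset _ (can_inj (@swap_pairK _ _))).
  apply: eq_card => -[x y]; apply/imsetP/idP.
    by case=> -[a b]; rewrite in_set sG => h [-> ->]; rewrite in_set.
  by rewrite in_set => h; exists (y, x) => //; rewrite in_set sG.
rewrite -(card_regular rG).
have sub : G \subset [set e | switchable G e] :|: (F :|:
   ([set e in G | e.1 \in u |: nbrs G u] :|: [set e in G | e.2 \in v |: nbrs G v])).
  apply/subsetP => e eG; rewrite [e \in _]in_setU [e \in _]in_set /switchable eG /=.
  rewrite [in X in _ || X]in_setU.
  rewrite [e \in _ :|: _]in_setU ![e \in [set _ in _ | _]]in_set eG /=.
  by case: (e \in F); case: (e.1 \in _); case: (e.2 \in _).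
have := subset_leq_card sub; have := cardN u; have := swapN v.
set X := [set e in G | _]; set Y := [set e in G | _] => c1 c2.
have := leq_of_leqif (leq_card_setU [set e | switchable G e] (F :|: (Y :|: X))).
have := leq_of_leqif (leq_card_setU F (Y :|: X)).
have := leq_of_leqif (leq_card_setU Y X).
move=> h1 h2 h3 h4; rewrite leq_subLR; apply: (leq_trans h4); apply: (leq_trans h3).
rewrite addnC leq_add2r; apply: (leq_trans h2); rewrite leq_add2l.
by apply: (leq_trans h1); rewrite c1 c2 mul2n addnn.
Qed.

(** The two membership claims bound the number of possible [e] for a given image; the last claim
    makes the switching injective once [e] is remembered. *)
Lemma switch_exts G e : G \in exts (link F u v) -> switchable G e ->
  [/\ switch G e \in exts F, e.1 \in nbrs (switch G e) u :\: nbrs F u,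
      e.2 \in nbrs (switch G e) v :\: nbrs F v & switchback (switch G e) e = G].
Proof.
case: e => a b; rewrite in_exts_link in_exts -andbA => /and3P[rG FG uvG].
have [irr sG dG] := regularP G rG.
case/and4P; rewrite /= !in_setU1 !negb_or !in_nbrs => abG abF.
case/andP=> neq_au uaG /andP[neq_bv vbG].
have FGm x y : (x, y) \in F -> (x, y) \in G by move/subsetP: FG; apply.
have neq_ab : a != b by apply: contraTneq abG => ->; apply: irr.
have neq_av : a != v by apply: contraNneq uaG => ->.
have neq_bu : b != u by apply: contraNneq vbG => ->; rewrite sG.
have inS x y : ((x, y) \in switch G (a, b)) =
  [|| (x == v) && (y == b), (x == b) && (y == v), (x == u) && (y == a),
      (x == a) && (y == u) | [&& ~~ ((x == a) && (y == b)),
      ~~ ((x == b) && (y == a)), ~~ ((x == u) && (y == v)),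
      ~~ ((x == v) && (y == u)) & (x, y) \in G]].
  rewrite /switch !in_link in_setD !in_link in_set0 /= orbF.
  by rewrite !negb_or -!andbA.
have vuG : (v, u) \in G by rewrite sG.
have baG : (b, a) \in G by rewrite sG.
have auG : (a, u) \notin G by rewrite sG.
have bvG : (b, v) \notin G by rewrite sG.
have sS : symset (switch G (a, b)).
  move=> x y; rewrite !inS sG.
  case: (x == u); case: (x == v); case: (x == a); case: (x == b);
  by case: (y == u); case: (y == v); case: (y == a); case: (y == b).
have swap z t (X : {set 'I_n}) : z \in X -> t \notin X -> #|t |: (X :\ z)| = #|X|.
  by move=> zX tX; rewrite cardsU1 in_setD1 (negbTE tX) andbF /= (cardsD1 z X) zX.
split.
- rewrite in_exts; apply/andP; split; last first.
    apply/subsetP => -[x y] xyF; rewrite inS (FGm _ _ xyF) andbT.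
    have nF p q : (p, q) \notin F -> ~~ ((x == p) && (y == q)).
      by move=> h; apply: contraL xyF => /andP[/eqP-> /eqP->].
    by rewrite !nF ?orbT // sF.
  apply/regularP; split=> // [x|x].
    rewrite inS (negbTE (irr x)) !andbF orbF.
    by apply/negP => /or4P[] /andP[/eqP-> ]; rewrite ?(negbTE neq_bv) ?(negbTE neq_au) // eq_sym
      ?(negbTE neq_bv) ?(negbTE neq_au).
  have [ua vb vu ba] : [/\ u != a, v != b, v != u & b != a] by split; rewrite eq_sym.
  have [va ub] : v != a /\ u != b by split; rewrite eq_sym.
  have neqs := (negbTE ua, negbTE vb, negbTE vu, negbTE ba, negbTE va, negbTE ub,
    negbTE neq_uv, negbTE neq_au, negbTE neq_bv, negbTE neq_ab, negbTE neq_av, negbTE neq_bu).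
  rewrite /deg; have [->|xu] := eqVneq x u.
    rewrite -(dG u) /deg -(swap v a (nbrs G u)) ?in_nbrs //; apply: eq_card => y.
    by rewrite in_nbrs inS !inE !eqxx !neqs /=; case: eqVneq => //= _; rewrite ?andbT.
  have [->|xv] := eqVneq x v.
    rewrite -(dG v) /deg -(swap u b (nbrs G v)) ?in_nbrs //; apply: eq_card => y.
    by rewrite in_nbrs inS !inE !eqxx !neqs /=; case: eqVneq => //= _; rewrite ?andbT.
  have [->|xa] := eqVneq x a.
    rewrite -(dG a) /deg -(swap b u (nbrs G a)) ?in_nbrs //; apply: eq_card => y.
    by rewrite in_nbrs inS !inE !eqxx !neqs /=; case: eqVneq => //= _; rewrite ?andbT.
  have [->|xb] := eqVneq x b.
    rewrite -(dG b) /deg -(swap a v (nbrs G b)) ?in_nbrs //; apply: eq_card => y.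
    by rewrite in_nbrs inS !inE !eqxx !neqs /=; case: eqVneq => //= _; rewrite ?andbT.
  rewrite -(dG x) /deg; apply: eq_card => y.
  by rewrite !in_nbrs inS (negbTE xu) (negbTE xv) (negbTE xa) (negbTE xb).
- rewrite in_setD !in_nbrs /= inS !eqxx /= ?orbT andbT.
  by apply: contra uaG => /FGm.
- rewrite in_setD !in_nbrs /= inS !eqxx /= ?orbT andbT.
  by apply: contra vbG => /FGm.
apply/setP => -[x y]; rewrite /switchback; move: (switch G (a, b)) inS => S inS.
rewrite !in_link in_setD !in_link in_set0 /= orbF inS.
have hG p q : (p, q) \in G -> ((x == p) && (y == q)) ==> ((x, y) \in G).
  by move=> h; apply/implyP => /andP[/eqP-> /eqP->].
have hN p q : (p, q) \notin G -> ((x == p) && (y == q)) ==> ((x, y) \notin G).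
  by move=> h; apply/implyP => /andP[/eqP-> /eqP->].
move: (hG _ _ uvG) (hG _ _ abG) (hN _ _ uaG) (hN _ _ vbG).
move: (hG _ _ vuG) (hG _ _ baG) (hN _ _ auG) (hN _ _ bvG).
by do 2 (case: ((x == u) && _) => //=); do 2 (case: ((x == v) && _) => //=);
   do 2 (case: ((x == a) && _) => //=); do 2 (case: ((x == b) && _) => //=);
   case: (_ \in G).
Qed.

(** Double counting: [A] holds the graphs with a switchable edge, [B] the graphs with a choice of a
    neighbour of u and one of v outside [F], and switching injects [A] into [B]. *)
Lemma npr_switch : (npr (link F u v) * (d * n - (#|F| + 2 * (d.+1 * d))) <=
  (d - deg F u) * (d - deg F v) * npr F)%N.
Proof.
pose A := [set x : {set 'I_n * 'I_n} * ('I_n * 'I_n) |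
  (x.1 \in exts (link F u v)) && switchable x.1 x.2].
pose B := [set x : {set 'I_n * 'I_n} * ('I_n * 'I_n) |
  [&& x.1 \in exts F, x.2.1 \in nbrs x.1 u :\: nbrs F u &
      x.2.2 \in nbrs x.1 v :\: nbrs F v]].
have cardA : (npr (link F u v) * (d * n - (#|F| + 2 * (d.+1 * d))) <= #|A|)%N.
  rewrite -sum_nat_const.
  apply: (@leq_trans (\sum_(G in exts (link F u v)) #|[set e | switchable G e]|)).
    by apply: leq_sum => G; apply: switchable_card.
  rewrite (eq_bigr (fun G => \sum_(e | switchable G e) 1)%N); last first.
    by move=> G _; rewrite -sum1_card; apply: eq_bigl => e; rewrite inE.
  rewrite pair_big_dep -sum1_card leq_eqVlt; apply/orP; left; apply/eqP.
  by apply: eq_bigl => x; rewrite [RHS]in_set.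
have cardB : (#|B| <= (d - deg F u) * (d - deg F v) * npr F)%N.
  rewrite mulnC -sum_nat_const.
  apply: (@leq_trans (\sum_(G in exts F) #|setX (nbrs G u :\: nbrs F u) (nbrs G v :\: nbrs F v)|)).
    rewrite (eq_bigr (fun G => \sum_(e in setX (nbrs G u :\: nbrs F u) (nbrs G v :\: nbrs F v)) 1)%N); last first.
      by move=> G _; rewrite sum1_card.
    rewrite pair_big_dep -sum1_card leq_eqVlt; apply/orP; left; apply/eqP.
    by apply: eq_bigl => -[G [x y]]; rewrite [LHS]in_set in_setX.
  apply: leq_sum => G; rewrite in_exts => /andP[/regularP[_ _ dG] FG].
  have cD w : #|nbrs G w :\: nbrs F w| = (d - deg F w)%N.
    rewrite cardsD -(dG w); congr (_ - _)%N; apply: eq_card => x.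
    by rewrite in_setI !in_nbrs; apply: andb_idl; move/subsetP: FG; apply.
  by rewrite cardsX !cD.
apply: leq_trans cardA (leq_trans _ cardB).
pose f (x : {set 'I_n * 'I_n} * ('I_n * 'I_n)) := (switch x.1 x.2, x.2).
have f_inj : {in A &, injective f}.
  move=> [G e] [G' e']; rewrite ![_ \in A]in_set /= => /andP[h1 h2] /andP[h3 h4] [es ee].
  have [_ _ _ e1] := switch_exts h1 h2; have [_ _ _ e2] := switch_exts h3 h4.
  by rewrite -[in LHS]e1 es ee e2.
rewrite -(card_in_imset f_inj); apply/subset_leq_card/subsetP => _ /imsetP[[G e] + ->].
by rewrite [_ \in A]in_set [_ \in B]in_set /= => /andP[h1 h2]; have [-> -> -> _] := switch_exts h1 h2.
Qed.

End Switch.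
End EdgeSets.

(** * Walks revealed edge by edge *)

Section Walks.
Variable n : nat.
Implicit Types (F G : {set 'I_n * 'I_n}) (p u v w : 'I_n) (s : seq 'I_n) (t : nat).

(** Plain sequences instead of tuples, so that walks can be cut and concatenated without casts. *)
Fixpoint allseq t : seq (seq 'I_n) :=
  if t is t'.+1 then [seq v :: s | v <- enum 'I_n, s <- allseq t'] else [:: [::]].

Lemma mem_allseq t s : (s \in allseq t) = (size s == t).
Proof.
elim: t s => [|t IH] [|v s] //=; first by apply/negP => /allpairsP[[? ?] []].
rewrite eqSS -IH; apply/allpairsP/idP => [[[v' s'] [_ h [_ ->]]] //|h].
by exists (v, s); rewrite mem_enum.
Qed.

Lemma allseq_uniq t : uniq (allseq t).
Proof.
elim: t => //= t IH; apply: allpairs_uniq => //; first exact: enum_uniq.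
by move=> [v s] [v' s'] _ _ [-> ->].
Qed.

Section BigAllseq.
Variable R : nmodType.

Lemma big_allseqS t (f : seq 'I_n -> R) :
  \sum_(s <- allseq t.+1) f s = \sum_v \sum_(s <- allseq t) f (v :: s).
Proof. by rewrite big_allpairs_dep /= big_enum. Qed.

Lemma big_allseq_cat a b (f : seq 'I_n -> R) :
  \sum_(s <- allseq (a + b)) f s =
  \sum_(s1 <- allseq a) \sum_(s2 <- allseq b) f (s1 ++ s2).
Proof.
elim: a f => [|a IH] f; first by rewrite big_seq1.
by rewrite addSn !big_allseqS; apply: eq_bigr => v _; rewrite IH.
Qed.

End BigAllseq.

(** The state is the directed edge (p, u). Loops are excluded explicitly because the revealed sets
    are built from the sequence alone, before any simple graph contains them. *)
Fixpoint nbw p u s : bool :=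
  if s is v :: s' then [&& v != p, v != u & nbw u v s'] else true.

Definition epath F := path [rel x y | (x, y) \in F].

Definition walk F p u s := nbw p u s && epath F u s.

Fixpoint addw F u s := if s is v :: s' then addw (link F u v) v s' else F.

(* A step to an unused vertex costs about b in [pr], a step along an old edge
   costs nothing, and the remaining steps are the coincidences counted here. *)
Fixpoint nC F u s : nat :=
  if s is v :: s' then
    (((u, v) \notin F) && (deg F v != 0%N)) + nC (link F u v) v s'
  else 0.

Fixpoint lastE p u s := if s is v :: s' then lastE u v s' else (p, u).

Definition cnt F p u t z :=
  count (fun s => walk F p u s && (lastE p u s == z)) (allseq t).

Lemma lastE2 p u s : (lastE p u s).2 = last u s.
Proof. by elim: s p u => //= v s IH p u; rewrite IH. Qed.

Lemma lastE_cat p u s1 s2 :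
  lastE p u (s1 ++ s2) = lastE (lastE p u s1).1 (last u s1) s2.
Proof.
by elim: s1 p u => /=.
Qed.

Lemma nbw_cat p u s1 s2 :
  nbw p u (s1 ++ s2) = nbw p u s1 && nbw (lastE p u s1).1 (last u s1) s2.
Proof. by elim: s1 p u => //= v s1 IH p u; rewrite IH !andbA. Qed.

Lemma epath_cons F u v s : epath F u (v :: s) = ((u, v) \in F) && epath F v s.
Proof. by []. Qed.

Lemma epath_cat F u s1 s2 :
  epath F u (s1 ++ s2) = epath F u s1 && epath F (last u s1) s2.
Proof. exact: cat_path. Qed.

Lemma walk_cat F p u s1 s2 :
  walk F p u (s1 ++ s2) = walk F p u s1 && walk F (lastE p u s1).1 (last u s1) s2.
Proof. by rewrite /walk nbw_cat epath_cat andbACA. Qed.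

Lemma epathS F F' u s : F \subset F' -> epath F u s -> epath F' u s.
Proof. by move=> /subsetP sub; apply: sub_path => x y; apply: sub. Qed.

Lemma walkS F F' p u s : F \subset F' -> walk F p u s -> walk F' p u s.
Proof. by move=> sub /andP[h1 h2]; rewrite /walk h1 (epathS sub). Qed.

Lemma addw_sym F u s : symset F -> symset (addw F u s).
Proof. by elim: s F u => //= v s IH F u /(link_sym u v); apply: IH. Qed.

Lemma sub_addw F u s : F \subset addw F u s.
Proof. by elim: s F u => //= v s IH F u; apply: subset_trans (IH _ _); exact: sub_link. Qed.

Lemma addw_subset F G u s : symset G ->
  (addw F u s \subset G) = (F \subset G) && epath G u s.
Proof.
move=> sG; elim: s F u => [|v s IH] F u /=; first by rewrite andbT.
by rewrite IH link_subset // andbCA andbA.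
Qed.

Lemma epath_addw F u s : symset F -> epath (addw F u s) u s.
Proof.
move=> sF; have := subxx (addw F u s).
by rewrite addw_subset; [case/andP|exact: addw_sym].
Qed.

Lemma addwE F u s : addw F u s = F :|: addw set0 u s.
Proof.
elim: s F u => [|v s IH] F u /=; first by rewrite setU0.
rewrite IH [in RHS]IH; apply/setP => e; rewrite !in_setU !in_set1 in_set0 orbF.
by case: (e == _); case: (e == _); case: (e \in F).
Qed.

(** This lets a pair of walks be revealed in either order. *)
Lemma addwC F u s u' s' : addw (addw F u s) u' s' = addw (addw F u' s') u s.
Proof. by rewrite (addwE (addw F u s)) (addwE F u) (addwE (addw F u' s')) (addwE F u') setUAC. Qed.

Lemma card_addw F u s : (#|addw F u s| <= #|F| + 2 * size s)%N.
Proof.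
elim: s F u => [|v s IH] F u /=; first by rewrite muln0 addn0.
by apply: leq_trans (IH _ _) _; rewrite mulnS addnA leq_add2r card_link.
Qed.

Lemma addw_cat F u s1 s2 : addw F u (s1 ++ s2) = addw (addw F u s1) (last u s1) s2.
Proof. by elim: s1 F u => /=. Qed.

Lemma nC_cat F u s1 s2 :
  nC F u (s1 ++ s2) = (nC F u s1 + nC (addw F u s1) (last u s1) s2)%N.
Proof. by elim: s1 F u => //= v s1 IH F u; rewrite IH addnA. Qed.

Lemma addw_id F u s : symset F -> epath F u s -> addw F u s = F.
Proof.
by move=> sF; elim: s u => //= v s IH u /andP[h1 h2]; rewrite link_id // IH.
Qed.

Lemma nC_id F u s : symset F -> epath F u s -> nC F u s = 0%N.
Proof.
move=> sF; elim: s u => //= v s IH u /andP[h1 h2].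
by rewrite link_id // IH // h1.
Qed.

Lemma lastE_in F p u s : (p, u) \in F -> epath F u s -> lastE p u s \in F.
Proof. by elim: s p u => //= v s IH p u puF /andP[h1 h2]; apply: IH. Qed.

Lemma lastE_addw F p u s : symset F -> (p, u) \in F -> lastE p u s \in addw F u s.
Proof.
move=> sF puF; apply: lastE_in; last exact: epath_addw.
exact: (subsetP (sub_addw _ _ _)).
Qed.

Lemma cntS F F' p u t z : F \subset F' -> (cnt F p u t z <= cnt F' p u t z)%N.
Proof.
by move=> sub; apply: sub_count => s /andP[/(walkS sub) -> ->].
Qed.

End Walks.

(** * Weighted counts of walks *)

Section Weights.
Variables (R : realFieldType) (n d A : nat) (y : R).
Implicit Types (F G : {set 'I_n * 'I_n}) (p u v w : 'I_n) (s : seq 'I_n) (t : nat).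

Local Notation b := (d.-1).
Local Notation pr F := ((npr d F)%:R : R).

(* [A] bounds the number of directed edges revealed so far, so that [room]
   bounds the denominator of [npr_switch] from below; revealing one more step
   multiplies weighted sums by at most b * [lam] (see [sum_step]). *)
Definition room := (d * n - A)%N.
Definition lam : R := d%:R * (n%:R + y * A%:R) / room%:R.

Hypotheses (d0 : (0 < d)%N) (y1 : 1 <= y) (room0 : (0 < room)%N).

Let D0 : 0 < room%:R :> R.
Proof. by rewrite ltr0n. Qed.

Lemma lam_ge1 : 1 <= lam.
Proof.
rewrite /lam ler_pdivlMr // mul1r mulrDr ler_wpDr //.
  by rewrite !mulr_ge0 // (le_trans _ y1).
by rewrite -natrM ler_nat leq_subr.
Qed.

Lemma pr_link F u v : symset F -> (u, v) \notin F ->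
  (#|F| + 2 * (d.+1 * d) <= A)%N ->
  pr (link F u v) <= (d - deg F u)%:R * (d - deg F v)%:R / room%:R * pr F.
Proof.
move=> sF uvF hA; rewrite mulrAC ler_pdivlMr // -!natrM ler_nat.
have [->|neq_uv] := eqVneq u v; first by rewrite npr_loop.
apply: leq_trans (npr_switch d sF uvF neq_uv).
by rewrite leq_mul2l leq_sub2l ?orbT.
Qed.

(** Old edges offer at most deg - 1 continuations, since p is excluded. A new edge is paid by
    [pr_link]; at most n endpoints count 1 and at most A used ones count y more, giving (d - deg)
    [lam]. As [lam] is at least 1, the total is at most (d - 1) [lam]. *)
Lemma sum_step F p u : symset F -> (p, u) \in F -> (#|F| + 2 * (d.+1 * d) <= A)%N ->
  \sum_(v | (v != p) && (v != u))
    y ^+ (((u, v) \notin F) && (deg F v != 0%N)) * pr (link F u v)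
  <= b%:R * lam * pr F.
Proof.
move=> sF puF hA; have y0 : 0 <= y by apply: le_trans y1.
have lam1 := lam_ge1.
have [pF|] := posnP (npr d F).
  rewrite big1 ?pF ?mulr0 // => v _.
  have := npr_link_le d F u v; rewrite pF leqn0 => /eqP->; by rewrite mulr0.
move=> pF; have du := npr_deg u pF.
have upF : (u, p) \in F by rewrite sF.
have du0 : (0 < deg F u)%N by apply: deg_gt0_mem upF.
rewrite (bigID (fun v => (u, v) \in F)) /=.
have h1 : \sum_(v | (v != p) && (v != u) && ((u, v) \in F))
    y ^+ (((u, v) \notin F) && (deg F v != 0%N)) * pr (link F u v)
    <= (deg F u).-1%:R * pr F.
  rewrite (eq_bigr (fun=> pr F)); last first.
    by move=> v /andP[_ uvF]; rewrite uvF link_id //= mul1r.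
  rewrite sumr_const -[_ *+ _]mulr_natl ler_wpM2r // ler_nat.
  have -> : (deg F u).-1 = #|nbrs F u :\ p|.
    by rewrite /deg (cardsD1 p) in_nbrs upF.
  apply/subset_leq_card/subsetP => v; rewrite in_setD1 in_nbrs unfold_in.
  by case/andP => /andP[-> _ ->].
have h2 : \sum_(v | (v != p) && (v != u) && ((u, v) \notin F))
    y ^+ (((u, v) \notin F) && (deg F v != 0%N)) * pr (link F u v)
    <= (d - deg F u)%:R * lam * pr F.
  pose c := (d - deg F u)%:R * d%:R / room%:R * pr F.
  have c0 : 0 <= c by rewrite /c !mulr_ge0 // invr_ge0 ltW.
  apply: (@le_trans _ _ (\sum_v (1 + y * (deg F v != 0%N)%:R) * c)).
    rewrite [leRHS](bigID (fun v => (v != p) && (v != u) && ((u, v) \notin F))) /=.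
    apply: ler_wpDr.
      apply: sumr_ge0 => v _; apply: mulr_ge0 => //.
      by apply: addr_ge0 => //; apply: mulr_ge0.
    apply: ler_sum => v /andP[_ uvF]; rewrite uvF /=.
    apply: ler_pM => //; first exact: exprn_ge0.
      by case: (_ != _); rewrite ?expr1 ?mulr1 ?mulr0 ?addr0 // ler_wpDl.
    apply: le_trans (pr_link sF uvF hA) _; rewrite /c.
    apply: ler_wpM2r => //; apply: ler_wpM2r; first by rewrite invr_ge0 ltW.
    by apply: ler_wpM2l => //; rewrite ler_nat leq_subr.
  rewrite -mulr_suml big_split /= sumr_const card_ord -mulr_sumr.
  have -> : \sum_(v < n) ((deg F v != 0%N)%:R : R) = #|[set v | deg F v != 0%N]|%:R.
    by rewrite -natr_sum -sum1_card [in RHS]big_mkcond /=; congr _%:R;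
      apply: eq_bigr => v _; rewrite inE; case: (_ != _).
  have -> : (d - deg F u)%:R * lam * pr F = (n%:R + y * A%:R) * c.
    by rewrite /c /lam; ring.
  apply: ler_wpM2r => //; rewrite lerD2l; apply: ler_wpM2l => //.
  by rewrite ler_nat (leq_trans (card_support F)) //; lia.
apply: le_trans (lerD h1 h2) _; rewrite -mulrDl; apply: ler_wpM2r => //.
apply: (@le_trans _ _ ((deg F u).-1%:R * lam + (d - deg F u)%:R * lam)).
  by rewrite lerD2r ler_peMr.
by rewrite -mulrDl -natrD; apply: ler_wpM2r; rewrite ?(le_trans _ lam1) // ler_nat; lia.
Qed.

(** The weight works as an exponential moment: dividing by y^k bounds the walks with at least k
    coincidences. *)
Lemma sum_walks F p u t : symset F -> (p, u) \in F ->
  (#|F| + 2 * (d.+1 * d) + 2 * t <= A)%N ->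
  \sum_(s <- allseq n t | nbw p u s) y ^+ nC F u s * pr (addw F u s)
  <= (b%:R * lam) ^+ t * pr F.
Proof.
have bl0 : 0 <= b%:R * lam by rewrite mulr_ge0 // (le_trans _ lam_ge1).
elim: t F p u => [|t IH] F p u sF puF hA.
  by rewrite big_mkcond big_seq1 /= expr0 !mul1r.
rewrite big_mkcond big_allseqS /=.
apply: (@le_trans _ _ (\sum_(v | (v != p) && (v != u))
    (b%:R * lam) ^+ t *
    (y ^+ (((u, v) \notin F) && (deg F v != 0%N)) * pr (link F u v)))).
  rewrite [leRHS]big_mkcond; apply: ler_sum => v _.
  case: (boolP ((v != p) && (v != u))) => [/andP[-> ->]|h] /=; last first.
    by rewrite big1 // => s _; rewrite andbA (negbTE h).
  rewrite -big_mkcond /= mulrCA.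
  rewrite (eq_bigr (fun s => y ^+ ((((u, v) \notin F)) && (deg F v != 0%N)) *
     (y ^+ nC (link F u v) v s * pr (addw (link F u v) v s)))); last first.
    by move=> s _; rewrite exprD mulrA.
  rewrite -mulr_sumr; apply: ler_wpM2l; first by rewrite exprn_ge0 // (le_trans _ y1).
  apply: IH; first exact: link_sym.
    by rewrite in_link !eqxx.
  have aux (a c x : nat) : (a <= c + 2 -> a + x + 2 * t <= c + x + 2 * t.+1)%N by lia.
  by apply: leq_trans hA; apply: aux; apply: card_link.
rewrite -mulr_sumr exprSr -mulrA; apply: ler_wpM2l; first exact: exprn_ge0.
by apply: sum_step => //; apply: leq_trans hA; apply: leq_addr.
Qed.

End Weights.

(** * Walks without coincidences *)

Section Fresh.
Variable n : nat.
Implicit Types (F G : {set 'I_n * 'I_n}) (p u v w : 'I_n) (s : seq 'I_n) (t : nat).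

Lemma deg0_notin F u v : deg F u = 0%N -> (u, v) \notin F.
Proof. by move=> h; apply/negP => /deg_gt0_mem; rewrite h. Qed.

Lemma fresh_run F p u a v r : (forall w, (u, w) \in F -> w = p) ->
  nbw p u (a ++ v :: r) -> nC F u (a ++ v :: r) = 0%N -> deg (addw F u a) v = 0%N.
Proof.
elim: a F p u => [|x a IH] F p u hp /= /and3P[vp vu nb].
  have uvF : (u, v) \notin F by apply: contraNN vp => /hp ->.
  by rewrite uvF /=; case: (deg F v) => // k.
have uxF : (u, x) \notin F by apply: contraNN vp => /hp ->.
rewrite uxF /=; have [dx|] := eqVneq (deg F x) 0%N; last by move=> _ /=.
rewrite add0n; apply: (IH _ u) => // w; rewrite in_link (negbTE vu) eqxx /=.
by case: eqP => [-> //|_]; rewrite orFb => xw; have := deg0_notin w dx; rewrite xw.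
Qed.

Lemma fresh_new F p u a v r : symset F -> nbw p u (a ++ v :: r) ->
  nC F u (a ++ v :: r) = 0%N -> ~~ epath F u (rcons a v) ->
  deg (addw F u a) v = 0%N.
Proof.
move=> sF; elim: a p u => [|x a IH] p u /= /and3P[vp vu nb].
  by rewrite andbT => + uvF; rewrite uvF /=; case: (deg F v).
have [uxF|uxF] := boolP ((u, x) \in F).
  by rewrite /= add0n link_id // => h1 h2; apply: IH nb h1 h2.
rewrite /=; have [dx|] := eqVneq (deg F x) 0%N; last by [].
rewrite add0n => h _; apply: (fresh_run (p := u)) h => // w.
rewrite in_link (negbTE vu) eqxx /=.
by case: eqP => [-> //|_]; rewrite orFb => xw; have := deg0_notin w dx; rewrite xw.
Qed.

Lemma addw_notin F x r v z : v \notin x :: r -> (v, z) \in addw F x r -> (v, z) \in F.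
Proof.
elim: r F x => [|w r IH] F x //=; rewrite !inE !negb_or => /and3P[h1 h2 h3].
move/IH; rewrite inE negb_or h2 h3 => /(_ isT).
by rewrite in_link (negbTE h1) (negbTE h2).
Qed.

Lemma fresh_mid F p u a v x r : symset F -> nbw p u (a ++ v :: x :: r) ->
  nC F u (a ++ v :: x :: r) = 0%N -> ~~ epath F u (rcons a v) ->
  forall z, (v, z) \in addw F u (a ++ v :: x :: r) -> (z == last u a) || (z == x).
Proof.
move=> sF nb hC ep z.
have dv := fresh_new sF nb hC ep.
have nb' := nb; rewrite nbw_cat /= in nb'; case/and4P: nb' => _ vp vl /and3P[xl xv nbr].
rewrite addw_cat /=; move/addw_notin.
have -> : v \notin x :: r.
  rewrite inE eq_sym negb_or xv /=; apply/negP => /splitPr vr.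
  case: vr nb hC {nbr} => r1 r2 nb hC.
  have := @fresh_new F p u (a ++ v :: x :: r1) v r2 sF.
  rewrite -catA /= => /(_ nb hC); rewrite rcons_cat epath_cat /= => h.
  have {h} : deg (addw F u (a ++ v :: x :: r1)) v = 0%N.
    apply: h; apply: contraNN ep => /and3P[h1 h2 _].
    by rewrite -cats1 epath_cat h1 /= h2.
  move/(deg0_notin x)/negP; apply; rewrite addw_cat /=.
  by apply: (subsetP (sub_addw _ _ _)); rewrite in_link !eqxx.
move=> /(_ isT); rewrite in_link eqxx /= => /or3P[/eqP->|/andP[/eqP vx _]|].
- by rewrite eqxx orbT.
- by move: xv; rewrite vx eqxx.
rewrite in_link eqxx /= (negbTE vl) /= => /orP[/eqP->|]; first by rewrite eqxx.
by move=> h; have := deg0_notin z dv; rewrite h.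
Qed.

End Fresh.

(** * Walks with few companions at time sigma *)

Section Pairs.
Variables (R : realFieldType) (n d A : nat) (y : R).
Variables (sigma kappa : nat) (p u : 'I_n).
Implicit Types (F G : {set 'I_n * 'I_n}) (v w : 'I_n) (s : seq 'I_n) (t : nat).

Local Notation b := (d.-1).
Local Notation pr F := ((npr d F)%:R : R).
Local Notation lam := (lam n d A y).
Local Notation room := (room n d A).

Hypotheses (d3 : (2 < d)%N) (y1 : 1 <= y) (room0 : (0 < room)%N).
Hypotheses (sigma0 : (0 < sigma)%N) (hy : y * (A * kappa)%:R <= b%:R ^+ sigma).

Definition valid F s := (cnt F p u sigma (lastE p u (take sigma s)) <= kappa)%N.

(* A walk running inside [F] up to time [sigma] is charged one more coincidence.
   Validity leaves at most |F| * kappa such prefixes, far fewer than b^sigma, so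
   by [hy] they can afford the weight [y]. *)
Definition kap F s := (epath F u (take sigma s) + nC F u s)%N.

(** Validity in the whole graph passes to the revealed part, the only set available during the
    count. *)
Lemma validS F F' s : F \subset F' -> valid F' s -> valid F s.
Proof. by move=> h; apply: leq_trans; apply: cntS. Qed.

Lemma card_prefixes F : (p, u) \in F ->
  (\sum_(s <- allseq n sigma | walk F p u s && (cnt F p u sigma (lastE p u s) <= kappa)) 1
   <= #|F| * kappa)%N.
Proof.
move=> puF.
apply: (@leq_trans (\sum_(s <- allseq n sigma) \sum_(z in F)
   ((walk F p u s && (lastE p u s == z)) && (cnt F p u sigma z <= kappa)))).
  rewrite big_mkcond; apply: leq_sum => s _; case: ifP => // /andP[w c].
  rewrite (bigD1 (lastE p u s)) /=; last by case/andP: w => _; apply: lastE_in.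
  by rewrite w eqxx c.
rewrite exchange_big -sum_nat_const /=; apply: leq_sum => z _.
case: (leqP (cnt F p u sigma z) kappa) => h; last by rewrite big1 // => s _; rewrite andbF.
apply: leq_trans h; rewrite /cnt -sum1_count [leqRHS]big_mkcond.
by apply: leq_sum => s _; rewrite andbT; case: (_ && _).
Qed.

Let b0 : (0 < b)%N. Proof. by case: d d3 => [|[]]. Qed.
Let d0 : (0 < d)%N. Proof. exact: ltnW (ltnW d3). Qed.

(** The 2 stands for two classes of equal cost: all walks without the extra charge, and the walks
    inside [F] up to time sigma. The latter have at most A kappa prefixes, each followed by t -
    sigma ordinary steps. *)
Lemma sum_kap F t : symset F -> (p, u) \in F ->
  (#|F| + 2 * (d.+1 * d) + 2 * t <= A)%N -> (sigma <= t)%N ->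
  \sum_(s <- allseq n t | nbw p u s && valid F s) y ^+ kap F s * pr (addw F u s)
  <= 2 * (b%:R * lam) ^+ t * pr F.
Proof.
move=> sF puF hA st; have y0 : 0 <= y := le_trans ler01 y1.
have lam1 : 1 <= lam := lam_ge1 y1 room0.
have bl0 : 0 <= b%:R * lam by rewrite mulr_ge0 // (le_trans _ lam1).
have pos F' s : 0 <= y ^+ nC F' u s * pr (addw F' u s) by rewrite mulr_ge0 // exprn_ge0.
apply: (@le_trans _ _ (\sum_(s <- allseq n t | nbw p u s) y ^+ nC F u s * pr (addw F u s) +
  y * \sum_(s <- allseq n t | [&& nbw p u s, valid F s & epath F u (take sigma s)])
     y ^+ nC F u s * pr (addw F u s))).
  rewrite mulr_sumr [leLHS]big_mkcond [X in _ <= X + _]big_mkcond [X in _ <= _ + X]big_mkcond -big_split /=; apply: ler_sum => s _.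
  case: (nbw p u s) => /=; last by rewrite addr0.
  case: (valid F s) => /=; last by rewrite addr0.
  rewrite /kap; case: (epath _ _ _) => /=; last by rewrite addr0 add0n.
  by rewrite exprS -mulrA lerDr.
rewrite mulr2n mulrDl mulrDl mul1r; apply: lerD; first exact: sum_walks.
have -> : t = (sigma + (t - sigma))%N by rewrite subnKC.
set r := (t - sigma)%N; rewrite big_mkcond big_allseq_cat.
apply: (@le_trans _ _ (y * \sum_(s1 <- allseq n sigma | walk F p u s1 &&
   (cnt F p u sigma (lastE p u s1) <= kappa)%N) (b%:R * lam) ^+ r * pr F)).
  apply: ler_wpM2l => //; rewrite [leRHS]big_mkcond big_seq [leRHS]big_seq.
  apply: ler_sum => s1; rewrite mem_allseq => /eqP ss1.
  have tk s2 : take sigma (s1 ++ s2) = s1 by rewrite take_size_cat.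
  have [ep|nep] := boolP (epath F u s1); last first.
    rewrite big1 ?(fun_if (fun x => 0 <= x)) => [|s2 _].
      by case: ifP => // _; rewrite mulr_ge0 ?exprn_ge0.
    by rewrite tk (negbTE nep) !andbF.
  have -> : \sum_(s2 <- allseq n r) (if [&& nbw p u (s1 ++ s2), valid F (s1 ++ s2)
        & epath F u (take sigma (s1 ++ s2))] then
        y ^+ nC F u (s1 ++ s2) * pr (addw F u (s1 ++ s2)) else 0) =
     \sum_(s2 <- allseq n r) (if (walk F p u s1 && (cnt F p u sigma (lastE p u s1) <= kappa)%N)
      && nbw (lastE p u s1).1 (lastE p u s1).2 s2
      then y ^+ nC F (lastE p u s1).2 s2 * pr (addw F (lastE p u s1).2 s2) else 0).
    apply: eq_bigr => s2 _; rewrite lastE2 nbw_cat nC_cat addw_cat nC_id // add0n addw_id //.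
    by rewrite /valid tk ep andbT /walk ep andbT andbAC.
  case: ifP => [_|_] /=; last by rewrite big1.
  rewrite -big_mkcond; have := lastE_in puF ep.
  case: (lastE p u s1) => p' u' /= pu'F; apply: sum_walks => //.
  by apply: leq_trans hA; rewrite leq_add2l leq_mul2l /r leq_subr.
rewrite -[X in X ^+ (_ + _)]/(b%:R * lam) exprD.
under eq_bigr do rewrite -[_ * _]mul1r.
rewrite -mulr_suml mulrA -[leRHS]mulrA; apply: ler_wpM2r; first by rewrite mulr_ge0 ?exprn_ge0.
apply: (@le_trans _ _ (b%:R ^+ sigma)).
  apply: le_trans hy; apply: ler_wpM2l => //.
  apply: (@le_trans _ _ (\sum_(s <- allseq n sigma | walk F p u s &&
    (cnt F p u sigma (lastE p u s) <= kappa)) 1)%N%:R); first by rewrite natr_sum.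
  rewrite ler_nat; apply: leq_trans (card_prefixes puF) _; rewrite leq_mul2r; apply/orP; right.
  by apply: leq_trans hA; rewrite -addnA leq_addr.
by rewrite exprMn ler_peMr ?exprn_ge0 // exprn_ege1.
Qed.

Lemma kap_gt0 F s : symset F -> nbw p u s -> (sigma <= size s)%N ->
  (0 < deg F (last u s))%N -> (0 < kap F s)%N.
Proof.
move=> sF nb ss; apply: contraTT; rewrite -leqNgt leqn0 addn_eq0 eqb0 => /andP[ep /eqP hC].
case/lastP: s nb ss ep hC => [|a v] nb ss ep hC; first by move: ss; rewrite leqNgt sigma0.
rewrite last_rcons -leqNgt.
rewrite -cats1 in nb hC.
have ep' : ~~ epath F u (rcons a v).
  by apply: contraNN ep; rewrite -{1}(cat_take_drop sigma (rcons a v)) epath_cat; case/andP.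
by rewrite -(fresh_new sF nb hC ep') degS // sub_addw.
Qed.

End Pairs.

(** * Pairs of colliding walks *)

Section Pairs2.
Variables (R : realFieldType) (n d A : nat) (y : R).
Variables (sigma kappa : nat) (p u : 'I_n).
Implicit Types (F G : {set 'I_n * 'I_n}) (v w : 'I_n) (s : seq 'I_n) (t : nat).

Local Notation b := (d.-1).
Local Notation pr F := ((npr d F)%:R : R).
Local Notation lam := (lam n d A y).
Local Notation room := (room n d A).
Local Notation valid := (valid sigma kappa p u).
Local Notation kap := (kap sigma u).

Hypotheses (d3 : (2 < d)%N) (y1 : 1 <= y) (room0 : (0 < room)%N).
Hypotheses (sigma0 : (0 < sigma)%N) (hy : y * (A * kappa)%:R <= b%:R ^+ sigma).

Let d0 : (0 < d)%N. Proof. exact: ltnW (ltnW d3). Qed.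

(** Such pairs met by time sigma and stayed together; [vcnt_sq] counts them through the pairs
    meeting at time sigma. *)
Definition diag s s' :=
  (lastE p u (take sigma s) == lastE p u (take sigma s')) &&
  (drop sigma s == drop sigma s').

Definition colliding s s' :=
  [&& nbw p u s, nbw p u s', lastE p u s == lastE p u s' & ~~ diag s s'].

Definition pairC F s s' := [&& colliding s s', valid F s & valid F s'].

Definition generic F s s' := [&& colliding s s', kap F s == 0%N & kap F s' == 0%N].

Definition doubly F s s' :=
  [&& nbw p u s && valid F s, nbw p u s' && valid (addw F u s) s'
    & (1 < kap F s + kap (addw F u s) s')%N].

(** The common last edge was revealed by the first walk, so the second one ends at a used vertex. *)
Lemma kap_second F s s' : symset F -> (p, u) \in F -> colliding s s' ->
  size s = size s' -> (sigma <= size s)%N -> (0 < kap (addw F u s) s')%N.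
Proof.
move=> sF puF /and4P[nb nb' /eqP le _] ss ss'.
apply: (@kap_gt0 n sigma p u) => //.
- exact: addw_sym.
- by rewrite -ss.
have := lastE_addw s sF puF; rewrite le; move: (lastE2 p u s').
by case: (lastE p u s') => a c /= <-; rewrite (addw_sym u s sF); apply: deg_gt0_mem.
Qed.

Lemma colliding_sym s s' : colliding s s' = colliding s' s.
Proof.
rewrite /colliding /diag andbCA; congr [&& _, _, _ & _]; first exact: eq_sym.
by congr (~~ (_ && _)); apply: eq_sym.
Qed.

(* Two walks that collide without being generic create two coincidences in one
   of the two orders of revelation. *)
Lemma pairC_cases F s s' : symset F -> (p, u) \in F -> size s = size s' ->
  (sigma <= size s)%N -> pairC (addw (addw F u s) u s') s s' ->
  [|| doubly F s s', doubly F s' s | generic F s s'].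
Proof.
move=> sF puF ss st /and3P[col v v'].
have k1 := kap_second sF puF col ss st.
have st' : (sigma <= size s')%N by rewrite -ss.
have k2 : (0 < kap (addw F u s') s)%N.
  by apply: kap_second; rewrite // colliding_sym.
have [nb nb' _ _] := and4P col.
have sub2 : addw F u s \subset addw (addw F u s) u s' by apply: sub_addw.
have sub3 : addw F u s' \subset addw (addw F u s) u s'.
  by rewrite addwC; apply: sub_addw.
have sub1 : F \subset addw (addw F u s) u s' := subset_trans (sub_addw _ _ _) sub2.
rewrite /doubly /generic nb nb' col.
rewrite (validS sub1 v) (validS sub1 v') (validS sub2 v') (validS sub3 v) /=.
case: (posnP (kap F s)) => [->|h1]; last by rewrite (leq_add h1 k1).
case: (posnP (kap F s')) => [->|h2]; last by rewrite (leq_add h2 k2) orbT.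
by rewrite !orbT.
Qed.

(** The weights of such a pair multiply to at least y^2, so Markov's inequality gives y^-2, and
    [sum_kap] contributes a 2 for each walk. *)
Lemma sum_doubly F t : symset F -> (p, u) \in F ->
  (#|F| + 2 * (d.+1 * d) + 2 * t + 2 * t <= A)%N -> (sigma <= t)%N ->
  \sum_(s <- allseq n t) \sum_(s' <- allseq n t)
     (doubly F s s')%:R * pr (addw (addw F u s) u s')
  <= 4 * y ^- 2 * (b%:R * lam) ^+ (2 * t) * pr F.
Proof.
move=> sF puF hA st; have y0 : 0 < y := lt_le_trans ltr01 y1.
have lam1 : 1 <= lam := lam_ge1 y1 room0.
have bl0 : 0 <= b%:R * lam by rewrite mulr_ge0 // (le_trans _ lam1).
apply: (@le_trans _ _ (y ^- 2 * \sum_(s <- allseq n t | nbw p u s && valid F s)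
   y ^+ kap F s * \sum_(s' <- allseq n t | nbw p u s' && valid (addw F u s) s')
    y ^+ kap (addw F u s) s' * pr (addw (addw F u s) u s'))).
  rewrite mulr_sumr [leRHS]big_mkcond; apply: ler_sum => s _.
  case: ifP => [h|h]; last by rewrite big1 // => s' _; rewrite /doubly h mul0r.
  rewrite mulrA mulr_sumr [leRHS]big_mkcond; apply: ler_sum => s' _.
  rewrite /doubly h /=; case: ifP => [h'|h']; last by rewrite mul0r.
  case: (leqP 2 _) => hk; last first.
    by rewrite mul0r !mulr_ge0 // ?exprn_ge0 ?invr_ge0 ?exprn_ge0 // ltW.
  rewrite mul1r mulrA -[_ * _ * y ^+ _]mulrA -exprD -(subnK hk) exprD.
  rewrite mulrCA mulVf ?mulr1 ?expf_eq0 ?gt_eqF // ler_peMl //.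
  exact: exprn_ege1.
apply: (@le_trans _ _ (y ^- 2 * \sum_(s <- allseq n t | nbw p u s && valid F s)
   y ^+ kap F s * (2 * (b%:R * lam) ^+ t * pr (addw F u s)))).
  apply: ler_wpM2l; first by rewrite invr_ge0 exprn_ge0 // ltW.
  rewrite big_seq_cond [leRHS]big_seq_cond; apply: ler_sum => s /andP[+ _].
  rewrite mem_allseq => /eqP sz.
  apply: ler_wpM2l; first by rewrite exprn_ge0 // ltW.
  apply: (sum_kap (A := A)) => //; first exact: addw_sym.
    exact: (subsetP (sub_addw _ _ _)).
  apply: leq_trans hA; rewrite leq_add2r addnAC leq_add2r -sz; exact: card_addw.
have -> : \sum_(s <- allseq n t | nbw p u s && valid F s)
   y ^+ kap F s * (2 * (b%:R * lam) ^+ t * pr (addw F u s)) =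
   2 * (b%:R * lam) ^+ t * \sum_(s <- allseq n t | nbw p u s && valid F s)
   y ^+ kap F s * pr (addw F u s).
  by rewrite mulr_sumr; apply: eq_bigr => s _; rewrite mulrCA.
apply: (@le_trans _ _ (y ^- 2 * (2 * (b%:R * lam) ^+ t * (2 * (b%:R * lam) ^+ t * pr F)))).
  apply: ler_wpM2l; first by rewrite invr_ge0 exprn_ge0 // ltW.
  apply: ler_wpM2l; first by rewrite mulr_ge0 // exprn_ge0.
  apply: (sum_kap (A := A)) => //; apply: leq_trans hA; exact: leq_addr.
rewrite mulnC exprM; set X := _ ^+ t; rewrite le_eqVlt; apply/orP; left; apply/eqP.
by ring.
Qed.

Section Generic.
Variables (F : {set 'I_n * 'I_n}) (t : nat) (s : seq 'I_n).
Hypotheses (sF : symset F) (puF : (p, u) \in F) (sz : size s = t).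
Hypothesis (hA : (#|F| + 2 * (d.+1 * d) + 2 * t + 2 * t <= A)%N).
Hypothesis (st : (sigma <= t)%N).

(** Index i holds the vertex reached at time i + 1. It is the first vertex from which both sequences
    agree, and the walks enter it through different edges. *)
Definition merge_at i s' :=
  [&& generic F s s', drop i s' == drop i s, (sigma.-1 <= i)%N, (i.+1 < t)%N
    & last u (take i s') != last u (take i s)].

Lemma generic_merge s' : size s' = t -> generic F s s' ->
  exists i : 'I_t, merge_at i s'.
Proof.
move=> sz' gen; have /and3P[/and4P[_ _ /eqP le ndiag] _ _] := gen.
have ex : exists i, drop i s' == drop i s.
  by exists t; rewrite !drop_oversize ?sz ?sz'.
case: (ex_minnP ex) => i /eqP hi imin {ex}; rewrite /merge_at.
have t0 : (0 < t)%N by apply: leq_trans st.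
have ndiag' : s <> s' by move=> e; move: ndiag; rewrite e /diag !eqxx.
have lastE_drop r q : size q = r.+2 -> drop r q = [:: (lastE p u q).1; (lastE p u q).2].
  move=> h; rewrite -{2 3}(cat_take_drop r q) lastE_cat.
  have : size (drop r q) = 2 by rewrite size_drop h; lia.
  by case: (drop r q) => [|? [|? [|]]].
(* The common last edge fixes the last two vertices, so the sequences agree from index t - 2 at the
   latest; for t = 1 they would be equal. *)
have it : (i.+1 < t)%N.
  have lastE1 q q' : size q = 1%N -> size q' = 1%N -> lastE p u q = lastE p u q' -> q = q'.
    by case: q => [|? []] //; case: q' => [|? []] // _ _ [->].
  have [t1|t2] : t = 1%N \/ (1 < t)%N by lia.
    by case: ndiag'; apply: lastE1; rewrite -?t1.
  have h q : size q = t -> size q = t.-2.+2 by lia.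
  by have := imin t.-2; rewrite (lastE_drop _ _ (h _ _ sz)) (lastE_drop _ _ (h _ _ sz')) le eqxx => /(_ isT); lia.
have lastE_tail a1 a2 r : (1 < size r)%N -> lastE p u (a1 ++ r) = lastE p u (a2 ++ r).
  by rewrite !lastE_cat; case: r => [|? [|]].
(* Otherwise the edges at time sigma and all later vertices would agree, which is a [diag] pair. *)
have si : (sigma.-1 <= i)%N.
  rewrite leqNgt; apply/negP => lt; move/negP: ndiag; apply.
  have e q : size q = t -> take sigma q = take i q ++ take (sigma - i) (drop i q).
    move=> szq; have szi : size (take i q) = i by rewrite size_takel // szq; lia.
    by rewrite -{1}(cat_take_drop i q) take_cat szi ltnNge (_ : i <= sigma)%N //; lia.
  have sz2 q : size q = t -> (1 < size (take (sigma - i) (drop i q)))%N.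
    by move=> szq; rewrite size_takel ?size_drop ?szq; lia.
  apply/andP; split.
    by rewrite !e // hi; apply/eqP/lastE_tail; rewrite -hi sz2.
  have -> : sigma = ((sigma - i) + i)%N by lia.
  by rewrite -!drop_drop hi.
exists (Ordinal (ltnW it)); rewrite gen /= hi eqxx si it /=.
case: i hi imin it si => [|i] hi imin it si.
  by move: hi; rewrite !drop0 => e; case: ndiag'.
have i1 : (i < size s)%N by rewrite sz; lia.
have i1' : (i < size s')%N by rewrite sz'; lia.
rewrite (take_nth u i1) (take_nth u i1') !last_rcons.
apply/negP => /eqP e; suff /imin : drop i s' == drop i s by rewrite ltnn.
by rewrite (drop_nth u i1) (drop_nth u i1') e hi.
Qed.

(* The merging edge ends at a vertex of degree at least 2: besides the factor b
   it only gets b - 1, which the geometric sum over the merging time absorbs in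
   [sum_generic_fixed]. This is why the leading constant of [pair_rate] is 1. *)
Lemma merge_weight i s' : (i < t)%N -> size s' = t -> merge_at i s' ->
  pr (addw (addw F u s) u s') <=
  b%:R * (b.-1)%:R / room%:R * pr (addw (addw F u s) u (take i s')).
Proof.
move=> it sz' /and5P[/and3P[/and4P[nb nb' _ _] k0 k0'] /eqP hd si i1t neq].
have /eqP := k0; rewrite /kap => /eqP; rewrite addn_eq0 eqb0 => /andP[ep /eqP hC].
have /eqP := k0'; rewrite /kap => /eqP; rewrite addn_eq0 eqb0 => /andP[ep' /eqP hC'].
have [v [x [r hdr]]] : exists v x r, drop i s = v :: x :: r.
  have : (1 < size (drop i s))%N by rewrite size_drop sz; lia.
  by case: (drop i s) => [|v [|x r]] // _; exists v, x, r.
have es : s = take i s ++ v :: x :: r by rewrite -hdr cat_take_drop.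
have es' : s' = take i s' ++ v :: x :: r by rewrite -hdr -hd cat_take_drop.
have sza : size (take i s) = i by rewrite size_takel // sz ltnW.
have sza' : size (take i s') = i by rewrite size_takel // sz' ltnW.
move: (take i s) (take i s') es es' sza sza' neq => a a' es es' sza sza' neq.
have epa : ~~ epath F u (rcons a v).
  apply: contraNN ep; rewrite es -cat_rcons take_cat size_rcons sza.
  case: ltnP => h; last by rewrite (_ : sigma - i.+1 = 0)%N ?take0 ?cats0 //; lia.
  by rewrite -{1}(cat_take_drop sigma (rcons a v)) epath_cat; case/andP.
have epa' : ~~ epath F u (rcons a' v).
  apply: contraNN ep'; rewrite es' -cat_rcons take_cat size_rcons sza'.
  case: ltnP => h; last by rewrite (_ : sigma - i.+1 = 0)%N ?take0 ?cats0 //; lia.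
  by rewrite -{1}(cat_take_drop sigma (rcons a' v)) epath_cat; case/andP.
rewrite es in nb hC; rewrite es' in nb' hC'.
have mid := fresh_mid sF nb hC epa.
have new := fresh_new sF nb' hC' epa'.
set F1 := addw F u s; set F2 := addw F1 u a'; set w := last u a'.
have sF1 : symset F1 by apply: addw_sym.
have sF2 : symset F2 by apply: addw_sym.
have /and5P[_ _ _ xw _] : [&& true, true, true, x != w & true].
  by move: nb'; rewrite nbw_cat /= => /and5P[_ _ _ ->].
(* In [F1] the vertex v has only its two neighbours along s; w is not the first by [neq], nor the
   second because s' does not backtrack. *)
have vw : (v, w) \notin F1.
  apply/negP; rewrite /F1 es => /mid /orP[|]; first by rewrite (negbTE neq).
  by rewrite eq_sym (negbTE xw).
have wv2 : (w, v) \notin F2.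
  rewrite sF2 /F2 addwE in_setU (negbTE vw) /=.
  have := deg0_notin w new; rewrite addwE in_setU negb_or => /andP[_]; exact.
(* After the merging edge s' repeats s, so keeping only that edge loses nothing. *)
have le1 : pr (addw F1 u s') <= pr (link F2 w v).
  rewrite ler_nat; apply/subset_leq_card/subsetP => G; rewrite !in_exts => /andP[-> h] /=.
  apply: subset_trans h; rewrite es' addw_cat /= -/F2 -/w.
  exact: subset_trans (sub_link _ _ _) (sub_addw _ _ _).
apply: le_trans le1 _.
have cardF2 : (#|F2| + 2 * (d.+1 * d) <= A)%N.
  have aux (f f1 f2 X : nat) :
      (f1 <= f + 2 * t -> f2 <= f1 + 2 * i -> f2 + X <= f + X + 2 * t + 2 * t)%N.
    by move: it; clear; lia.
  apply: leq_trans hA; apply: (aux _ #|F1|).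
    by rewrite -{1}sz card_addw.
  by rewrite -sza' card_addw.
apply: le_trans (pr_link R room0 sF2 wv2 cardF2) _.
apply: ler_wpM2r => //; apply: ler_wpM2r; first by rewrite invr_ge0.
rewrite -!natrM ler_nat; apply: leq_mul.
  have : (0 < deg F2 w)%N.
    have := lastE_addw a' sF1 (subsetP (sub_addw F u s) _ puF).
    rewrite /w -(lastE2 p); case: (lastE p u a') => c e /=; rewrite -/F2 sF2.
    exact: deg_gt0_mem.
  by move=> h; rewrite -subn1 leq_sub2l.
(* Both edges of s at v are already revealed, which leaves at most d - 2 = b - 1 free places
   there. *)
suff h : (1 < deg F2 v)%N by rewrite -!subn1 -subnDA leq_sub2l.
have xa : x != last u a.
  by move: nb; rewrite nbw_cat /= -(lastE2 p); case/and5P.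
apply: (@leq_trans #|[set last u a; x]|); first by rewrite cards2 eq_sym xa.
apply/subset_leq_card; rewrite subUset !sub1set !in_nbrs.
have sub : F1 \subset F2 := sub_addw _ _ _.
rewrite !(subsetP sub) // /F1 es addw_cat /=; apply: (subsetP (sub_addw _ _ _)); rewrite !in_link !eqxx ?orbT //.
Qed.

(** The tail of s' is that of s, so only its first i steps are free, whence the exponent i. *)
Lemma sum_generic_at i : (i < t)%N ->
  \sum_(s' <- allseq n t) (merge_at i s')%:R * pr (addw (addw F u s) u s')
  <= b%:R * (b.-1)%:R / room%:R * (b%:R * lam) ^+ i * pr (addw F u s).
Proof.
move=> it; have y0 : 0 <= y := le_trans ler01 y1.
set c := _ / _; have c0 : 0 <= c by rewrite /c !mulr_ge0 // invr_ge0.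
set F1 := addw F u s.
apply: (@le_trans _ _ (\sum_(s' <- allseq n t)
   (nbw p u (take i s') && (drop i s' == drop i s))%:R * (c * pr (addw F1 u (take i s'))))).
  rewrite big_seq [leRHS]big_seq; apply: ler_sum => s'; rewrite mem_allseq => /eqP sz'.
  have [m|_] := boolP (merge_at i s'); last by rewrite mul0r mulr_ge0 // mulr_ge0.
  have /and5P[/and3P[/and4P[_ nb _ _] _ _] -> _ _ _] := m.
  rewrite -{1}(cat_take_drop i s') nbw_cat in nb; case/andP: nb => -> _.
  by rewrite !mul1r; apply: merge_weight.
rewrite -mulrA; have -> : t = (i + (t - i))%N by rewrite subnKC // ltnW.
rewrite big_allseq_cat.
apply: (@le_trans _ _ (\sum_(a <- allseq n i | nbw p u a) c * pr (addw F1 u a))).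
  rewrite [leRHS]big_mkcond big_seq [leRHS]big_seq; apply: ler_sum => a.
  rewrite mem_allseq => /eqP sza.
  rewrite (eq_bigr (fun r => (r == drop i s)%:R * ((nbw p u a)%:R * (c * pr (addw F1 u a))))).
    rewrite -mulr_suml.
    have -> : (if nbw p u a then c * pr (addw F1 u a) else 0) =
       (nbw p u a)%:R * (c * pr (addw F1 u a)) by case: (nbw p u a); rewrite ?mul1r ?mul0r.
    apply: ler_piMl; first by rewrite mulr_ge0 // mulr_ge0.
    apply: (@le_trans _ _ (count_mem (drop i s) (allseq n (t - i)))%:R).
      rewrite -sum1_count natr_sum [leRHS]big_mkcond; apply: ler_sum => r _ /=.
      by case: eqP.
    by rewrite lern1 count_uniq_mem ?allseq_uniq // leq_b1.
  by move=> r _; rewrite take_size_cat // drop_size_cat // -mulnb natrM [in RHS]mulrA [_ * (nbw _ _ _)%:R]mulrC.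
rewrite -mulr_sumr; apply: ler_wpM2l => //.
have puF1 : (p, u) \in F1 := subsetP (sub_addw _ _ _) _ puF.
have sF1 : symset F1 by apply: addw_sym.
apply: le_trans (sum_walks d0 y1 room0 sF1 puF1 _).
  apply: ler_sum => a _; rewrite ler_peMl // exprn_ege1 //.
have aux (f f1 X : nat) : (f1 <= f + 2 * t -> f1 + X + 2 * i <= f + X + 2 * t + 2 * t)%N.
  by move: it; clear; lia.
by apply: leq_trans hA; apply: aux; rewrite -{1}sz card_addw.
Qed.

Lemma sum_generic_fixed :
  \sum_(s' <- allseq n t) (generic F s s')%:R * pr (addw (addw F u s) u s')
  <= (b%:R * lam) ^+ t / room%:R * pr (addw F u s).
Proof.
have lam1 : 1 <= lam := lam_ge1 y1 room0.
have lam0 : 0 <= lam := le_trans ler01 lam1.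
apply: (@le_trans _ _ (\sum_(i < t.-1) b%:R * (b.-1)%:R / room%:R * (b%:R * lam) ^+ i * pr (addw F u s))).
  apply: (@le_trans _ _ (\sum_(i < t.-1) \sum_(s' <- allseq n t)
     (merge_at i s')%:R * pr (addw (addw F u s) u s'))); last first.
    apply: ler_sum => i _; apply: sum_generic_at.
    by apply: leq_trans (ltn_ord i) _; apply: leq_pred.
  rewrite exchange_big /= big_seq [leRHS]big_seq; apply: ler_sum => s'.
  rewrite mem_allseq => /eqP sz'; rewrite -mulr_suml; apply: ler_wpM2r => //.
  have [g|_] := boolP (generic F s s'); last exact: sumr_ge0.
  have [i m] := generic_merge sz' g.
  have it : (i < t.-1)%N by case/and5P: m; lia.
  by rewrite (bigD1 (Ordinal it)) //= m lerDl sumr_ge0.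
rewrite -mulr_suml; apply: ler_wpM2r => //.
rewrite -mulr_sumr [leLHS]mulrAC; apply: ler_wpM2r; first by rewrite invr_ge0.
apply: (@le_trans _ _ (b%:R * (b.-1)%:R * \sum_(i < t.-1) b%:R ^+ i * lam ^+ t)).
  apply: ler_wpM2l; first by rewrite mulr_ge0.
  apply: ler_sum => i _; rewrite exprMn; apply: ler_wpM2l; first exact: exprn_ge0.
  by apply: ler_weXn2l => //; have := ltn_ord i; lia.
rewrite -mulr_suml mulrA [leRHS]exprMn; apply: ler_wpM2r; first exact: exprn_ge0.
rewrite -mulrA; have -> : (b.-1)%:R = b%:R - 1 :> R.
  by rewrite -[in RHS](@prednK b) ?mulrSr ?addrK //; case: d d3 => [|[]].
(* The sum of b^i over i < t - 1, times b (b - 1), equals b (b^(t-1) - 1), which is below b^t. *)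
rewrite -subrX1; case: t st => [|r] /=; first by move=> /(leq_trans sigma0).
by rewrite exprS => _; rewrite ler_wpM2l // gerBl.
Qed.

End Generic.

Lemma sum_generic F t : symset F -> (p, u) \in F ->
  (#|F| + 2 * (d.+1 * d) + 2 * t + 2 * t <= A)%N -> (sigma <= t)%N ->
  \sum_(s <- allseq n t) \sum_(s' <- allseq n t)
     (generic F s s')%:R * pr (addw (addw F u s) u s')
  <= (b%:R * lam) ^+ (2 * t) / room%:R * pr F.
Proof.
move=> sF puF hA st.
have lam1 : 1 <= lam := lam_ge1 y1 room0.
have bl0 : 0 <= b%:R * lam by rewrite mulr_ge0 // (le_trans _ lam1).
set c := (b%:R * lam) ^+ t / room%:R.
have c0 : 0 <= c by rewrite /c mulr_ge0 ?exprn_ge0 ?invr_ge0.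
apply: (@le_trans _ _ (\sum_(s <- allseq n t | nbw p u s) c * pr (addw F u s))).
  rewrite [leRHS]big_mkcond big_seq [leRHS]big_seq; apply: ler_sum => s.
  rewrite mem_allseq => /eqP sz; case: ifP => nb; first exact: sum_generic_fixed.
  by rewrite big1 // => s' _; rewrite /generic /colliding nb mul0r.
have -> : (b%:R * lam) ^+ (2 * t) / room%:R * pr F = c * ((b%:R * lam) ^+ t * pr F).
  by rewrite /c mul2n -addnn exprD; ring.
rewrite -mulr_sumr; apply: ler_wpM2l => //.
apply: le_trans (sum_walks d0 y1 room0 sF puF (_ : _ + 2 * t <= A)%N).
  by apply: ler_sum => s _; rewrite ler_peMl // exprn_ege1.
by apply: leq_trans hA; apply: leq_addr.
Qed.

(** The main term comes from [generic] pairs; the 8 is the 4 of [sum_doubly] for each order of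
    revelation. *)
Definition pair_rate t : R := (b%:R * lam) ^+ (2 * t) * (room%:R^-1 + 8 * y ^- 2).

Lemma sum_pairC F t : symset F -> (p, u) \in F ->
  (#|F| + 2 * (d.+1 * d) + 2 * t + 2 * t <= A)%N -> (sigma <= t)%N ->
  \sum_(s <- allseq n t) \sum_(s' <- allseq n t)
    (pairC (addw (addw F u s) u s') s s')%:R * pr (addw (addw F u s) u s')
  <= pair_rate t * pr F.
Proof.
move=> sF puF hA st.
have h1 := sum_doubly sF puF hA st; have h2 := sum_generic sF puF hA st.
rewrite (_ : pair_rate t * pr F = 4 * y ^- 2 * (b%:R * lam) ^+ (2 * t) * pr F +
  (4 * y ^- 2 * (b%:R * lam) ^+ (2 * t) * pr F + (b%:R * lam) ^+ (2 * t) / room%:R * pr F));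
  last by rewrite /pair_rate; ring.
apply: le_trans (lerD h1 (lerD h1 h2)); rewrite [X in _ <= _ + (X + _)]exchange_big /=.
rewrite -!big_split big_seq [leRHS]big_seq; apply: ler_sum => s; rewrite mem_allseq => /eqP sz.
rewrite -!big_split big_seq [leRHS]big_seq; apply: ler_sum => s'; rewrite mem_allseq => /eqP sz'.
rewrite /= [addw (addw F u s') u s]addwC -!mulrDl; apply: ler_wpM2r => //.
have [c|_] := boolP (pairC _ _ _); last by rewrite !addr_ge0.
have := pairC_cases sF puF (etrans sz (esym sz')) _ c; rewrite sz => /(_ st).
by case/or3P => ->; rewrite ?lerDl ?addr_ge0 // addrCA ?lerDl ?addr_ge0 // addrA lerDr addr_ge0.
Qed.

End Pairs2.

(** * High moments of the number of colliding pairs *)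

Section Moments.
Variables (R : realFieldType) (n d A : nat) (y : R).
Variables (sigma kappa : nat) (p u : 'I_n).
Implicit Types (F G : {set 'I_n * 'I_n}) (v w : 'I_n) (s : seq 'I_n) (t : nat).

Local Notation b := (d.-1).
Local Notation pr F := ((npr d F)%:R : R).
Local Notation room := (room n d A).
Local Notation rate := (pair_rate n d A y).

Hypotheses (d3 : (2 < d)%N) (y1 : 1 <= y) (room0 : (0 < room)%N).
Hypotheses (sigma0 : (0 < sigma)%N) (hy : y * (A * kappa)%:R <= b%:R ^+ sigma).

Definition pair_in G s s' :=
  [&& epath G u s, epath G u s' & pairC sigma kappa p u G s s'].

Definition ncoll t G : R :=
  \sum_(s <- allseq n t) \sum_(s' <- allseq n t) (pair_in G s s')%:R.

Lemma ncoll_ge0 t G : 0 <= ncoll t G.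
Proof. by apply: sumr_ge0 => s _; apply: sumr_ge0. Qed.

Lemma rate_ge0 t : 0 <= rate t.
Proof.
have y0 : 0 <= y := le_trans ler01 y1.
rewrite /pair_rate mulr_ge0 //.
  by rewrite exprn_ge0 // mulr_ge0 // (le_trans ler01) // lam_ge1.
by rewrite addr_ge0 ?mulr_ge0 ?invr_ge0 ?exprn_ge0.
Qed.

(** One factor of the power is expanded and its pair revealed; the remaining power is bounded by
    induction on the enlarged set, at a cost of at most 4t directed edges. This is why all earlier
    bounds hold for arbitrary [F]. *)
Lemma moment_ncoll F t m : symset F -> (p, u) \in F -> (sigma <= t)%N ->
  (#|F| + 2 * (d.+1 * d) + 4 * t * m <= A)%N ->
  \sum_(G in exts d F) ncoll t G ^+ m <= rate t ^+ m * pr F.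
Proof.
move=> sF puF st; elim: m F sF puF => [|m IH] F sF puF hA.
  under eq_bigr do rewrite expr0.
  by rewrite sumr_const mul1r.
have hA' : (#|F| + 2 * (d.+1 * d) + 2 * t + 2 * t <= A)%N.
  by apply: leq_trans hA; rewrite -addnA leq_add2l mulnS -mulnDl leq_addr.
apply: (@le_trans _ _ (\sum_(s <- allseq n t) \sum_(s' <- allseq n t)
   (pairC sigma kappa p u (addw (addw F u s) u s') s s')%:R *
     (rate t ^+ m * pr (addw (addw F u s) u s')))); last first.
  have := sum_pairC d3 y1 room0 sigma0 hy sF puF hA' st.
  rewrite exprSr -mulrA => /(ler_wpM2l (exprn_ge0 m (rate_ge0 t))).
  apply: le_trans; rewrite mulr_sumr; apply: ler_sum => s _.
  by rewrite mulr_sumr; apply: ler_sum => s' _; rewrite mulrCA.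
under eq_bigr do rewrite exprS mulr_suml.
rewrite exchange_big /= big_seq [leRHS]big_seq; apply: ler_sum => s.
rewrite mem_allseq => /eqP sz.
under eq_bigr do rewrite mulr_suml.
rewrite exchange_big /= big_seq [leRHS]big_seq; apply: ler_sum => s'.
rewrite mem_allseq => /eqP sz'.
set F2 := addw _ u s'.
(* By antitonicity of validity, a pair that fails in [F2] fails in every graph containing it. *)
have [c|nc] := boolP (pairC sigma kappa p u F2 s s'); last first.
  rewrite mul0r big1 // => G; rewrite in_exts => /andP[/regularP[_ sG _] FG].
  rewrite /pair_in; case: (boolP (epath G u s)) => [e|_]; last by rewrite mul0r.
  case: (boolP (epath G u s')) => [e'|_]; last by rewrite mul0r.
  have sub : F2 \subset G by rewrite !addw_subset // FG e e'.
  case: (boolP (pairC _ _ _ _ _ _ _)) => [/and3P[c v v']|_]; last by rewrite mul0r.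
  by case/negP: nc; rewrite /pairC c (validS sub v) (validS sub v').
rewrite mul1r; apply: (@le_trans _ _ (\sum_(G in exts d F2) ncoll t G ^+ m)).
  rewrite [leLHS]big_mkcond [leRHS]big_mkcond; apply: ler_sum => G _.
  rewrite !in_exts; case: (boolP (G \in _)) => //= /regularP[_ sG _].
  rewrite !addw_subset // -andbA /pair_in; case: (F \subset G) => //=.
  case: (epath G u s); last by rewrite mul0r.
  case: (epath G u s'); last by rewrite mul0r.
  by rewrite /= ler_piMl ?exprn_ge0 ?ncoll_ge0 // lern1 leq_b1.
apply: IH; first by do 2 apply: addw_sym.
  by do 2 apply: (subsetP (sub_addw _ _ _)).
have h1 := card_addw F u s; have h2 := card_addw (addw F u s) u s'.
rewrite sz in h1; rewrite sz' in h2; apply: leq_trans hA.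
have aux (f f1 f2 X : nat) : (f1 <= f + 2 * t -> f2 <= f1 + 2 * t ->
  f2 + X + 4 * t * m <= f + X + 4 * t * m.+1)%N by clear; nia.
exact: aux h1 h2.
Qed.

Lemma tail_ncoll t m (beta : R) : 0 < beta -> (sigma <= t)%N ->
  (2 + 2 * (d.+1 * d) + 4 * t * m <= A)%N ->
  #|[set G in exts d (link set0 p u) | beta < ncoll t G]|%:R
  <= (rate t / beta) ^+ m * pr (link set0 p u).
Proof.
move=> beta0 st hA.
have s0 : symset (set0 : {set 'I_n * 'I_n}) by move=> x z; rewrite !in_set0.
have hA' : (#|link (set0 : {set 'I_n * 'I_n}) p u| + 2 * (d.+1 * d) + 4 * t * m <= A)%N.
  apply: leq_trans hA; rewrite !leq_add2r; apply: leq_trans (card_link _ _ _) _.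
  by rewrite cards0.
have := moment_ncoll (link_sym p u s0) _ st hA'.
rewrite in_link !eqxx => /(_ isT) le.
rewrite expr_div_n mulrAC ler_pdivlMr ?exprn_gt0 //; apply: le_trans le.
rewrite mulr_natl -sumr_const [leLHS]big_mkcond [leRHS]big_mkcond.
apply: ler_sum => G _; rewrite in_set; case: (G \in exts _ _) => //=.
case: ifP => h; last by rewrite exprn_ge0 // ncoll_ge0.
by apply: lerXn2r; rewrite ?nnegrE ?ncoll_ge0 // ltW.
Qed.

End Moments.

Section Union.
Variables (R : realFieldType) (n d : nat).
Variable (P : 'I_n -> 'I_n -> pred {set 'I_n * 'I_n}).

Lemma sum_npr1 :
  (\sum_(e : 'I_n * 'I_n) npr d (link set0 e.1 e.2) = d * n * #|regular_graphs n d|)%N.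
Proof.
transitivity (\sum_(e : 'I_n * 'I_n) \sum_(G in regular_graphs n d) (e \in G))%N.
  apply: eq_bigr => -[p u] _; rewrite /npr -sum1_card big_mkcond [RHS]big_mkcond /=.
  apply: eq_bigr => G _; rewrite in_exts; case: (boolP (G \in _)) => //= rG.
  have [_ sG _] := regularP _ _ rG.
  by rewrite link_subset // sub0set andbT; case: (_ \in G).
rewrite exchange_big mulnC -sum_nat_const; apply: eq_bigr => G rG.
rewrite -(card_regular rG) -sum1_card [RHS]big_mkcond /=.
by apply: eq_bigr => e _; case: (e \in G).
Qed.

(** Because each bound is relative to the graphs containing the starting edge, the union costs the
    dn edges of one graph and not the n^2 possible ones. *)
Lemma union_edges (c : R) : 0 <= c ->
  (forall p u, #|[set G in exts d (link set0 p u) | P p u G]|%:R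
     <= c * (npr d (link set0 p u))%:R) ->
  #|[set G in regular_graphs n d | [exists e in G, P e.1 e.2 G]]|%:R
  <= c * (d * n)%:R * #|regular_graphs n d|%:R.
Proof.
move=> c0 h; rewrite -mulrA -natrM -sum_npr1.
apply: (@le_trans _ _ (\sum_(e : 'I_n * 'I_n)
   #|[set G in exts d (link set0 e.1 e.2) | P e.1 e.2 G]|%:R)).
  rewrite -natr_sum ler_nat.
  apply: (@leq_trans #|\bigcup_(e : 'I_n * 'I_n) [set G in exts d (link set0 e.1 e.2) | P e.1 e.2 G]|).
    apply/subset_leq_card/subsetP => G; rewrite in_set => /andP[rG /exists_inP[[p u] eG Pe]].
    apply/bigcupP; exists (p, u) => //; rewrite in_set Pe andbT in_exts rG /=.
    by have [_ sG _] := regularP _ _ rG; rewrite link_subset // eG sub0set.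
  elim/big_rec2: _ => [|e k B _ le]; first by rewrite cards0.
  by apply: leq_trans (leq_of_leqif (leq_card_setU _ _)) _; rewrite leq_add2l.
by rewrite natr_sum mulr_sumr; apply: ler_sum => -[p u] _; apply: h.
Qed.

End Union.

(** * Three walks with the same endpoint *)

Section Unicyclic.
Variable n : nat.
Implicit Types (F G T : {set 'I_n * 'I_n}) (a b c p q u v : 'I_n) (g r s w : seq 'I_n).

Lemma walk_cons F q a v w :
  walk F q a (v :: w) = [&& v != q, v != a, (a, v) \in F & walk F a v w].
Proof.
rewrite /walk /=; case: (v != q); case: (v != a); case: ((a, v) \in F) => //=.
by rewrite andbF.
Qed.

(* [walk F a a w]: the first step of [w] is unconstrained, apart from not being
   a loop. *)
Lemma walkW F q a w : walk F q a w -> walk F a a w.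
Proof. by case: w => // v w; rewrite !walk_cons => /and4P[_ -> -> ->]. Qed.

(** Forests are described by uniqueness of non-backtracking walks between two vertices, the only
    property used below. *)
Definition acyclic T :=
  [/\ symset T, forall a, (a, a) \notin T &
   forall a w w', walk T a a w -> walk T a a w' -> last a w = last a w' -> w = w'].

Lemma acyclic0 : acyclic set0.
Proof.
by split=> [a b|a|a [|v w] [|v' w']]; rewrite ?walk_cons ?in_set0 ?andbF.
Qed.

(** From the leaf v a walk could only turn back to u, so v can occur only as the last vertex. *)
Lemma walk_pendant T u v q a w : symset T -> deg T v = 0%N -> a != v ->
  walk (link T u v) q a w ->
  (walk T q a w /\ v \notin w) \/
  exists w1, [/\ w = rcons w1 v, walk T q a w1, last a w1 = u & v \notin w1].
Proof.
move=> sT dv; have nv x : (v, x) \notin T by apply: deg0_notin.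
elim: w q a => [|x w IH] q a av; first by left.
rewrite walk_cons => /and4P[xq xa ax wk].
have [xv|xv] := eqVneq x v.
  right; exists [::]; move: ax; rewrite xv in_link eqxx andbT (negbTE av) /= sT (negbTE (nv a)).
  rewrite orbF => /eqP au; split => //.
  case: w wk {IH} => // z w; rewrite walk_cons => /and4P[za zx vz _].
  move: vz; rewrite xv in_link (negbTE (nv z)) orbF eqxx -au (negbTE za) andbF orbF.
  by rewrite eq_sym (negbTE av).
move: ax; rewrite in_link (negbTE av) (negbTE xv) andbF /= => ax.
case: (IH _ _ xv wk) => [[wk' vw]|[w1 [-> wk' lw vw]]].
  by left; rewrite walk_cons /= xq ax xa wk' inE eq_sym negb_or xv.
right; exists (x :: w1); split=> //; last by rewrite inE eq_sym negb_or xv.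
by rewrite walk_cons /= xq ax xa wk'.
Qed.

Lemma acyclic_pendant T u v : acyclic T -> deg T v = 0%N -> u != v ->
  acyclic (link T u v).
Proof.
move=> [sT lT uT] dv uv; have nv x : (v, x) \notin T by apply: deg0_notin.
split=> [|a|a w w']; first exact: link_sym.
  rewrite in_link (negbTE (lT a)) orbF.
  by apply/negP => /orP[]/andP[/eqP e1 /eqP e2]; rewrite -e1 -e2 eqxx in uv.
have [->|av] := eqVneq a v; last first.
  move=> /(walk_pendant sT dv av)[[k nw]|[w1 [-> k l _]]];
  move=> /(walk_pendant sT dv av)[[k' nw']|[w1' [-> k' l' _]]].
  - exact: uT.
  - rewrite last_rcons => e; case/negP: nw; rewrite -e.
    by have := mem_last a w; rewrite inE e (negbTE (_ : v != a)) // eq_sym.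
  - rewrite last_rcons => e; case/negP: nw'; rewrite e.
    by have := mem_last a w'; rewrite inE -e (negbTE (_ : v != a)) // eq_sym.
  - by rewrite !last_rcons => _; rewrite (uT a w1 w1') // l l'.
(* From the leaf the first step is forced. Returning to it would need a closed walk at u in the
   forest, which is empty and would make the return a backtrack. *)
have fromv z : walk (link T u v) v v z -> z = [::] \/
    exists z1, [/\ z = u :: z1, walk T u u z1 & v \notin z1].
  case: z => [|x z]; [by left|right; move: H; rewrite walk_cons => /and4P[xv _ vx wk]].
  have xu : x = u.
    by move: vx; rewrite in_link (negbTE (nv x)) eqxx (eq_sym v) (negbTE uv) /= orbF => /eqP.
  exists z; rewrite xu in wk *.
  case: (walk_pendant sT dv uv wk) => [[k nz]|[z1 [ez k l nz]]].
    by split=> //; apply: walkW k.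
  have z1nil : z1 = [::] by apply: (uT u) => //; apply: walkW k.
  by move: wk; rewrite ez z1nil walk_cons eqxx.
move=> /fromv[->|[z1 [-> k nz]]] /fromv[->|[z2 [-> k' nz']]] //=.
- move=> e; case/negP: nz'; have := mem_last u z2; rewrite -e inE.
  by rewrite eq_sym (negbTE uv).
- move=> e; case/negP: nz; have := mem_last u z1; rewrite e inE.
  by rewrite eq_sym (negbTE uv).
- by move=> e; rewrite (uT u z1 z2).
Qed.

(** Cancelling a backtrack shortens the path by two. The middle case is a backtrack over the edge
    (q, a) itself, which the caller cancels. *)
Lemma path_reduce T q a w : (q, a) \in T -> symset T -> (forall c, (c, c) \notin T) ->
  epath T a w ->
  [\/ walk T q a w, exists w', w = q :: w' |
    exists w', [/\ epath T a w', last a w' = last a w & (size w' < size w)%N]].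
Proof.
move=> + sT lT; elim: w q a => [|x w IH] q a qa; first by constructor 1.
rewrite epath_cons => /andP[ax ep].
case: (IH a x ax ep) => [wk|[w' ew]|[w' [ep' l sw]]].
- have [->|xq] := eqVneq x q; first by constructor 2; exists w.
  constructor 1; rewrite walk_cons xq ax wk !andbT /=.
  by apply: contraNneq (lT a) => e; rewrite -{2}e.
- constructor 3; exists w'; move: ep; rewrite ew epath_cons => /andP[_ ep'].
  by split=> //=; lia.
- by constructor 3; exists (x :: w'); split; rewrite ?epath_cons ?ax /= ?ltnS.
Qed.

(** Cancelling backtracks in w ends at the unique non-backtracking walk, which is g. *)
Lemma walk_shortest T a g w : acyclic T -> walk T a a g -> epath T a w ->
  last a g = last a w -> (size g <= size w)%N.
Proof.
move=> [sT lT uT] wg; elim: {w}_.+1 {-2}w (ltnSn (size w)) => // k IH w.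
case: w => [|x w] sw ep l; first by rewrite (uT a g [::]).
have xw := ep; rewrite epath_cons in xw; case/andP: xw => ax ep'.
have xa : x != a by apply: contraNneq (lT a) => e; rewrite -{2}e.
case: (path_reduce ax sT lT ep') => [wk|[w' ew]|[w' [ep2 l2 sw2]]].
- by rewrite (uT a g (x :: w)) // walk_cons xa ax wk.
- move: ep' l sw; rewrite ew epath_cons /= => /andP[_ ep2] l sw.
  by apply: leq_trans (IH w' _ ep2 l) _; lia.
- apply: leq_trans (IH (x :: w') _ _ _) _.
  + by move: sw sw2 => /=; clear; lia.
  + by rewrite epath_cons ax.
  + by rewrite l /= l2.
  + by move: sw2 => /=; clear; lia.
Qed.

Lemma linkC T a b : link T a b = link T b a.
Proof. by rewrite /link setUCA. Qed.

(** The walk is cut at its first crossing of the chord; the two last cases are the two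
    directions. *)
Lemma split_cross T a b q c w : walk (link T a b) q c w ->
  [\/ walk T q c w,
   exists g r, [/\ w = g ++ b :: r, walk T q c g, last c g = a & walk (link T a b) a b r] |
   exists g r, [/\ w = g ++ a :: r, walk T q c g, last c g = b & walk (link T a b) b a r]].
Proof.
elim: w q c => [|x w IH] q c; first by constructor 1.
rewrite walk_cons => /and4P[xq xc cx wk].
have [cxT|cxT] := boolP ((c, x) \in T); last first.
  move: cx; rewrite in_link (negbTE cxT) orbF => /orP[]/andP[/eqP ec /eqP ex].
    by constructor 2; exists [::], w; rewrite ec ex in wk *.
  by constructor 3; exists [::], w; rewrite ec ex in wk *.
have pre g : walk T c x g -> walk T q c (x :: g) by rewrite walk_cons xq xc cxT.
case: (IH _ _ wk) => [k|[g [r [e k l h]]]|[g [r [e k l h]]]].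
- by constructor 1; apply: pre.
- by constructor 2; exists (x :: g), r; rewrite e; split => //; apply: pre.
- by constructor 3; exists (x :: g), r; rewrite e; split => //; apply: pre.
Qed.

Section Chord.
Variables (T : {set 'I_n * 'I_n}).
Hypothesis (aT : acyclic T).

(** All crossings have the same direction: to cross back, the walk would first need a closed forest
    walk at b, which is empty, and would then backtrack. *)
Lemma chord_again a b r : walk (link T a b) a b r ->
  walk T b b r \/
  exists g r1, [/\ r = g ++ b :: r1, walk T b b g, last b g = a & walk (link T a b) a b r1].
Proof.
move=> wk; have [_ _ uT] := aT.
case: (split_cross wk) => [/walkW k|[g [r1 [e /walkW k l h]]]|[g [r1 [e k l h]]]].
- by left.
- by right; exists g, r1.
have g0 : g = [::] by apply: (uT b) => //; apply: walkW k.
by move: wk; rewrite e g0 walk_cons eqxx.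
Qed.

(** The witness is the stretch after the last crossing. *)
Lemma chord_tail a b r : walk (link T a b) a b r ->
  exists g, [/\ walk T b b g, last b g = last b r & (size g <= size r)%N].
Proof.
elim: {r}_.+1 {-2}r (ltnSn (size r)) => // k IH r sr.
case/chord_again => [h|[g [r1 [e h l h1]]]]; first by exists r.
case: (IH r1 _ h1); first by move: sr; rewrite e size_cat /=; lia.
move=> g1 [h2 l2 s2]; exists g1; split=> //; first by rewrite l2 e last_cat.
by rewrite e size_cat /=; lia.
Qed.

(** If only one walk crosses again, the other equals the first one's last stretch and is too short;
    if both do, their stretches up to that crossing agree and can be removed. *)
Lemma chord_unique a b r r' : walk (link T a b) a b r -> walk (link T a b) a b r' ->
  size r = size r' -> last b r = last b r' -> r = r'.
Proof.
have [_ _ uT] := aT.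
elim: {r}_.+1 {-2}r (ltnSn (size r)) r' => // k IH r sr r'.
case/chord_again => [h|[g [r1 [e h l h1]]]];
case/chord_again => [h'|[g' [r1' [e' h' l' h1']]]] ss ll.
- exact: (uT b).
- have [g1 [w1 lg sg]] := chord_tail h1'.
  have eg : r = g1 by apply: (uT b) => //; rewrite ll e' last_cat.
  by move: ss; rewrite eg e' size_cat /=; lia.
- have [g1 [w1 lg sg]] := chord_tail h1.
  have eg : r' = g1 by apply: (uT b) => //; rewrite -ll e last_cat.
  by move: ss; rewrite eg e size_cat /=; lia.
have eg : g = g' by apply: (uT b) => //; rewrite l l'.
rewrite e e' eg; congr (_ ++ _ :: _); apply: IH => //.
- by move: sr; rewrite e size_cat /=; lia.
- by move: ss; rewrite e e' eg !size_cat /=; lia.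
- by move: ll; rewrite e e' !last_cat.
Qed.

(* Without its chord the graph is a forest, so a non-backtracking walk is
   determined by how often, and in which direction, it crosses the chord; its
   length then determines the number of crossings. A walk avoiding the chord
   cannot have the length of walks crossing it in both directions, by the
   triangle inequality in the forest. *)
Lemma three_walks_chord a b c w1 w2 w3 :
  walk (link T a b) c c w1 -> walk (link T a b) c c w2 -> walk (link T a b) c c w3 ->
  size w1 = size w2 -> size w2 = size w3 ->
  last c w1 = last c w2 -> last c w2 = last c w3 ->
  [\/ w1 = w2, w1 = w3 | w2 = w3].
Proof.
have [sT lT uT] := aT.
pose crossing a' b' w := exists g r,
  [/\ w = g ++ b' :: r, walk T c c g, last c g = a' & walk (link T a' b') a' b' r].
have cross_eq a' b' w w' : crossing a' b' w -> crossing a' b' w' ->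
    size w = size w' -> last c w = last c w' -> w = w'.
  move=> [g [r [e h l h1]]] [g' [r' [e' h' l' h1']]] ss ll.
  have eg : g = g' by apply: (uT c) => //; rewrite l l'.
  rewrite e e' eg; congr (_ ++ _ :: _); apply: (chord_unique h1 h1').
    by move: ss; rewrite e e' eg !size_cat /=; lia.
  by move: ll; rewrite e e' !last_cat.
have cross3 w w' w'' : walk T c c w -> crossing a b w' -> crossing b a w'' ->
    size w = size w' -> size w = size w'' -> last c w = last c w' ->
    last c w = last c w'' -> False.
  move=> hw [g [r [e h l h1]]] [g' [r' [e' h' l' h1']]] s1 s2 l1 l2.
  have [z [hz lz sz]] := chord_tail h1; have [z' [hz' lz' sz']] := chord_tail h1'.
  (* Exchanging tails: g followed by z', and g' followed by z, avoid the chord and end where w does.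
     Together they save at least the two chord steps, while each is at least as long as w. *)
  have k1 : (size w <= size (g ++ z'))%N.
    apply: (walk_shortest aT hw); last by rewrite last_cat l lz' l2 e' last_cat.
    by rewrite epath_cat l; case/andP: h => _ ->; case/andP: hz'.
  have k2 : (size w <= size (g' ++ z))%N.
    apply: (walk_shortest aT hw); last by rewrite last_cat l' lz l1 e last_cat.
    by rewrite epath_cat l'; case/andP: h' => _ ->; case/andP: hz.
  by move: k1 k2 s1 s2 sz sz'; rewrite e e' !size_cat /=; clear; lia.
have cls w : walk (link T a b) c c w -> [\/ walk T c c w, crossing a b w | crossing b a w].
  move=> /split_cross[?|[g [r h]]|[g [r h]]]; first by constructor 1.
    by constructor 2; exists g, r.
  by constructor 3; exists g, r; rewrite (linkC T b a).
move=> /cls h1 /cls h2 /cls h3 s12 s23 l12 l23.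
have s13 := etrans s12 s23; have l13 := etrans l12 l23.
case: h1 => h1; case: h2 => h2; case: h3 => h3;
  first [by constructor 1; apply: (uT c) | by constructor 2; apply: (uT c)
  | by constructor 3; apply: (uT c) | by constructor 1; apply: (cross_eq a b)
  | by constructor 2; apply: (cross_eq a b) | by constructor 3; apply: (cross_eq a b)
  | by constructor 1; apply: (cross_eq b a) | by constructor 2; apply: (cross_eq b a)
  | by constructor 3; apply: (cross_eq b a)
  | by case: (cross3 w1 w2 w3) | by case: (cross3 w1 w3 w2) | by case: (cross3 w2 w1 w3)
  | by case: (cross3 w2 w3 w1) | by case: (cross3 w3 w1 w2) | by case: (cross3 w3 w2 w1)].
Qed.

End Chord.

Definition near_acyclic k F := exists T, acyclic T /\
  (F = T \/ ((0 < k)%N /\ exists a b, a != b /\ F = link T a b)).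

Lemma near_acyclic_addw k F u p s : near_acyclic k F -> nbw p u s ->
  (k + nC F u s <= 1)%N -> near_acyclic (k + nC F u s) (addw F u s).
Proof.
elim: s p u k F => [|v s IH] p u k F /=; first by rewrite addn0.
move=> nF /and3P[vp vu nb]; rewrite addnA.
have uv : u != v by rewrite eq_sym.
suff h : (k + ((u, v) \notin F) && (deg F v != 0) <= 1)%N ->
    near_acyclic (k + ((u, v) \notin F) && (deg F v != 0))%N (link F u v).
  by move=> h1; apply: (IH u) => //; apply: h; apply: leq_trans h1; apply: leq_addr.
case: nF => T [aT hF]; have [sT _ _] := aT.
have sF : symset F by case: hF => [->|[_ [a [b [_ ->]]]]] //; apply: link_sym.
have [uvF|uvF] := boolP ((u, v) \in F).
  by rewrite addn0 link_id // => _; exists T.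
have [dv|dv] := eqVneq (deg F v) 0%N.
  rewrite addn0 => _; exists (link T u v); split.
    apply: acyclic_pendant => //; apply/eqP; rewrite -leqn0 -dv.
    by apply: degS; case: hF => [->//|[_ [a [b [_ ->]]]]]; apply: sub_link.
  case: hF => [->|[k0 [a [b [ab ->]]]]]; first by left.
  right; split=> //; exists a, b; split=> //.
  by apply/setP => e; rewrite !inE; do 4 (case: (e == _)).
rewrite addn1 ltnS leqn0 => /eqP k0; case: hF => [FT|[]]; last by rewrite k0.
by exists T; split=> //; right; split => //; exists u, v; rewrite FT.
Qed.

Lemma three_walks p u s1 s2 s3 :
  let F0 := link set0 p u in
  let F1 := addw F0 u s1 in let F2 := addw F1 u s2 in
  p != u -> nbw p u s1 -> nbw p u s2 -> nbw p u s3 ->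
  size s1 = size s2 -> size s2 = size s3 ->
  lastE p u s1 = lastE p u s2 -> lastE p u s2 = lastE p u s3 ->
  [&& s1 != s2, s1 != s3 & s2 != s3] ->
  (1 < nC F0 u s1 + nC F1 u s2 + nC F2 u s3)%N.
Proof.
move=> F0 F1 F2 pu n1 n2 n3 z12 z23 l12 l23 dist; rewrite ltnNge; apply/negP => le1.
have s0 : symset (set0 : {set 'I_n * 'I_n}) by case: acyclic0.
have sF0 : symset F0 by apply: link_sym.
have sF1 : symset F1 by apply: addw_sym.
have sF2 : symset F2 by apply: addw_sym.
have k0 : near_acyclic 0 F0.
  exists F0; split; last by left.
  apply: acyclic_pendant => //; first exact: acyclic0.
  by apply/eqP; rewrite cards_eq0; apply/eqP/setP => x; rewrite in_nbrs !in_set0.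
have k1 := near_acyclic_addw k0 n1 (leq_trans (leq_addr _ _) (leq_trans (leq_addr _ _) le1)).
have k2 := near_acyclic_addw k1 n2 (leq_trans (leq_addr _ _) le1).
have := near_acyclic_addw k2 n3 le1; set F3 := addw _ u s3 => k3.
(* Without a coincidence any chord will do; p u is at hand. *)
have [T [a [b [aT ab sub]]]] : exists T a b, [/\ acyclic T, a != b & F3 \subset link T a b].
  case: k3 => T [aT [->|[_ [a [b [ab ->]]]]]]; last by exists T, a, b.
  by exists T, p, u; split => //; apply: sub_link.
have w1 : walk F3 p u s1.
  rewrite /walk n1 (@epathS _ F1) //; last exact: epath_addw.
  exact: subset_trans (sub_addw _ _ _) (sub_addw _ _ _).
have w2 : walk F3 p u s2.
  rewrite /walk n2 (@epathS _ F2) //; last exact: epath_addw.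
  exact: sub_addw.
have w3 : walk F3 p u s3 by rewrite /walk n3 epath_addw.
have puF : (p, u) \in F3.
  by do 3 apply: (subsetP (sub_addw _ _ _)); rewrite in_link !eqxx.
(* Started from p, the walks have an unconstrained first step, as [three_walks_chord] requires. *)
have cons s : walk F3 p u s -> walk (link T a b) p p (u :: s).
  by move=> h; apply: (walkS sub); rewrite walk_cons eq_sym pu puF.
have lastq s s' : lastE p u s = lastE p u s' -> last p (u :: s) = last p (u :: s').
  by move=> e; rewrite /= -!(lastE2 p) e.
case: (three_walks_chord aT (cons _ w1) (cons _ w2) (cons _ w3) _ _ (lastq _ _ l12) (lastq _ _ l23)).
- by rewrite /= z12.
- by rewrite /= z23.
- by case=> e; move: dist; rewrite e eqxx.
- by case=> e; move: dist; rewrite e eqxx andbF.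
- by case=> e; move: dist; rewrite e eqxx !andbF.
Qed.

End Unicyclic.

Section Triples.
Variables (R : realFieldType) (n d A : nat) (y : R).
Implicit Types (p u : 'I_n) (s : seq 'I_n).
Local Notation b := (d.-1).
Local Notation pr F := ((npr d F)%:R : R).
Local Notation lam := (lam n d A y).
Hypotheses (d0 : (0 < d)%N) (y1 : 1 <= y) (room0 : (0 < room n d A)%N).

Definition multiple t p u (G : {set 'I_n * 'I_n}) :=
  [exists z, (2 < cnt G p u t z)%N].

Definition triple p u s1 s2 s3 :=
  [&& nbw p u s1, nbw p u s2, nbw p u s3, lastE p u s1 == lastE p u s2,
    lastE p u s2 == lastE p u s3 & [&& s1 != s2, s1 != s3 & s2 != s3]].

Lemma multiple_triple t p u G : multiple t p u G ->
  exists s1 s2 s3, [/\ size s1 = t, size s2 = t, size s3 = t, triple p u s1 s2 s3 &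
    [&& epath G u s1, epath G u s2 & epath G u s3]].
Proof.
case/existsP => z; rewrite /cnt -size_filter.
set l := filter _ _; have ul : uniq l by rewrite filter_uniq ?allseq_uniq.
have hl s : s \in l -> [/\ nbw p u s, epath G u s, lastE p u s = z & size s = t].
  by rewrite mem_filter mem_allseq => /andP[/andP[/andP[-> ->] /eqP->] /eqP->].
case: l ul hl => [|s1 [|s2 [|s3 l]]] //= /and3P[h1 h2 h3] hl _.
have [|n1 e1 l1 z1] := hl s1; first by rewrite inE eqxx.
have [|n2 e2 l2 z2] := hl s2; first by rewrite !inE eqxx orbT.
have [|n3 e3 l3 z3] := hl s3; first by rewrite !inE eqxx !orbT.
exists s1, s2, s3; split; rewrite ?e1 ?e2 ?e3 //.
rewrite /triple n1 n2 n3 l1 l2 l3 eqxx /=.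
by move: h1 h2; rewrite !inE !negb_or => /and3P[-> -> _] /andP[->].
Qed.

(** By [three_walks] every triple has two coincidences, hence y^-2, and each of the three walks
    contributes its own count. *)
Lemma tail_multiple t p u :
  (2 + 2 * (d.+1 * d) + 6 * t <= A)%N ->
  #|[set G in exts d (link set0 p u) | multiple t p u G]|%:R
  <= y ^- 2 * (b%:R * lam) ^+ (3 * t) * pr (link set0 p u).
Proof.
move=> hA; have y0 : 0 < y := lt_le_trans ltr01 y1.
have y0' := ltW y0.
have lam1 : 1 <= lam := lam_ge1 y1 room0.
have bl0 : 0 <= b%:R * lam by rewrite mulr_ge0 // (le_trans _ lam1).
have iy0 : 0 <= y ^- 2 by rewrite invr_ge0 exprn_ge0.
have [pu|pu] := eqVneq p u.
  rewrite pu npr_loop mulr0 (_ : [set _ in _ | _] = set0) ?cards0 //.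
  apply/setP => G; rewrite in_set in_set0; apply/negP => /andP[h _].
  by have := npr_loop d set0 u; move/eqP; rewrite cards_eq0 => /eqP e; rewrite e in_set0 in h.
set F0 := link set0 p u; pose F1 s1 := addw F0 u s1; pose F2 s1 s2 := addw (F1 s1) u s2.
have s0 : symset (set0 : {set 'I_n * 'I_n}) by move=> x z; rewrite !in_set0.
have sF0 : symset F0 by apply: link_sym.
have sF1 s1 : symset (F1 s1) by apply: addw_sym.
have sF2 s1 s2 : symset (F2 s1 s2) by apply: addw_sym.
have m0 : (p, u) \in F0 by rewrite in_link !eqxx.
have m1 s1 : (p, u) \in F1 s1 by apply: (subsetP (sub_addw _ _ _)).
have m2 s1 s2 : (p, u) \in F2 s1 s2 by apply: (subsetP (sub_addw _ _ _)).
have c0 : (#|F0| <= 2)%N by apply: leq_trans (card_link _ _ _) _; rewrite cards0.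
have c1 s1 : size s1 = t -> (#|F1 s1| <= 2 + 2 * t)%N.
  by move=> z1; apply: leq_trans (card_addw _ _ _) _; rewrite z1 leq_add2r.
have c2 s1 s2 : size s1 = t -> size s2 = t -> (#|F2 s1 s2| <= 2 + 4 * t)%N.
  move=> z1 z2; apply: leq_trans (card_addw _ _ _) _; rewrite z2.
  by apply: leq_trans (leq_add (c1 _ z1) (leqnn _)) _; rewrite -addnA leq_add2l -mulnDl.
apply: (@le_trans _ _ (\sum_(s1 <- allseq n t) \sum_(s2 <- allseq n t) \sum_(s3 <- allseq n t)
  (triple p u s1 s2 s3)%:R * pr (addw (F2 s1 s2) u s3))).
  apply: (@le_trans _ _ (\sum_(s1 <- allseq n t) \sum_(s2 <- allseq n t) \sum_(s3 <- allseq n t)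
    \sum_(G in exts d F0) (triple p u s1 s2 s3 &&
      [&& epath G u s1, epath G u s2 & epath G u s3])%:R)).
    have -> : (#|[set G in exts d F0 | multiple t p u G]|%:R : R) =
        \sum_(G in exts d F0) (multiple t p u G)%:R.
      rewrite -sum1_card natr_sum [LHS]big_mkcond [RHS]big_mkcond; apply: eq_bigr => G _.
      by rewrite in_set; case: (G \in exts d F0) => //=; case: (multiple _ _ _ _).
    apply: (@le_trans _ _ (\sum_(G in exts d F0) \sum_(s1 <- allseq n t)
      \sum_(s2 <- allseq n t) \sum_(s3 <- allseq n t) (triple p u s1 s2 s3 &&
      [&& epath G u s1, epath G u s2 & epath G u s3])%:R)); last first.
      rewrite exchange_big; apply: ler_sum => s1 _; rewrite exchange_big; apply: ler_sum => s2 _.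
      by rewrite exchange_big.
    apply: ler_sum => G _.
    have [m|_] := boolP (multiple t p u G); last by do 3 apply: sumr_ge0 => ? _.
    have [s1 [s2 [s3 [z1 z2 z3 tr ep]]]] := multiple_triple m.
    have mem s : size s = t -> s \in allseq n t by move=> h; rewrite mem_allseq h.
    rewrite (bigD1_seq s1) ?mem ?allseq_uniq //= ler_wpDr //; first by do 3 apply: sumr_ge0 => ? _.
    rewrite (bigD1_seq s2) ?mem ?allseq_uniq //= ler_wpDr //; first by do 2 apply: sumr_ge0 => ? _.
    rewrite (bigD1_seq s3) ?mem ?allseq_uniq //= ler_wpDr //; first by apply: sumr_ge0 => ? _.
    by rewrite tr ep.
  apply: ler_sum => s1 _; apply: ler_sum => s2 _; apply: ler_sum => s3 _.
  case: (triple _ _ _ _ _) => /=; last by rewrite big1 // mul0r.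
  rewrite mul1r /npr -sum1_card natr_sum [leLHS]big_mkcond [leRHS]big_mkcond.
  apply: ler_sum => G _; rewrite !in_exts; case: (boolP (G \in _)) => //= rG.
  have [_ sG _] := regularP _ _ rG; rewrite /F2 /F1 !addw_subset // -!andbA.
  by case: (F0 \subset G); case: (epath G u s1); case: (epath G u s2); case: (epath G u s3).
pose X := (b%:R * lam) ^+ t.
have X0 : 0 <= X by apply: exprn_ge0.
have pos F s : 0 <= y ^+ nC F u s by apply: exprn_ge0.
apply: (@le_trans _ _ (y ^- 2 * \sum_(s1 <- allseq n t | nbw p u s1) y ^+ nC F0 u s1 *
  \sum_(s2 <- allseq n t | nbw p u s2) y ^+ nC (F1 s1) u s2 *
  \sum_(s3 <- allseq n t | nbw p u s3) y ^+ nC (F2 s1 s2) u s3 * pr (addw (F2 s1 s2) u s3))).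
  rewrite mulr_sumr [leRHS]big_mkcond big_seq [leRHS]big_seq; apply: ler_sum => s1.
  rewrite mem_allseq => /eqP z1; case: ifP => nb1; last first.
    by rewrite big1 // => s2 _; rewrite big1 // => s3 _; rewrite /triple nb1 mul0r.
  rewrite !mulr_sumr [leRHS]big_mkcond big_seq [leRHS]big_seq; apply: ler_sum => s2.
  rewrite mem_allseq => /eqP z2; case: ifP => nb2; last first.
    by rewrite big1 // => s3 _; rewrite /triple nb2 andbF mul0r.
  rewrite !mulr_sumr [leRHS]big_mkcond big_seq [leRHS]big_seq; apply: ler_sum => s3.
  rewrite mem_allseq => /eqP z3; case: ifP => nb3; last by rewrite /triple nb3 !andbF mul0r.
  have [tr|_] := boolP (triple _ _ _ _ _); last by rewrite mul0r !mulr_ge0.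
  rewrite mul1r !mulrA ler_peMl // -!mulrA -!exprD addnA.
  have /and5P[_ _ _ /eqP l12 /andP[/eqP l23 dist]] := tr.
  have := three_walks pu nb1 nb2 nb3 (etrans z1 (esym z2)) (etrans z2 (esym z3)) l12 l23 dist.
  rewrite -/F0 -/(F1 s1) -/(F2 s1 s2) => hk.
  rewrite -(subnK hk) exprD mulrCA mulVf ?mulr1 ?expf_eq0 ?gt_eqF //.
  exact: exprn_ege1.
rewrite -!mulrA; apply: ler_wpM2l => //.
have -> : (b%:R * lam) ^+ (3 * t) * pr F0 = X * X * (X * pr F0).
  by rewrite /X mulnC exprM; ring.
apply: (@le_trans _ _ (\sum_(s1 <- allseq n t | nbw p u s1) X * X * (y ^+ nC F0 u s1 * pr (F1 s1)))); last first.
  rewrite -mulr_sumr; apply: ler_wpM2l; first exact: mulr_ge0.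
  apply: sum_walks => //; apply: leq_trans hA; apply: leq_add; first by rewrite leq_add2r.
  by rewrite leq_mul2r orbT.
rewrite big_seq_cond [leRHS]big_seq_cond; apply: ler_sum => s1 /andP[+ nb1].
rewrite mem_allseq => /eqP z1; rewrite mulrCA; apply: ler_wpM2l => //.
apply: (@le_trans _ _ (\sum_(s2 <- allseq n t | nbw p u s2) X * (y ^+ nC (F1 s1) u s2 * pr (F2 s1 s2)))); last first.
  rewrite -mulr_sumr -mulrA; apply: ler_wpM2l => //.
  apply: sum_walks => //; apply: leq_trans hA.
  rewrite addnAC [leqRHS]addnAC leq_add2r; apply: leq_trans (leq_add (c1 _ z1) (leqnn _)) _.
  by rewrite -addnA leq_add2l -mulnDl leq_mul2r orbT.
rewrite big_seq_cond [leRHS]big_seq_cond; apply: ler_sum => s2 /andP[+ nb2].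
rewrite mem_allseq => /eqP z2; rewrite [leRHS]mulrCA; apply: ler_wpM2l => //.
apply: sum_walks => //; apply: leq_trans hA.
rewrite addnAC [leqRHS]addnAC leq_add2r; apply: leq_trans (leq_add (c2 _ _ z1 z2) (leqnn _)) _.
by rewrite -addnA leq_add2l -mulnDl.
Qed.

End Triples.

(** * Counting walks in a regular graph *)

Section WalkCounts.
Variables (R : realFieldType) (n d : nat) (G : {set 'I_n * 'I_n}).
Hypothesis (rG : G \in regular_graphs n d).
Implicit Types (p u v : 'I_n) (s : seq 'I_n) (t : nat).
Local Notation b := (d.-1).

Lemma card_next p u : (p, u) \in G ->
  #|[set v | [&& v != p, v != u & (u, v) \in G]]| = b.
Proof.
have [irr sG dG] := regularP _ _ rG; move=> puG.
rewrite -(dG u) /deg (cardsD1 p (nbrs G u)) in_nbrs sG puG add1n /=.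
apply: eq_card => v; rewrite in_set in_setD1 in_nbrs.
case: (v != p) => //=; rewrite andb_idl //.
by move=> uv; apply: contraNneq (irr u) => e; rewrite -{2}e.
Qed.

Lemma sum_next p u (f : 'I_n -> R) :
  \sum_(v | [&& v != p, v != u & (u, v) \in G]) f v =
  \sum_(v in [set v | [&& v != p, v != u & (u, v) \in G]]) f v.
Proof. by apply: eq_bigl => v; rewrite in_set. Qed.

Lemma sum_walkS p u t (f : seq 'I_n -> R) :
  \sum_(s <- allseq n t.+1) (walk G p u s)%:R * f s =
  \sum_(v | [&& v != p, v != u & (u, v) \in G])
    \sum_(s <- allseq n t) (walk G u v s)%:R * f (v :: s).
Proof.
rewrite big_allseqS [RHS]big_mkcond; apply: eq_bigr => v _.
case: ifP => h.
  by case/and3P: h => h1 h2 h3; apply: eq_bigr => s _; rewrite walk_cons h1 h2 h3.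
rewrite big1 // => s _; rewrite walk_cons.
by move: h; case: (v != p) => //=; case: (v != u) => //=; case: (_ \in G); rewrite ?mul0r.
Qed.

Lemma sum_walk p u t : (p, u) \in G ->
  \sum_(s <- allseq n t) (walk G p u s)%:R = b%:R ^+ t :> R.
Proof.
elim: t p u => [|t IH] p u puG; first by rewrite big_seq1.
under eq_bigr do rewrite -[(walk _ _ _ _)%:R]mulr1.
rewrite sum_walkS (eq_bigr (fun=> b%:R ^+ t)); last first.
  move=> v /and3P[_ _ uvG]; rewrite -(IH u v uvG).
  by apply: eq_bigr => s _; rewrite mulr1.
by rewrite sum_next sumr_const (card_next puG) exprS mulr_natl.
Qed.

Lemma sum_walk_cat p u t1 t2 (g : seq 'I_n -> seq 'I_n -> R) :
  \sum_(s <- allseq n (t1 + t2)) (walk G p u s)%:R * g (take t1 s) (drop t1 s) =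
  \sum_(s1 <- allseq n t1) (walk G p u s1)%:R *
   \sum_(s2 <- allseq n t2) (walk G (lastE p u s1).1 (last u s1) s2)%:R * g s1 s2.
Proof.
rewrite big_allseq_cat big_seq [RHS]big_seq; apply: eq_bigr => s1.
rewrite mem_allseq => /eqP z1; rewrite mulr_sumr; apply: eq_bigr => s2 _.
by rewrite walk_cat -mulnb natrM take_size_cat // drop_size_cat // mulrA.
Qed.

Lemma sum_walk_prefix p u t1 t2 (f : seq 'I_n -> R) : (p, u) \in G ->
  \sum_(s <- allseq n (t1 + t2)) (walk G p u s)%:R * f (take t1 s) =
  b%:R ^+ t2 * \sum_(s1 <- allseq n t1) (walk G p u s1)%:R * f s1.
Proof.
move=> puG; rewrite (sum_walk_cat p u t1 t2 (fun s1 _ => f s1)) mulr_sumr.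
apply: eq_bigr => s1 _; rewrite -mulr_suml mulrCA.
have [/andP[_ ep]|_] := boolP (walk G p u s1); last by rewrite !mul0r !mulr0.
congr (_ * _); rewrite sum_walk // -(lastE2 p).
by have := lastE_in puG ep; case: (lastE p u s1).
Qed.

Lemma cntE p u t z :
  (cnt G p u t z)%:R = \sum_(s <- allseq n t) (walk G p u s)%:R * (lastE p u s == z)%:R :> R.
Proof.
rewrite /cnt -sum1_count natr_sum big_mkcond; apply: eq_bigr => s _.
by case: (walk _ _ _ _); case: (_ == _); rewrite ?mulr1 ?mulr0 ?mul0r.
Qed.

(** Ordered pairs of walks with the same last edge, equal walks included: up to normalisation, the
    squared l^2 norm of the law at time t. *)
Definition nmeet p u t : R :=
  \sum_(s <- allseq n t) (walk G p u s)%:R * (cnt G p u t (lastE p u s))%:R.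

Section Start.
Variables (p u : 'I_n).
Hypothesis (puG : (p, u) \in G).

Lemma nmeet_le t (c : nat) : (forall z, (cnt G p u t z <= c)%N) ->
  nmeet p u t <= c%:R * b%:R ^+ t.
Proof.
move=> h; rewrite -(sum_walk t puG) mulr_sumr; apply: ler_sum => s _.
by rewrite mulrC ler_wpM2r // ler_nat.
Qed.

Lemma nmeet_sq t : nmeet p u t = \sum_(z in G) (cnt G p u t z)%:R ^+ 2.
Proof.
under [RHS]eq_bigr do rewrite expr2 {1}cntE mulr_suml.
rewrite exchange_big; apply: eq_bigr => s _ /=.
have [/andP[_ ep]|_] := boolP (walk G p u s); last first.
  by rewrite mul0r big1 // => z _; rewrite !mul0r.
rewrite (bigD1 (lastE p u s)) /=; last exact: lastE_in.
rewrite eqxx !mul1r big1 ?addr0 // => z /andP[_ /negbTE nz].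
by rewrite [lastE _ _ _ == _]eq_sym nz mulr0 mul0r.
Qed.

Variables (sigma kappa t : nat).
Hypothesis (st : (sigma <= t)%N).
Local Notation valid := (valid sigma kappa p u G).

(** The unnormalised law at time t restricted to valid walks. *)
Definition vcnt z : R :=
  \sum_(s <- allseq n t) (walk G p u s && valid s)%:R * (lastE p u s == z)%:R.

Lemma vcnt_le z : vcnt z <= (cnt G p u t z)%:R.
Proof.
rewrite cntE; apply: ler_sum => s _; rewrite ler_wpM2r // ler_nat.
by case: (walk _ _ _ _) => //=; case: (valid s).
Qed.

(** Used with kappa = 2 at time 4q, where no walk is discarded and the bound on pairs controls the
    full law at time 7q. *)
Lemma vcnt_all z : (forall e, (cnt G p u sigma e <= kappa)%N) ->
  vcnt z = (cnt G p u t z)%:R.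
Proof.
by move=> h; rewrite cntE; apply: eq_bigr => s _; rewrite (_ : valid s) ?andbT //; apply: h.
Qed.

(** Markov's inequality: an invalid walk has more than kappa companions at time sigma, counting
    itself, and [nmeet] sums these numbers. *)
Lemma vcnt_mass : (0 < kappa)%N -> b%:R ^+ t - b%:R ^+ (t - sigma) * nmeet p u sigma / kappa%:R
  <= \sum_(z in G) vcnt z.
Proof.
move=> k0; have -> : \sum_(z in G) vcnt z = \sum_(s <- allseq n t) (walk G p u s && valid s)%:R.
  rewrite exchange_big; apply: eq_bigr => s _ /=.
  have [/andP[/andP[_ ep] _]|_] := boolP (walk _ _ _ _ && _); last first.
    by rewrite big1 // => z _; rewrite mul0r.
  rewrite (bigD1 (lastE p u s)) /=; last exact: lastE_in.
  by rewrite eqxx mulr1 big1 ?addr0 // => z /andP[_ /negbTE nz]; rewrite eq_sym nz mulr0.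
rewrite lerBlDr -(sum_walk t puG).
have -> : b%:R ^+ (t - sigma) * nmeet p u sigma / kappa%:R =
   \sum_(s <- allseq n t) (walk G p u s)%:R *
   ((cnt G p u sigma (lastE p u (take sigma s)))%:R / kappa%:R).
  have {2}-> : t = (sigma + (t - sigma))%N by rewrite subnKC.
  rewrite (@sum_walk_prefix p u sigma (t - sigma)
    (fun s1 => (cnt G p u sigma (lastE p u s1))%:R / kappa%:R)) // -mulrA; congr (_ * _).
  by rewrite /nmeet mulr_suml; apply: eq_bigr => s _; rewrite mulrA.
rewrite -big_split; apply: ler_sum => s _ /=.
case: (walk _ _ _ _); last by rewrite /= mul0r addr0.
rewrite mul1r; have [_|nv] := boolP (valid s).
  by rewrite lerDl divr_ge0.
by rewrite add0r ler_pdivlMr ?ltr0n // mul1r ler_nat ltnW // ltnNge.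
Qed.

Lemma vcnt_sq : \sum_(z in G) vcnt z ^+ 2 <=
  b%:R ^+ (t - sigma) * nmeet p u sigma + ncoll R sigma kappa p u t G.
Proof.
apply: (@le_trans _ _ (\sum_(s <- allseq n t) \sum_(s' <- allseq n t)
  [&& walk G p u s && valid s, walk G p u s' && valid s' & lastE p u s == lastE p u s']%:R)).
  apply: (@le_trans _ _ (\sum_(s <- allseq n t) \sum_(s' <- allseq n t) \sum_(z in G)
    ((walk G p u s && valid s)%:R * (lastE p u s == z)%:R) *
    ((walk G p u s' && valid s')%:R * (lastE p u s' == z)%:R))).
    under eq_bigr do rewrite expr2 /vcnt mulr_suml.
    rewrite exchange_big; apply: ler_sum => s _.
    by rewrite [leRHS]exchange_big; apply: ler_sum => z _ /=; rewrite mulr_sumr.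
  apply: ler_sum => s _; apply: ler_sum => s' _.
  case: (walk G p u s && valid s); last by rewrite big1 // => z _; rewrite !mul0r.
  case: (walk G p u s' && valid s'); last by rewrite big1 // => z _; rewrite !mul0r mulr0.
  rewrite big_mkcond (bigD1 (lastE p u s)) //= eqxx !mul1r eq_sym big1 ?addr0.
    by case: (_ \in G).
  by move=> z /negbTE h; case: ifP; rewrite // eq_sym h !mul1r mul0r.
(* A diagonal pair is a pair meeting at time sigma with one common continuation, for which there are
   b^(t - sigma) choices. *)
have -> : b%:R ^+ (t - sigma) * nmeet p u sigma = \sum_(s <- allseq n t) \sum_(s' <- allseq n t)
    [&& walk G p u s, walk G p u s' & diag sigma p u s s']%:R.
  transitivity (\sum_(s <- allseq n t) (walk G p u s)%:R *
     (cnt G p u sigma (lastE p u (take sigma s)))%:R : R).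
    have {2}-> : t = (sigma + (t - sigma))%N by rewrite subnKC.
    by rewrite (@sum_walk_prefix p u sigma (t - sigma)
      (fun s1 => (cnt G p u sigma (lastE p u s1))%:R)).
  rewrite big_seq [RHS]big_seq; apply: eq_bigr => s; rewrite mem_allseq => /eqP sz.
  have [w|_] := boolP (walk G p u s); last by rewrite mul0r big1.
  rewrite mul1r cntE /=.
  have -> : t = (sigma + (t - sigma))%N by rewrite subnKC.
  rewrite big_allseq_cat big_seq [RHS]big_seq; apply: eq_bigr => s1; rewrite mem_allseq => /eqP z1.
  have szd : size (drop sigma s) = (t - sigma)%N by rewrite size_drop sz.
  rewrite (bigD1_seq (drop sigma s)) ?allseq_uniq ?mem_allseq ?szd //= big1 ?addr0; last first.
    move=> s2 /negbTE h; rewrite /diag drop_size_cat // [drop _ _ == _]eq_sym h.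
    by rewrite !andbF.
  rewrite /diag take_size_cat // drop_size_cat // eqxx andbT walk_cat [lastE p u (take sigma s) == _]eq_sym.
  have [e|_] := eqVneq (lastE p u s1) (lastE p u (take sigma s)); last by rewrite !andbF mulr0.
  rewrite !andbT mulr1; congr _%:R.
  case: (walk G p u s1) => //=; rewrite -(lastE2 p) e (lastE2 p).
  by move: w; rewrite -{1}(cat_take_drop sigma s) walk_cat => /andP[_ ->].
rewrite -big_split; apply: ler_sum => s _ /=; rewrite -big_split; apply: ler_sum => s' _ /=.
rewrite /pair_in /pairC /colliding /walk -natrD ler_nat.
case: (nbw p u s); case: (nbw p u s') => //=; rewrite ?andbF //.
case: (epath G u s); case: (epath G u s') => //=; rewrite ?andbF //.
case: (valid s); case: (valid s') => //=; rewrite ?andbF //.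
by case: (lastE p u s == _) => //=; rewrite andbT; case: (diag _ _ _ _ _).
Qed.

End Start.
End WalkCounts.

(** * Existence of regular graphs *)

Section Circulant.
Variable n : nat.
Implicit Types (S : {set 'I_n.+1}) (x : 'I_n.+1).

(** Connection sets of simple Cayley graphs of the cyclic group of order n + 1. *)
Definition symmetric_set S := (0 \notin S) && [forall x, (- x \in S) == (x \in S)].

Lemma card_involutions : (#|[set x : 'I_n.+1 | - x == x]| <= 2)%N.
Proof.
apply: (@leq_trans #|[set 0; inord n.+1./2 : 'I_n.+1]|); last by rewrite cards2; case: (_ != _).
apply/subset_leq_card/subsetP => x; rewrite in_set in_set2 => /eqP/(congr1 val) /=.
have xn := ltn_ord x.
have [x0|x0] := eqVneq (val x) 0%N; first by move=> _; apply/orP; left; apply/eqP/val_inj.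
rewrite modn_small => [e|]; last by move: x0 => /=; lia.
apply/orP; right; apply/eqP/val_inj; rewrite /= inordK; lia.
Qed.

Lemma symmetric_setU S x : symmetric_set S -> x \notin S -> x != 0 -> - x != x ->
  symmetric_set (x |: (- x |: S)) /\ #|x |: (- x |: S)| = #|S|.+2.
Proof.
move=> /andP[S0 /forallP sS] xS x0 xx; split; last first.
  by rewrite !cardsU1 in_setU1 negb_or eq_sym xx xS (eqP (sS x)) xS.
rewrite /symmetric_set !in_setU1 !negb_or eq_sym x0 eq_sym oppr_eq0 x0 S0 /=.
apply/forallP => z; rewrite !in_setU1 (eqP (sS z)) (eqr_opp z) (eqr_oppLR z).
by case: (z == x); case: (z == - x).
Qed.

Lemma symmetric_set_extend S k : symmetric_set S -> (#|S| + 2 * k + 2 <= n.+1)%N ->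
  exists2 S', symmetric_set S' & #|S'| = (#|S| + 2 * k)%N.
Proof.
move=> sS; elim: k => [|k IH] hk; first by exists S; rewrite ?muln0 ?addn0.
have [|S' sS' cS'] := IH; first by apply: leq_trans hk; clear; lia.
have : (0 < #|~: (S' :|: [set x | - x == x])|)%N.
  rewrite [#|~: _|]cardsCs setCK card_ord subn_gt0.
  apply: leq_ltn_trans (leq_of_leqif (leq_card_setU _ _)) _; rewrite cS'.
  apply: leq_ltn_trans (leq_add (leqnn _) card_involutions) _.
  by apply: leq_trans hk; rewrite ltn_add2r ltn_add2l mulnS.
case/card_gt0P => x; rewrite in_setC in_setU negb_or in_set => /andP[xS xx].
have x0 : x != 0 by apply: contraNneq xx => ->; rewrite oppr0.
have [h1 h2] := symmetric_setU sS' xS x0 xx.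
by exists (x |: (- x |: S')); rewrite // h2 cS' mulnS; lia.
Qed.

Lemma circulant_regular S : symmetric_set S ->
  [set e : 'I_n.+1 * 'I_n.+1 | e.2 - e.1 \in S] \in regular_graphs n.+1 #|S|.
Proof.
case/andP => S0 /forallP sS; apply/regularP; split=> [x|x z|x].
- by rewrite in_set /= subrr.
- by rewrite !in_set /= -opprB (eqP (sS _)).
have inj : injective (fun z : 'I_n.+1 => x + z) := addrI x.
rewrite /deg -[RHS](card_imset _ inj); apply: eq_card => z; rewrite in_nbrs in_set /=.
apply/idP/imsetP => [h|[y yS ->]]; last by rewrite addrC addKr.
by exists (z - x); rewrite // addrC subrK.
Qed.

End Circulant.

(** Without a regular graph [prob_regular] would be 0 by division by zero. For odd d the order is
    even and the involution n / 2 is taken; the rest are pairs x, -x. *)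
Lemma regular_graph_exists n d : (d.+2 < n)%N -> ~~ odd (d * n) ->
  (0 < #|regular_graphs n d|)%N.
Proof.
case: n => // n dn od; have half := odd_double_half d.
have [S sS cS] : exists2 S : {set 'I_n.+1}, symmetric_set S & #|S| = odd d.
  case: (boolP (odd d)) => [o|_]; last first.
    exists set0; rewrite ?cards0 //; apply/andP; rewrite in_set0; split=> //.
    by apply/forallP => x; rewrite !in_set0.
  have en : ~~ odd n.+1 by move: od; rewrite oddM o.
  exists [set inord n.+1./2]; last by rewrite cards1.
  have vh : (inord n.+1./2 : 'I_n.+1) = n.+1./2 :> nat by rewrite inordK //; lia.
  have hh : - inord n.+1./2 = inord n.+1./2 :> 'I_n.+1.
    by apply: val_inj; rewrite /= vh modn_small; lia.
  apply/andP; split; last by apply/forallP => x; rewrite !in_set1 (eqr_oppLR x) hh.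
  by rewrite in_set1 eq_sym; apply/eqP => /(congr1 val); rewrite /= vh; lia.
have [|S' sS' cS'] := symmetric_set_extend (k := d./2) sS.
  by rewrite cS mul2n half; lia.
rewrite cS mul2n half in cS'; apply/card_gt0P.
by exists [set e : 'I_n.+1 * 'I_n.+1 | e.2 - e.1 \in S']; rewrite -[in X in _ \in X]cS' circulant_regular.
Qed.

(** * Graphs with too many collisions *)

Section RealBounds.
Variable R : realFieldType.

Lemma bernoulli (x : R) k : 0 <= x -> 1 + k%:R * x <= (1 + x) ^+ k.
Proof.
move=> x0; elim: k => [|k IH]; first by rewrite mul0r addr0.
rewrite exprS; apply: le_trans (ler_wpM2l _ IH); last by rewrite addr_ge0.
have : 0 <= k%:R * x * x by rewrite !mulr_ge0.
by rewrite -natr1; lra.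
Qed.

Lemma inv_bernoulli (x z : R) k : 0 <= x -> k%:R * x <= z -> z <= 1 ->
  (1 + x) ^+ k * (1 - z) <= 1.
Proof.
move=> x0 kx z1.
apply: (@le_trans _ _ ((1 + x) ^+ k * (1 - k%:R * x))).
  by apply: ler_wpM2l; [rewrite exprn_ge0 // addr_ge0|lra].
elim: k {z z1 kx} => [|k IH]; first by rewrite expr0 mul0r subr0 mulr1.
apply: le_trans IH; rewrite exprSr -mulrA; apply: ler_wpM2l.
  by rewrite exprn_ge0 // addr_ge0.
have : 0 <= k%:R * x * x by rewrite !mulr_ge0.
have : 0 <= x * x by rewrite mulr_ge0.
by rewrite -natr1; lra.
Qed.

Variables (n d A : nat).
Hypotheses (d3 : (2 < d)%N) (n0 : (0 < n)%N) (hA : (2 * A <= d * n)%N).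

Let N0 : (0 : R) < (d * n)%:R.
Proof. by rewrite ltr0n muln_gt0 n0 andbT (ltnW (ltnW d3)). Qed.

Lemma roomE : (room n d A)%:R = (d * n)%:R - A%:R :> R.
Proof. by rewrite natrB //; apply: leq_trans hA; apply: leq_pmull. Qed.

Lemma room_half : (d * n)%:R / 2 <= (room n d A)%:R :> R.
Proof.
rewrite roomE; have : (2 * A)%:R <= (d * n)%:R :> R by rewrite ler_nat.
by rewrite natrM; lra.
Qed.

Lemma room_gt0 : (0 < room n d A)%N.
Proof. by rewrite -(ltr0n R); apply: lt_le_trans room_half; rewrite divr_gt0 ?N0. Qed.
(** Since [room] is at least dn / 2, [lam] exceeds 1 by at most 4 y A / n. *)
Lemma lam_pow (y z : R) k : 1 <= y -> 4 * k%:R * A%:R * y <= z * n%:R -> z <= 1 ->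
  lam n d A y ^+ k * (1 - z) <= 1.
Proof.
move=> y1 hk z1; have y0 : 0 <= y by lra.
have D0 : (0 : R) < (room n d A)%:R by rewrite ltr0n room_gt0.
have nR : (0 : R) < n%:R by rewrite ltr0n.
have dR : (1 : R) <= d%:R by rewrite ler1n (ltnW (ltnW d3)).
have A0 : (0 : R) <= A%:R by [].
pose x := (d%:R * y * A%:R + A%:R) / (room n d A)%:R.
have -> : lam n d A y = 1 + x.
  rewrite /lam (_ : _ * (_ + _) = (room n d A)%:R + (d%:R * y * A%:R + A%:R)).
    by rewrite mulrDl divff ?gt_eqF.
  by rewrite roomE natrM; ring.
have x0 : 0 <= x by rewrite divr_ge0 ?addr_ge0 ?mulr_ge0.
apply: inv_bernoulli => //.
suff h : x * n%:R <= 4 * y * A%:R.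
  rewrite -(ler_pM2r nR); apply: le_trans hk.
  have -> : 4 * k%:R * A%:R * y = k%:R * (4 * y * A%:R) by ring.
  by rewrite -[leLHS]mulrA; apply: ler_wpM2l.
rewrite mulrAC ler_pdivrMr //.
have h1 : 4 * y * A%:R * ((d * n)%:R / 2) <= 4 * y * A%:R * (room n d A)%:R.
  by apply: ler_wpM2l; rewrite ?mulr_ge0 // room_half.
apply: le_trans h1; rewrite natrM.
have h2 : A%:R <= d%:R * y * A%:R.
  by apply: ler_peMl => //; have := ler_pM ler01 ler01 dR y1; rewrite mulr1.
have h3 : (d%:R * y * A%:R + A%:R) * n%:R <= (d%:R * y * A%:R + d%:R * y * A%:R) * n%:R.
  by apply: ler_wpM2r; rewrite ?lerD2l.
by apply: le_trans h3 _; rewrite le_eqVlt; apply/orP; left; apply/eqP; field.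
Qed.

End RealBounds.

(** * The three scales 4q, 7q and t *)

Section BadFraction.
Variables (R : realFieldType) (n d q M t : nat) (eta delta : R).
Implicit Types p u : 'I_n.
Local Notation b := (d.-1).
Local Notation N := (d * n)%N.
Local Notation A := (q ^ 4)%N.
Local Notation Q := (b%:R ^+ q : R).

(* [M] is large in terms of d, [eta] and [delta] only. The powers of b^q gained
   at each scale absorb every polynomial loss in [q]. *)
Hypotheses (d3 : (2 < d)%N) (Mq : (M <= q)%N) (MQ : (M * q ^ 13 <= b ^ q)%N).
Hypotheses (n_ge : (b ^ (13 * q) <= n)%N) (n_le : (n <= b ^ (13 * q + 13))%N).
Hypotheses (t_ge : (7 * q <= t)%N) (t_le : (t <= 20 * q)%N).
Hypotheses (eta01 : 0 < eta <= 1) (delta0 : 0 < delta).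
Hypotheses (M1 : (400 + 2 * (d.+1 * d) <= M)%N) (M2 : 6 * d%:R <= M%:R * delta).
Hypothesis (M3 : 2560 + 128 * (d%:R * b%:R ^+ 13) + 4 * b%:R ^+ 27 <= M%:R * eta).

Let q400 : (400 <= q)%N.
Proof. by apply: leq_trans Mq; apply: leq_trans M1; apply: leq_addr. Qed.

Let q0 : (0 < q)%N.
Proof. exact: leq_trans q400. Qed.

Let qR : (400 : R) <= q%:R.
Proof. by rewrite (ler_nat R 400). Qed.

Let MR : (400 : R) <= M%:R.
Proof. by rewrite (ler_nat R 400); apply: leq_trans M1; apply: leq_addr. Qed.

Let MqR : (M%:R : R) <= q%:R.
Proof. by rewrite ler_nat. Qed.

Let b2 : (2 : R) <= b%:R.
Proof. by rewrite (ler_nat R 2); move: d3; case: (d) => [|[|[]]]. Qed.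

Let QM : M%:R * q%:R ^+ 13 <= Q.
Proof. by rewrite -!natrX -natrM ler_nat. Qed.

Let qX (i j : nat) : (i <= j)%N -> q%:R ^+ i <= q%:R ^+ j :> R.
Proof. by move=> ij; apply: ler_weXn2l => //; rewrite ler1n. Qed.

Let Qq i : (i <= 13)%N -> M%:R * q%:R ^+ i <= Q.
Proof.
by move=> i13; apply: le_trans QM; apply: ler_wpM2l => //; apply: qX.
Qed.

Let Q400 : 400 <= Q.
Proof. by apply: le_trans (Qq (leq0n _)); rewrite mulr1. Qed.

Let QX (i j : nat) : (i <= j)%N -> Q ^+ i <= Q ^+ j.
Proof. by move=> ij; apply: ler_weXn2l => //; apply: le_trans Q400; rewrite ler1n. Qed.

Let nQ : Q ^+ 13 <= n%:R.
Proof. by rewrite -exprM mulnC -natrX ler_nat. Qed.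

Let nQ1 : Q <= n%:R.
Proof. by apply: le_trans nQ; rewrite -{1}[Q]expr1; apply: QX. Qed.

Let n0 : (0 < n)%N.
Proof. by rewrite -(ltr0n R); apply: lt_le_trans nQ1; apply: lt_le_trans Q400; rewrite ltr0n. Qed.

Let NnR : (N%:R : R) = d%:R * n%:R.
Proof. exact: natrM. Qed.

Let d3R : (3 : R) <= d%:R.
Proof. by rewrite (ler_nat R 3). Qed.

Let nN : (n%:R : R) <= N%:R.
Proof. by rewrite NnR ler_peMl //; apply: le_trans d3R; rewrite ler1n. Qed.

Let half_room : (2 * A <= N)%N.
Proof.
rewrite -(ler_nat R); apply: le_trans nN; apply: le_trans nQ1; apply: le_trans (Qq (_ : 4 <= 13)%N) => //.
by rewrite natrM natrX; apply: ler_wpM2r; [apply: exprn_ge0|apply: le_trans MR; rewrite (ler_nat R 2 400)].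
Qed.

Let room0 : (0 < room n d A)%N.
Proof. exact: (room_gt0 R d3 n0 half_room). Qed.

Let Q0 : 0 < Q.
Proof. by apply: lt_le_trans Q400; rewrite ltr0n. Qed.

Let nR0 : (0 : R) < n%:R.
Proof. by rewrite ltr0n. Qed.

Let qR0 : (0 : R) < q%:R.
Proof. by rewrite ltr0n. Qed.

(** 80 q^3 is the cost of q^2 pairs of walks of length at most 20q, four directed edges per step. *)
Lemma budget k : (k <= 80 * q ^ 3)%N -> (2 + 2 * (d.+1 * d) + k <= A)%N.
Proof.
move=> hk; apply: leq_trans (leq_add (leqnn _) hk) _.
apply: (@leq_trans ((2 + 2 * (d.+1 * d)) * q ^ 3 + 80 * q ^ 3)).
  by rewrite leq_add2r leq_pmulr // expn_gt0 q0.
rewrite -mulnDl (expnS q 3) leq_mul2r; apply/orP; right.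
by apply: leq_trans Mq; apply: leq_trans M1; rewrite addnAC leq_add2r.
Qed.

Lemma stage1 p u : #|[set G in exts d (link set0 p u) | multiple (4 * q) p u G]|%:R
  <= delta / 3 / N%:R * (npr d (link set0 p u))%:R.
Proof.
(* Up to powers of q, the largest weight that keeps the power of [lam] bounded. *)
pose y : R := n%:R / q%:R ^+ 6.
have q6 : (0 : R) < q%:R ^+ 6 by rewrite exprn_gt0.
have y1 : 1 <= y.
  rewrite /y ler_pdivlMr // mul1r; apply: le_trans nQ1; apply: le_trans (Qq (_ : 6 <= 13)%N) => //.
  by apply: ler_peMl; [apply: ltW|apply: le_trans MR; rewrite ler1n].
have hb : (2 + 2 * (d.+1 * d) + 6 * (4 * q) <= A)%N.
  by apply: budget; rewrite mulnA leq_mul // -{1}[q]expn1 leq_pexp2l.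
apply: le_trans (tail_multiple (ltnW (ltnW d3)) y1 room0 p u hb) _.
apply: ler_wpM2r => //.
have hl : lam n d A y ^+ (3 * (4 * q)) <= 2.
  suff : lam n d A y ^+ (3 * (4 * q)) * (1 - 2^-1) <= 1 by lra.
  apply: (lam_pow d3 n0 half_room y1); last by lra.
  rewrite natrX mulnA (natrM R 12) /y.
  rewrite [leLHS](_ : _ = 48 / q%:R * n%:R); last first.
    by move: qR0; move: (q%:R : R) => Z Z0; field; rewrite gt_eqF.
  apply: ler_wpM2r; first exact: ltW.
  by rewrite ler_pdivrMr //; move: qR; lra.
rewrite [(_ * lam _ _ _ _) ^+ _]exprMn.
have -> : b%:R ^+ (3 * (4 * q)) = Q ^+ 12 :> R by rewrite -exprM mulnA mulnC.
have Q12 : 0 <= Q ^+ 12 by rewrite exprn_ge0 // ltW.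
have iy0 : 0 <= y ^- 2 by rewrite invr_ge0 exprn_ge0 // (le_trans _ y1).
apply: le_trans (ler_wpM2l iy0 (ler_wpM2l Q12 hl)) _.
rewrite ler_pdivlMr ?(lt_le_trans nR0 nN) // NnR.
have -> : y ^- 2 * (Q ^+ 12 * 2) * (d%:R * n%:R) = 2 * d%:R * q%:R ^+ 12 * Q ^+ 12 / n%:R.
  rewrite /y; move: qR0 nR0; move: (q%:R : R) (n%:R : R) (Q) (d%:R : R) => Z n' Q' d' Z0 n'0.
  by field; rewrite !gt_eqF.
rewrite ler_pdivrMr //; apply: (@le_trans _ _ (delta / 3 * Q ^+ 13)); last first.
  by apply: ler_wpM2l => //; rewrite divr_ge0 // ltW.
rewrite (exprS Q 12) [leRHS]mulrA; apply: ler_wpM2r => //.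
apply: (@le_trans _ _ (delta / 3 * (M%:R * q%:R ^+ 12))); last first.
  by apply: ler_wpM2l; [rewrite divr_ge0 // ltW|apply: Qq].
move: (q%:R ^+ 12) (exprn_ge0 12 (ltW qR0)) => Z Z0.
have h : 6 * d%:R * Z <= M%:R * delta * Z := ler_wpM2r Z0 M2.
by lra.
Qed.

Let bR0 : (0 : R) < b%:R.
Proof. by apply: lt_le_trans b2. Qed.

(** By Bernoulli (1 + x)^q is at least b^27, so the q^2-th power beats b^(27q). Of this b^(26q)
    covers b^(13q + 13), hence n, and the spare Q covers d and delta. *)
Lemma geometric_tail (x : R) : 0 < x -> b%:R ^+ 27 <= q%:R * x ->
  (1 + x)^-1 ^+ (q ^ 2) <= delta / 3 / N%:R.
Proof.
move=> x0 hx; have x1 : 0 < 1 + x by rewrite addr_gt0.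
have h1 : b%:R ^+ 27 <= (1 + x) ^+ q.
  apply: le_trans (bernoulli q (ltW x0)); apply: le_trans hx _.
  by rewrite lerDr.
have h2 : b%:R ^+ (27 * q) <= (1 + x) ^+ (q ^ 2).
  by rewrite -mulnn !exprM; apply: lerXn2r; rewrite ?nnegrE ?exprn_ge0 // ltW.
have N0 : (0 : R) < N%:R by apply: lt_le_trans nN.
have c0 : 0 < delta / 3 / N%:R by rewrite !divr_gt0.
rewrite exprVn -[leRHS]invrK lef_pV2 ?posrE ?invr_gt0 ?exprn_gt0 //.
apply: le_trans h2.
rewrite invf_div ler_pdivrMr ?divr_gt0 // NnR.
apply: (@le_trans _ _ (d%:R * b%:R ^+ (13 * q + 13))).
  by apply: ler_wpM2l => //; rewrite -natrX ler_nat.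
apply: (@le_trans _ _ (b%:R ^+ (26 * q) * (Q * (delta / 3)))); last first.
  by rewrite mulrA -exprD (_ : 26 * q + q = 27 * q)%N // -mulSnr.
rewrite mulrC; apply: ler_pM => //; first by rewrite exprn_ge0 // ltW.
  apply: ler_weXn2l; first by apply: le_trans b2; rewrite ler1n.
  by rewrite -[26%N]/(13 + 13)%N mulnDl leq_add2l leq_pmulr.
apply: (@le_trans _ _ (M%:R * (delta / 3))); first by move: M2 d3R; lra.
apply: ler_wpM2r; first by rewrite divr_ge0 // ltW.
by apply: le_trans (Qq (leq0n _)); rewrite expr0 mulr1.
Qed.

Lemma stage2 p u : #|[set G in exts d (link set0 p u) |
    b%:R ^+ (7 * q) < ncoll R (4 * q) 2 p u (7 * q) G]|%:R
  <= delta / 3 / N%:R * (npr d (link set0 p u))%:R.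
Proof.
(* The largest weight allowed by [hy], which becomes an equality; the rate at time 7q is then O(q^8
   Q^6), below half of Q^7. *)
pose y : R := Q ^+ 4 / (2 * q%:R ^+ 4).
have q4 : (0 : R) < q%:R ^+ 4 by rewrite exprn_gt0.
have Q4 : 0 < Q ^+ 4 by rewrite exprn_gt0.
have M2R : (2 : R) <= M%:R by apply: le_trans MR; rewrite (ler_nat R 2 400).
have y1 : 1 <= y.
  rewrite /y ler_pdivlMr ?mulr_gt0 // mul1r.
  apply: (@le_trans _ _ (M%:R * q%:R ^+ 4)); first by apply: ler_wpM2r => //; apply: ltW.
  by apply: le_trans (Qq (_ : 4 <= 13)%N) _ => //; rewrite -{1}[Q]expr1; apply: QX.
have hy : y * (A * 2)%:R <= b%:R ^+ (4 * q).
  rewrite mulnC exprM natrM natrX [b%:R ^+ 4 ^+ q]exprAC /y divfK //.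
  by rewrite gt_eqF // mulr_gt0.
have hb : (2 + 2 * (d.+1 * d) + 4 * (7 * q) * q ^ 2 <= A)%N.
  by apply: budget; rewrite mulnA -mulnA -expnS leq_mul2r orbT.
have s0 : (0 < 4 * q)%N by rewrite muln_gt0.
have st : (4 * q <= 7 * q)%N by rewrite leq_mul2r orbT.
have beta0 : (0 : R) < b%:R ^+ (7 * q) by rewrite exprn_gt0.
apply: le_trans (tail_ncoll p u d3 y1 room0 s0 hy beta0 st hb) _.
apply: ler_wpM2r => //.
apply: (le_trans _ (geometric_tail (x := 1) ltr01 _)); last first.
  rewrite mulr1; apply: le_trans MqR; apply: (@le_trans _ _ (M%:R * eta)).
    apply: le_trans M3; have : (0 : R) <= b%:R ^+ 27 by rewrite exprn_ge0 // ltW.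
    have : (0 : R) <= d%:R * b%:R ^+ 13 by rewrite mulr_ge0 // exprn_ge0 // ltW.
    by lra.
  by case/andP: eta01 => _ e1; rewrite ler_piMr.
apply: lerXn2r; rewrite ?nnegrE ?invr_ge0 ?addr_ge0 ?divr_ge0 ?rate_ge0 ?(ltW beta0) //.
rewrite ler_pdivrMr //.
have hl : lam n d A y ^+ (2 * (7 * q)) <= 2.
  suff : lam n d A y ^+ (2 * (7 * q)) * (1 - 2^-1) <= 1 by lra.
  apply: (lam_pow d3 n0 half_room y1); last by lra.
  rewrite natrX mulnA (natrM R 14) /y.
  rewrite [leLHS](_ : _ = 28 * q%:R * Q ^+ 4); last first.
    by move: qR0; move: (q%:R : R) (Q ^+ 4) => Z Z' Z0; field; rewrite gt_eqF.
  have h1 : 28 * q%:R * Q ^+ 4 <= 2^-1 * (Q * Q ^+ 4).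
    rewrite [leRHS]mulrA; apply: ler_wpM2r; first exact: ltW.
    apply: (@le_trans _ _ (2^-1 * (M%:R * q%:R ^+ 1))); last first.
      by apply: ler_wpM2l; [rewrite invr_ge0|apply: Qq].
    have h : 400 * q%:R <= M%:R * q%:R := ler_wpM2r (ltW qR0) MR.
    by rewrite expr1; move: qR0; lra.
  apply: le_trans h1 _; apply: ler_wpM2l; first by rewrite invr_ge0.
  by rewrite -exprS; apply: le_trans nQ; apply: QX.
rewrite /pair_rate [(_ * lam _ _ _ _) ^+ _]exprMn.
have -> : b%:R ^+ (2 * (7 * q)) = Q ^+ 14 :> R by rewrite -exprM mulnA mulnC.
have -> : b%:R ^+ (7 * q) = Q ^+ 7 :> R by rewrite -exprM mulnC.
have Q7 : 0 <= Q ^+ 7 by rewrite exprn_ge0 // ltW.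
have Q14 : 0 <= Q ^+ 14 by rewrite exprn_ge0 // ltW.
have c0 : 0 <= (room n d A)%:R^-1 + 8 * y ^- 2 :> R.
  by rewrite addr_ge0 ?invr_ge0 // mulr_ge0 // invr_ge0 exprn_ge0 // (le_trans _ y1).
apply: le_trans (ler_wpM2r c0 (ler_wpM2l Q14 hl)) _.
have hr : (room n d A)%:R^-1 <= 2 / Q ^+ 13 :> R.
  rewrite -[leRHS]invf_div lef_pV2 ?posrE ?ltr0n ?divr_gt0 ?exprn_gt0 //.
  apply: le_trans (room_half R half_room).
  by apply: ler_wpM2r; [rewrite invr_ge0|apply: le_trans nQ nN].
have hyy : 8 * y ^- 2 = 32 * q%:R ^+ 8 / Q ^+ 8.
  rewrite /y; move: qR0 Q0; move: (q%:R : R) (Q) => Z Q' Z0 Q'0.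
  by field; rewrite !gt_eqF.
rewrite hyy; apply: (@le_trans _ _ (Q ^+ 14 * 2 * (2 / Q ^+ 13 + 32 * q%:R ^+ 8 / Q ^+ 8))).
  by apply: ler_wpM2l; [rewrite mulr_ge0|rewrite lerD2r].
have -> : Q ^+ 14 * 2 * (2 / Q ^+ 13 + 32 * q%:R ^+ 8 / Q ^+ 8) = 4 * Q + 64 * q%:R ^+ 8 * Q ^+ 6.
  by move: Q0; move: (Q) (q%:R : R) => Q' Z Q'0; field; rewrite !gt_eqF.
have -> : (1 + 1)^-1 * Q ^+ 7 = 4^-1 * Q ^+ 7 + 4^-1 * Q * Q ^+ 6.
  by rewrite -mulrA -exprS; field.
apply: lerD.
  have h16 : 16 <= Q ^+ 6.
    apply: (@le_trans _ _ (Q ^+ 1)); last exact: QX.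
    by rewrite expr1; move: Q400; lra.
  have h : Q * 16 <= Q * Q ^+ 6 := ler_wpM2l (ltW Q0) h16.
  by rewrite -exprS in h; lra.
apply: ler_wpM2r; first by rewrite exprn_ge0 // ltW.
apply: (@le_trans _ _ (4^-1 * (M%:R * q%:R ^+ 8))); last first.
  by apply: ler_wpM2l; [rewrite invr_ge0|apply: Qq].
move: (q%:R ^+ 8) (exprn_ge0 8 (ltW qR0)) => Z Z0.
have h : 400 * Z <= M%:R * Z := ler_wpM2r Z0 MR.
by lra.
Qed.

Lemma stage3 p u : #|[set G in exts d (link set0 p u) |
    (1 + eta) * (b%:R ^+ (2 * t) / N%:R) < ncoll R (7 * q) q p u t G]|%:R
  <= delta / 3 / N%:R * (npr d (link set0 p u))%:R.
Proof.
case/andP: eta01 => eta0 eta1.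
have N0 : (0 : R) < N%:R by apply: lt_le_trans nN.
(* Again [hy] becomes an equality. *)
pose y : R := Q ^+ 7 / q%:R ^+ 5.
have q5 : (0 : R) < q%:R ^+ 5 by rewrite exprn_gt0.
have Q7 : 0 < Q ^+ 7 by rewrite exprn_gt0.
have M1R : (1 : R) <= M%:R by apply: le_trans MR; rewrite (ler_nat R 1 400).
have y1 : 1 <= y.
  rewrite /y ler_pdivlMr // mul1r.
  apply: (@le_trans _ _ (M%:R * q%:R ^+ 5)); first by apply: ler_peMl => //; apply: ltW.
  by apply: le_trans (Qq (_ : 5 <= 13)%N) _ => //; rewrite -{1}[Q]expr1; apply: QX.
have hy : y * (A * q)%:R <= b%:R ^+ (7 * q).
  by rewrite mulnC -expnS natrX [(7 * q)%N]mulnC exprM /y divfK // gt_eqF.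
have hb : (2 + 2 * (d.+1 * d) + 4 * t * q ^ 2 <= A)%N.
  apply: budget; rewrite (expnS q 2) mulnA leq_mul2r; apply/orP; right.
  by rewrite -[80%N]/(4 * 20)%N -mulnA leq_mul2l.
have s0 : (0 < 7 * q)%N by rewrite muln_gt0.
have B0 : (0 : R) < b%:R ^+ (2 * t) by rewrite exprn_gt0.
have beta0 : 0 < (1 + eta) * (b%:R ^+ (2 * t) / N%:R).
  by rewrite mulr_gt0 ?divr_gt0 // addr_gt0.
apply: le_trans (tail_ncoll p u d3 y1 room0 s0 hy beta0 t_ge hb) _.
apply: ler_wpM2r => //.
have db0 : (0 : R) <= d%:R * b%:R ^+ 13 by rewrite mulr_ge0 // exprn_ge0 // ltW.
have b27 : (0 : R) <= b%:R ^+ 27 by rewrite exprn_ge0 // ltW.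
have x0 : 0 < eta / 4 by rewrite divr_gt0.
apply: (le_trans _ (geometric_tail x0 _)); last first.
  have : M%:R * eta <= q%:R * eta by apply: ler_wpM2r; [apply: ltW|apply: MqR].
  by move: M3; lra.
apply: lerXn2r; rewrite ?nnegrE ?invr_ge0 ?addr_ge0 ?divr_ge0 ?rate_ge0 ?(ltW beta0) ?(ltW x0) ?(ltW eta0) //.
have e4 : 0 < 1 + eta / 4 by rewrite addr_gt0.
rewrite ler_pdivrMr // mulrC ler_pdivlMr //.
(* [lam], N / [room] and N y^-2 each deviate by O(z); the tail bound takes 4z, and (1 + 2z)(1 +
   3z)(1 + 4z) stays below 1 + 16z. *)
pose z := eta / 16.
have z0 : 0 < z by rewrite divr_gt0.
have Mz : 160 + 8 * (d%:R * b%:R ^+ 13) <= M%:R * z by rewrite /z; move: M3; lra.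
have zQ i : (i <= 13)%N -> M%:R * z * q%:R ^+ i <= z * Q.
  move=> i13; have h : z * (M%:R * q%:R ^+ i) <= z * Q.
    by apply: ler_wpM2l; [apply: ltW|apply: Qq].
  by rewrite [leLHS](_ : _ = z * (M%:R * q%:R ^+ i)) //; ring.
have Y0 : 0 < y ^- 2 by rewrite invr_gt0 exprn_gt0 // (lt_le_trans ltr01).
have hl : lam n d A y ^+ (2 * t) * (1 - z) <= 1.
  apply: (lam_pow d3 n0 half_room y1); last by rewrite /z; lra.
  have h1 : 4 * (2 * t)%:R * A%:R * y <= 160 * Q ^+ 7 :> R.
    rewrite natrX (natrM R 2) /y.
    rewrite [leLHS](_ : _ = 8 * t%:R / q%:R * Q ^+ 7); last first.
      by move: qR0; move: (q%:R : R) (Q ^+ 7) => Z Z' Z0; field; rewrite gt_eqF.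
    apply: ler_wpM2r; first exact: ltW.
    rewrite ler_pdivrMr //; have : (t%:R : R) <= 20 * q%:R by rewrite -natrM ler_nat.
    by lra.
  apply: le_trans h1 _; apply: (@le_trans _ _ (z * Q * Q ^+ 7)).
    apply: ler_wpM2r; first exact: ltW.
    by have := zQ 0%N isT; rewrite expr0 mulr1; lra.
  rewrite -mulrA -exprS; apply: ler_wpM2l; first exact: ltW.
  by apply: le_trans nQ; apply: QX.
have D0 : (0 : R) < (room n d A)%:R by rewrite ltr0n.
have hX : N%:R / (room n d A)%:R * (1 - z) <= 1 :> R.
  rewrite mulrAC ler_pdivrMr // mul1r (roomE R half_room).
  have : A%:R <= z * N%:R :> R.
    apply: (@le_trans _ _ (z * Q)).
      have := zQ 4%N isT; rewrite natrX.
      have : q%:R ^+ 4 <= M%:R * z * q%:R ^+ 4.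
        by apply: ler_peMl; [rewrite exprn_ge0 // ltW|lra].
      by lra.
    by apply: ler_wpM2l; [apply: ltW|apply: le_trans nQ1 nN].
  by lra.
have hW : 8 * N%:R * y ^- 2 <= z.
  have -> : 8 * N%:R * y ^- 2 = 8 * N%:R * q%:R ^+ 10 / Q ^+ 14.
    rewrite /y; move: qR0 Q0; move: (q%:R : R) (Q) (N%:R : R) => Z Q' N' Z0 Q'0.
    by field; rewrite !gt_eqF.
  rewrite ler_pdivrMr ?exprn_gt0 //.
  have nQb : n%:R <= Q ^+ 13 * b%:R ^+ 13.
    by rewrite -exprM -exprD [(q * 13)%N]mulnC -natrX ler_nat.
  have q10 : (0 : R) <= q%:R ^+ 10 by rewrite exprn_ge0 // ltW.
  apply: (@le_trans _ _ (8 * (d%:R * (Q ^+ 13 * b%:R ^+ 13)) * q%:R ^+ 10)).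
    apply: ler_wpM2r => //; apply: ler_wpM2l => //; rewrite NnR.
    by apply: ler_wpM2l.
  rewrite (exprS Q 13) [leRHS]mulrA [leLHS](_ : _ = 8 * (d%:R * b%:R ^+ 13) * q%:R ^+ 10 * Q ^+ 13); last by ring.
  apply: ler_wpM2r; first by rewrite exprn_ge0 // ltW.
  apply: le_trans (zQ 10%N isT); apply: ler_wpM2r => //.
  by move: Mz; lra.
rewrite /pair_rate [(_ * lam _ _ _ _) ^+ _]exprMn.
have L0 : 0 <= lam n d A y ^+ (2 * t).
  by rewrite exprn_ge0 // (le_trans ler01) // lam_ge1.
move: (lam n d A y ^+ (2 * t)) L0 hl => L L0 hl.
have z16 : z <= 16^-1 by rewrite /z; lra.
have inv_le (X : R) : X * (1 - z) <= 1 -> X <= 1 + 2 * z.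
  move=> hX'; have z1 : 0 < 1 - z by lra.
  rewrite -(ler_pM2r z1); apply: le_trans hX' _.
  have : z * z <= z * 16^-1 by apply: ler_wpM2l => //; apply: ltW.
  by lra.
have L1 := inv_le _ hl; have X1 := inv_le _ hX.
have -> : (1 + eta) * (b%:R ^+ (2 * t) / N%:R) = (1 + 16 * z) * (b%:R ^+ (2 * t) / N%:R).
  by congr (_ * _); rewrite /z; field.
have -> : eta / 4 = 4 * z by rewrite /z; field.
have -> : b%:R ^+ (2 * t) * L * ((room n d A)%:R^-1 + 8 * y ^- 2) * (1 + 4 * z) =
   ((1 + 4 * z) * (L * (N%:R / (room n d A)%:R + 8 * N%:R * y ^- 2))) *
     (b%:R ^+ (2 * t) / N%:R).
  move: N0 (y ^- 2) (room n d A)%:R^-1; move: (N%:R : R) (b%:R ^+ (2 * t) : R).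
  by move=> N' B' N'0 Y D'; field; rewrite gt_eqF.
rewrite ler_pM2r ?divr_gt0 //.
have XW : N%:R / (room n d A)%:R + 8 * N%:R * y ^- 2 <= 1 + 3 * z by lra.
have XW0 : 0 <= N%:R / (room n d A)%:R + 8 * N%:R * y ^- 2.
  by apply: addr_ge0; [apply: divr_ge0|apply: mulr_ge0; [apply: mulr_ge0|apply: ltW]].
have h1 : L * (N%:R / (room n d A)%:R + 8 * N%:R * y ^- 2) <= (1 + 2 * z) * (1 + 3 * z).
  exact: ler_pM.
have z4 : 0 <= 1 + 4 * z by lra.
apply: le_trans (ler_wpM2l z4 h1) _.
have zz : z * z <= z * 16^-1 by apply: ler_wpM2l => //; apply: ltW.
have zzz : z * z * z <= z * 16^-1 * 16^-1.
  by apply: ler_pM => //; [apply: mulr_ge0|]; apply: ltW.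
by lra.
Qed.

Definition bad (G : {set 'I_n * 'I_n}) := [exists e in G,
  [|| multiple (4 * q) e.1 e.2 G,
      (b%:R ^+ (7 * q) : R) < ncoll R (4 * q) 2 e.1 e.2 (7 * q) G
    | (1 + eta) * (b%:R ^+ (2 * t) / N%:R) < ncoll R (7 * q) q e.1 e.2 t G]].

Lemma bad_fraction : #|[set G in regular_graphs n d | bad G]|%:R
  <= delta * #|regular_graphs n d|%:R.
Proof.
have N0 : (0 : R) < N%:R by apply: lt_le_trans nN.
have -> : delta * #|regular_graphs n d|%:R =
    delta / N%:R * N%:R * #|regular_graphs n d|%:R.
  by rewrite divfK // gt_eqF.
apply: (union_edges (P := fun p u (G : {set 'I_n * 'I_n}) => [|| multiple (4 * q) p u G,
      b%:R ^+ (7 * q) < ncoll R (4 * q) 2 p u (7 * q) G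
    | (1 + eta) * (b%:R ^+ (2 * t) / N%:R) < ncoll R (7 * q) q p u t G])).
  by rewrite divr_ge0 // ltW.
move=> p u; have := stage1 p u; have := stage2 p u; have := stage3 p u.
set X1 := [set G in _ | _]; set X2 := [set G in _ | _ < _]; set X3 := [set G in _ | multiple _ _ _ _].
set X := [set G in _ | [|| _, _ | _]] => h1 h2 h3.
have : (#|X| <= #|X3| + (#|X2| + #|X1|))%N.
  apply: (@leq_trans #|X3 :|: (X2 :|: X1)|).
    apply/subset_leq_card/subsetP => G; rewrite !in_setU !in_set.
    by case/andP => -> /or3P[] ->; rewrite ?orbT.
  apply: leq_trans (leq_of_leqif (leq_card_setU _ _)) _; rewrite leq_add2l.
  exact: leq_of_leqif (leq_card_setU _ _).
rewrite -(ler_nat R) !natrD => h; apply: le_trans h _.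
have -> : delta / N%:R * (npr d (link set0 p u))%:R =
  3 * (delta / 3 / N%:R * (npr d (link set0 p u))%:R) :> R.
  by move: N0; move: (N%:R : R) => N' N0; field; rewrite gt_eqF.
by lra.
Qed.

End BadFraction.

From mathcomp Require Import all_classical all_reals all_analysis.
Import numFieldNormedType.Exports.

(** * The walk on a fixed graph *)

(** [mc_law] appends its steps at the end, whereas walks are built from the front. *)
Lemma mc_lawS (R : realType) (T : finType) (P : T -> T -> R) t x z :
  mc_law P t.+1 x z = \sum_y P x y * mc_law P t y z.
Proof.
elim: t z => [|t IH] z.
  rewrite /= (bigD1 x) //= eqxx mul1r big1 ?addr0; last first.
    by move=> y /negbTE yx; rewrite eq_sym yx mul0r.
  rewrite (bigD1 z) //= eqxx mulr1 big1 ?addr0 // => y /negbTE ->.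
  by rewrite mulr0.
rewrite -[LHS]/(\sum_z' mc_law P t.+1 x z' * P z' z).
under eq_bigr do rewrite IH mulr_suml.
rewrite exchange_big; apply: eq_bigr => y _ /=.
by rewrite mulr_sumr; apply: eq_bigr => z' _; rewrite mulrA.
Qed.

Section NBLaw.
Variables (R : realType) (n d : nat) (G : {set 'I_n * 'I_n}).
Hypotheses (d3 : (2 < d)%N) (rG : G \in regular_graphs n d).
Local Notation b := (d.-1).
Local Notation N := (d * n)%N.

Lemma sum_dedge (f : 'I_n * 'I_n -> R) :
  \sum_(x : dedge G) f (val x) = \sum_(e in G) f e.
Proof.
have [x0 | none] := pickP [pred x : dedge G | true]; last first.
  rewrite big_pred0 // big_pred0 // => e; apply/negbTE/negP => eG.
  by have := none (Sub e eG).
rewrite [RHS](reindex_onto val (insubd x0)) => [|e eG]; last by rewrite insubdK.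
by move=> _; apply: eq_big => [x|//]; rewrite (valP x) valKd eqxx.
Qed.

Lemma card_dedge : #|dedge G| = N.
Proof. by rewrite card_sig -(card_regular rG); apply: eq_card. Qed.

Lemma card_nb_succ (e : dedge G) : #|nb_succ e| = b.
Proof.
case: e => -[p u] puG; rewrite -(card_next rG puG).
rewrite -(card_in_imset (f := fun f : dedge G => (val f).2)); last first.
  move=> [[a1 c1] h1] [[a2 c2] h2]; rewrite !finset.in_set /= => /andP[/eqP e1 _] /andP[/eqP e2 _] e3.
  by apply: val_inj; rewrite /= e1 e2 e3.
apply: eq_card => v; rewrite finset.in_set; apply/imsetP/and3P.
  move=> [[[a c] h]]; rewrite finset.in_set /= => /andP[/eqP e1 cp] ->; rewrite -e1; split => //.
  have [irr _ _] := regularP _ _ rG.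
  by apply: contraTneq h => ->.
move=> [vp vu uvG]; exists (Sub (u, v) uvG) => //.
by rewrite finset.in_set /= eqxx.
Qed.

Lemma nb_lawE t (x z : dedge G) :
  mc_law (@nb_step R n G) t x z =
  (cnt G (val x).1 (val x).2 t (val z))%:R / b%:R ^+ t.
Proof.
have b0 : b%:R != 0 :> R by rewrite pnatr_eq0; move: d3; case: (d) => [|[]].
elim: t x => [|t IH] x.
  rewrite /= /cnt /= expr0 divr1 addn0 -val_eqE. by case: x => -[].
rewrite mc_lawS; under eq_bigr do rewrite IH.
case: x => -[p u] puG /=; rewrite cntE.
under [in RHS]eq_bigr do rewrite -[_ * _]/(_ * (fun s => (lastE p u s == val z)%:R) _).
rewrite (sum_walkS G p u t (fun s => (lastE p u s == val z)%:R)).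
transitivity (\sum_(y : dedge G) (if ((val y).1 == u) && ((val y).2 != p) then
    b%:R^-1 * ((cnt G (val y).1 (val y).2 t (val z))%:R / b%:R ^+ t) else 0) : R).
  apply: eq_bigr => y _; rewrite /nb_step card_nb_succ finset.in_set /=.
  by case: ifP; rewrite ?mul0r.
rewrite (sum_dedge (fun e => if (e.1 == u) && (e.2 != p) then
   b%:R^-1 * ((cnt G e.1 e.2 t (val z))%:R / b%:R ^+ t) else 0)).
rewrite (_ : \sum_(e in G) _ = \sum_a \sum_(c | (a, c) \in G) (if (a == u) && (c != p) then
   b%:R^-1 * ((cnt G a c t (val z))%:R / b%:R ^+ t) else 0)); last first.
  by rewrite pair_big_dep; apply: eq_big => -[].
rewrite (bigD1 u) //= [X in _ + X]big1 ?addr0; last first.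
  by move=> a /negbTE au; rewrite big1 // => c _; rewrite au.
rewrite -big_mkcondr mulr_suml; apply: eq_big => [v|v _].
  rewrite eqxx /= andbC; case: (v != p) => //=; rewrite andb_idl // => uv.
  by have [irr _ _] := regularP _ _ rG; apply: contraTneq uv => ->.
by rewrite cntE exprS invfM; ring.
Qed.

Lemma sum_nb_law t (x : dedge G) :
  \sum_z mc_law (@nb_step R n G) t x z = 1.
Proof.
have b0 : b%:R != 0 :> R by rewrite pnatr_eq0; move: d3; case: (d) => [|[]].
under eq_bigr do rewrite nb_lawE.
rewrite (sum_dedge (fun e => (cnt G (val x).1 (val x).2 t e)%:R / b%:R ^+ t)) -mulr_suml.
have xG : ((val x).1, (val x).2) \in G by have := valP x; case: (val x).
rewrite (_ : \sum_(e in G) _ = b%:R ^+ t) ?divff ?expf_neq0 //.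
rewrite -(sum_walk R rG t xG).
under eq_bigr do rewrite cntE.
rewrite exchange_big; apply: eq_bigr => s _ /=; rewrite -mulr_sumr.
have [/andP[_ ep]|_] := boolP (walk _ _ _ _); last by rewrite mul0r.
rewrite mul1r (bigD1 (lastE (val x).1 (val x).2 s)) /=; last exact: lastE_in.
by rewrite eqxx big1 ?addr0 // => z /andP[_ /negbTE nz]; rewrite eq_sym nz.
Qed.

(** The law takes the value 0 or at least b^-t. Hence its distance to 1/N is at every point at least
    law + 1/N - 2 (b^t / N) law, and these bounds sum to 2 - 2 b^t / N. *)
Lemma nb_tv_lower t (x : dedge G) : (0 < n)%N ->
  1 - b%:R ^+ t / N%:R <= tv_dist (mc_law (@nb_step R n G) t x) (@nb_stat R n G).
Proof.
move=> n0; have b0 : (0 < b)%N by move: d3; case: (d) => [|[]].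
have N0 : (0 : R) < N%:R by rewrite ltr0n muln_gt0 n0 (ltnW (ltnW d3)).
have B0 : (0 : R) < b%:R ^+ t by rewrite exprn_gt0 // ltr0n.
suff : 2 - 2 * (b%:R ^+ t / N%:R) <= \sum_(z : dedge G)
    `|mc_law (@nb_step R n G) t x z - @nb_stat R n G z| by rewrite /tv_dist; lra.
have <- : \sum_(z : dedge G) (mc_law (@nb_step R n G) t x z + N%:R^-1 -
   2 * (b%:R ^+ t / N%:R) * mc_law (@nb_step R n G) t x z) = 2 - 2 * (b%:R ^+ t / N%:R).
  rewrite big_split /= sumrN -mulr_sumr big_split /= sum_nb_law mulr1 sumr_const card_dedge.
  by rewrite -[_ *+ _]mulr_natr mulVf ?gt_eqF.
apply: ler_sum => z _; rewrite nb_lawE /nb_stat card_dedge.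
have [->|c0] := posnP (cnt G (val x).1 (val x).2 t (val z)).
  by rewrite !mul0r mulr0 subr0 add0r sub0r normrN ger0_norm // invr_ge0 ltW.
have c1 : 1 <= (cnt G (val x).1 (val x).2 t (val z))%:R :> R by rewrite ler1n.
move: (cnt _ _ _ _ _)%:R c1 => c c1.
apply: le_trans (ler_norm _).
have -> : 2 * (b%:R ^+ t / N%:R) * (c / b%:R ^+ t) = 2 * (c / N%:R).
  by move: N0 B0; move: (N%:R : R) (b%:R ^+ t : R) => NR BR N0 B0; field; rewrite !gt_eqF.
have : N%:R^-1 <= c / N%:R by rewrite ler_peMl // invr_ge0 ltW.
lra.
Qed.

Lemma nb_dist_lower t : (0 < n)%N -> 1 - b%:R ^+ t / N%:R <= nb_dist R G t.
Proof.
move=> n0; have : (0 < #|dedge G|)%N by rewrite card_dedge muln_gt0 n0 (ltnW (ltnW d3)).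
case/card_gt0P => x _; apply: le_trans (nb_tv_lower t x n0) _.
exact: (le_bigmax_cond 0 (fun x => tv_dist (mc_law (@nb_step R n G) t x) (@nb_stat R n G))).
Qed.

Lemma nb_tv_upper (eps eta : R) sigma kappa t (x : dedge G) :
  0 < eps -> (0 < n)%N -> (0 < kappa)%N -> (sigma <= t)%N ->
  nmeet R G (val x).1 (val x).2 sigma <= 3 * b%:R ^+ sigma ->
  ncoll R sigma kappa (val x).1 (val x).2 t G <= (1 + eta) * (b%:R ^+ (2 * t) / N%:R) ->
  3 * (N%:R / b%:R ^+ t) + eta + 6 / kappa%:R <= eps ^+ 2 ->
  3 / kappa%:R < eps ->
  tv_dist (mc_law (@nb_step R n G) t x) (@nb_stat R n G) < eps.
Proof.
move=> eps0 n0 k0 st hm hc h1 h2.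
have b0 : (0 < b)%N by move: d3; case: (d) => [|[]].
have N0 : (0 : R) < N%:R by rewrite ltr0n muln_gt0 n0 (ltnW (ltnW d3)).
have bR0 : (0 : R) < b%:R by rewrite ltr0n.
have B0 : (0 : R) < b%:R ^+ t by rewrite exprn_gt0.
have K0 : (0 : R) < kappa%:R by rewrite ltr0n.
have xG : ((val x).1, (val x).2) \in G by have := valP x; case: (val x).
set p := (val x).1 in hm hc xG *; set u := (val x).2 in hm hc xG *.
pose V := @vcnt R n G p u sigma kappa t.
pose q (z : dedge G) := V (val z) / b%:R ^+ t.
have qp z : q z <= mc_law (@nb_step R n G) t x z.
  by rewrite nb_lawE; apply: ler_wpM2r; [rewrite invr_ge0 ltW|apply: vcnt_le].
have mass : 1 - 3 / kappa%:R <= \sum_z q z.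
  rewrite (sum_dedge (fun e => V e / b%:R ^+ t)) -mulr_suml ler_pdivlMr //.
  apply: le_trans (vcnt_mass R rG xG st k0).
  rewrite mulrBl mul1r lerB // -mulrA.
  have -> : 3 / kappa%:R * b%:R ^+ t = b%:R ^+ (t - sigma) * ((3 * b%:R ^+ sigma) / kappa%:R) :> R.
    by rewrite -[in LHS](subnK st) exprD; ring.
  apply: ler_wpM2l; first by rewrite exprn_ge0 // ltW.
  by apply: ler_wpM2r => //; rewrite invr_ge0 ltW.
have sq : \sum_z q z ^+ 2 <= 3 / b%:R ^+ t + (1 + eta) / N%:R.
  under eq_bigr do rewrite expr_div_n.
  rewrite (sum_dedge (fun e => V e ^+ 2 / (b%:R ^+ t) ^+ 2)) -mulr_suml.
  rewrite ler_pdivrMr ?exprn_gt0 //; apply: (le_trans (vcnt_sq R rG xG kappa st)).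
  have -> : (3 / b%:R ^+ t + (1 + eta) / N%:R) * (b%:R ^+ t) ^+ 2 =
     b%:R ^+ (t - sigma) * (3 * b%:R ^+ sigma) + (1 + eta) * (b%:R ^+ (2 * t) / N%:R) :> R.
    rewrite [X in _ = X + _]mulrCA -exprD subnK // [(2 * t)%N]mulnC exprM.
    by move: N0 B0 K0; move: (N%:R : R) (b%:R ^+ t : R) (kappa%:R : R) => NR BR KR N0 B0 K0; field; rewrite ?gt_eqF //.
  by apply: lerD => //; apply: ler_wpM2l => //; rewrite exprn_ge0 // ltW.
(* The cross term doubles the missing mass 3 / kappa, which explains the 6 / kappa in the
   hypothesis. *)
have dev : \sum_z (q z - N%:R^-1) ^+ 2 <= eps ^+ 2 / N%:R.
  have -> : \sum_z (q z - N%:R^-1) ^+ 2 = \sum_z q z ^+ 2 - 2 / N%:R * \sum_z q z + N%:R^-1.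
    under eq_bigr do rewrite sqrrB.
    rewrite big_split big_split /= sumr_const card_dedge sumrN; congr (_ - _ + _).
      by rewrite mulr_sumr; apply: eq_bigr => z _; rewrite -mulr_natl; ring.
    by rewrite -[_ *+ _]mulr_natr; move: N0 B0 K0; move: (N%:R : R) (b%:R ^+ t : R) (kappa%:R : R) => NR BR KR N0 B0 K0; field; rewrite ?gt_eqF //.
  rewrite ler_pdivlMr //.
  have h3 : (\sum_z q z ^+ 2) * N%:R <= 3 * (N%:R / b%:R ^+ t) + (1 + eta).
    apply: le_trans (ler_wpM2r (ltW N0) sq) _; rewrite le_eqVlt; apply/orP; left; apply/eqP.
    by move: N0 B0 K0; move: (N%:R : R) (b%:R ^+ t : R) (kappa%:R : R) => NR BR KR N0 B0 K0; field; rewrite ?gt_eqF //.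
  have -> : (\sum_z q z ^+ 2 - 2 / N%:R * (\sum_z q z) + N%:R^-1) * N%:R =
     (\sum_z q z ^+ 2) * N%:R - 2 * (\sum_z q z) + 1.
    by move: (\sum_z _) (\sum_z _) => S1 S2; move: N0 B0 K0; move: (N%:R : R) (b%:R ^+ t : R) (kappa%:R : R) => NR BR KR N0 B0 K0; field; rewrite ?gt_eqF //.
  have : 6 / kappa%:R = 2 * (3 / kappa%:R) :> R by rewrite mulrA; congr (_ / _); ring.
  lra.
have l1 : \sum_z `|q z - N%:R^-1| <= eps.
  (* Cauchy-Schwarz in the form 2a <= (N / eps) a^2 + eps / N, which avoids square roots. *)
  apply: (@le_trans _ _ (\sum_z 2^-1 * (N%:R / eps * (q z - N%:R^-1) ^+ 2 + eps / N%:R))).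
    apply: ler_sum => z _; rewrite -(real_normK (num_real _)); set a := `|_|.
    rewrite ler_pdivlMl // -subr_ge0.
    have -> : N%:R / eps * a ^+ 2 + eps / N%:R - 2 * a = N%:R / eps * (a - eps / N%:R) ^+ 2.
      by move: N0 B0 K0; move: (N%:R : R) (b%:R ^+ t : R) (kappa%:R : R) => NR BR KR N0 B0 K0; field; rewrite ?gt_eqF //.
    by rewrite mulr_ge0 ?sqr_ge0 // divr_ge0 // ltW.
  rewrite -mulr_sumr big_split /= -mulr_sumr sumr_const card_dedge.
  have : N%:R / eps * \sum_z (q z - N%:R^-1) ^+ 2 <= eps.
    apply: le_trans (ler_wpM2l _ dev) _; first by rewrite divr_ge0 // ltW.
    by rewrite le_eqVlt; apply/orP; left; apply/eqP; move: N0 B0 K0; move: (N%:R : R) (b%:R ^+ t : R) (kappa%:R : R) => NR BR KR N0 B0 K0; field; rewrite ?gt_eqF //.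
  have -> : eps / N%:R *+ N = eps by rewrite -mulr_natr divfK // gt_eqF.
  lra.
have l2 : \sum_z (mc_law (@nb_step R n G) t x z - q z) <= 3 / kappa%:R.
  by rewrite sumrB sum_nb_law; lra.
suff : \sum_(z : dedge G) `|mc_law (@nb_step R n G) t x z - @nb_stat R n G z|
    <= 3 / kappa%:R + eps by rewrite /tv_dist; lra.
apply: le_trans (lerD l2 l1); rewrite -big_split; apply: ler_sum => z _ /=.
rewrite /nb_stat card_dedge -(subrK (q z) (mc_law _ _ _ _)) -[X in `|X|]addrA.
apply: le_trans (ler_normD _ _) _; rewrite subrK lerD2r ger0_norm // subr_ge0; exact: qp.
Qed.

End NBLaw.

Section GoodGraph.
Variables (R : realType) (n d q t : nat) (eta eps : R) (G : {set 'I_n * 'I_n}).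
Hypotheses (d3 : (2 < d)%N) (q0 : (0 < q)%N) (rG : G \in regular_graphs n d).
Hypothesis goodG : ~~ bad d q t eta G.
Local Notation b := (d.-1).
Local Notation N := (d * n)%N.

(** The pairs meeting at time 7q number at most 3 b^(7q): 2 b^(7q) from those together since time
    4q, where each edge has at most two walks, and b^(7q) from the other collisions. *)
Lemma nb_dist_small : (7 * q <= t)%N -> 0 < eps -> (0 < n)%N ->
  3 * (N%:R / b%:R ^+ t) + eta + 6 / q%:R <= eps ^+ 2 -> 3 / q%:R < eps ->
  nb_dist R G t < eps.
Proof.
move=> qt eps0 n0 h1 h2; apply: bigmax_lt => // x _.
apply: (nb_tv_upper d3 rG eps0 n0 q0 qt _ _ h1 h2).
  have xG : ((val x).1, (val x).2) \in G by have := valP x; case: (val x).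
  move: goodG; rewrite negb_exists_in => /forall_inP/(_ _ (valP x)).
  rewrite !negb_or -!leNgt => /and3P[mult coll _].
  move: mult; rewrite negb_exists => /forallP mult.
  have c2 z : (cnt G (val x).1 (val x).2 (4 * q) z <= 2)%N by have := mult z; rewrite -leqNgt.
  have st : (4 * q <= 7 * q)%N by rewrite leq_mul2r orbT.
  have := vcnt_sq R rG xG 2 st.
  rewrite (nmeet_sq R xG (7 * q)); under eq_bigr do rewrite vcnt_all //.
  move=> h; apply: le_trans h _.
  have hm := nmeet_le R rG xG c2.
  have -> : 3 * b%:R ^+ (7 * q) = b%:R ^+ (7 * q - 4 * q) * (2 * b%:R ^+ (4 * q)) + b%:R ^+ (7 * q) :> R.
    by rewrite mulrCA -exprD subnK //; ring.
  by apply: lerD coll; apply: ler_wpM2l; rewrite ?exprn_ge0.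
move: goodG; rewrite negb_exists_in => /forall_inP/(_ _ (valP x)).
by rewrite !negb_or -!leNgt => /and3P[].
Qed.

End GoodGraph.

(** From q <= (k + 1) 2^(q / (k + 1)), raised to the power k + 1. *)
Lemma poly_le_exp M k : exists q0, forall q, (q0 <= q)%N -> (M * q ^ k <= 2 ^ q)%N.
Proof.
exists (M * k.+1 ^ k.+1)%N => q hq.
have c0 : (0 < k.+1 ^ k.+1)%N by rewrite expn_gt0.
rewrite -(leq_pmul2l c0); apply: (@leq_trans (q ^ k.+1)).
  by rewrite mulnA [(_ * M)%N]mulnC [(q ^ k.+1)%N]expnS leq_mul2r hq orbT.
have qj : (q <= k.+1 * 2 ^ (q %/ k.+1))%N.
  rewrite {1}(divn_eq q k.+1) mulnC.
  apply: (@leq_trans (k.+1 * (q %/ k.+1).+1)).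
    by rewrite mulnS addnC leq_add2r ltnW // ltn_pmod.
  by rewrite leq_mul2l /= ltn_expl.
apply: (@leq_trans ((k.+1 * 2 ^ (q %/ k.+1)) ^ k.+1)); first by rewrite leq_exp2r.
by rewrite expnMn -expnM leq_mul2l leq_exp2l // leq_divM orbT.
Qed.

Lemma whp_intro (R : realType) d (P : forall n, pred {set 'I_n * 'I_n}) : (2 < d)%N ->
  (forall delta : R, 0 < delta -> exists n0, forall n, (n0 <= n)%N -> ~~ odd (d * n) ->
    exists B : pred {set 'I_n * 'I_n},
      #|[set G in regular_graphs n d | B G]|%:R <= delta * #|regular_graphs n d|%:R /\
      forall G, G \in regular_graphs n d -> ~~ B G -> P n G) ->
  whp R d P.
Proof.
move=> d3 h; apply/cvgrPdist_le => delta delta0.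
have [n0 hn0] := h delta delta0.
exists (maxn n0 d.+3) => //= n nd od.
have nn0 : (n0 <= n)%N by apply: leq_trans nd; apply: leq_maxl.
have {}nd : (d.+3 <= n)%N by apply: leq_trans nd; apply: leq_maxr.
have [B [hB hP]] := hn0 n nn0 od.
have reg0 : (0 : R) < #|regular_graphs n d|%:R by rewrite ltr0n regular_graph_exists.
rewrite /prob_regular ger0_norm; last first.
  rewrite subr_ge0 ler_pdivrMr // mul1r ler_nat; apply/subset_leq_card/fintype.subsetP => G.
  by rewrite finset.in_set => /andP[].
rewrite lerBlDr -lerBlDl ler_pdivlMr // mulrBl mul1r lerBlDr.
apply: (@le_trans _ _ (#|[set G in regular_graphs n d | P n G]|%:R +
  #|[set G in regular_graphs n d | B G]|%:R)); last by rewrite lerD2l.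
rewrite -natrD ler_nat; apply: leq_trans (leq_of_leqif (leq_card_setU _ _)).
apply/subset_leq_card/fintype.subsetP => G rG; rewrite finset.in_setU !finset.in_set -andb_orr.
apply/andP; split; first by rewrite inE in rG.
by have := hP G rG; case: (B G); rewrite ?orbT // => ->.
Qed.

(** * From logarithmic times to the integer scales *)

Section Logarithms.
Variables (R : realType) (d : nat).
Hypothesis (d3 : (2 < d)%N).
Local Notation b := (d.-1).
Local Notation lb := (ln (b%:R : R)).

Lemma pred_natr : d%:R - 1 = b%:R :> R.
Proof. by move: d3; case: d => // k _; rewrite -natr1 addrK. Qed.

Lemma b_gt1 : (1 < b)%N.
Proof. by move: d3; case: d => [|[|[]]]. Qed.

Lemma bR_gt0 : (0 : R) < b%:R.
Proof. by rewrite ltr0n ltnW // b_gt1. Qed.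

Lemma lb_gt0 : 0 < lb.
Proof. by apply: ln_gt0; rewrite ltr1n b_gt1. Qed.

Lemma pow_expR t : b%:R ^+ t = expR (t%:R * lb) :> R.
Proof. by rewrite expRM_natl lnK // posrE bR_gt0. Qed.

Lemma logb_expR (x : R) : 0 < x -> expR (logb b%:R x * lb) = x.
Proof. by move=> x0; rewrite /logb divfK ?gt_eqF ?lb_gt0 // lnK. Qed.

Lemma eventually_small (t : nat -> nat) (eps c1 c2 delta : R) n1 :
  0 < eps < 1 -> 0 <= c1 -> 6 / eps ^+ 2 <= expR (c1 * lb) ->
  (forall n, (n1 <= n)%N -> (0 < n)%N ->
    logb b%:R (d * n)%:R + c1 <= (t n)%:R <= logb b%:R (d * n)%:R + c2) ->
  0 < delta -> exists n0, forall n, (n0 <= n)%N ->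
    exists B : pred {set 'I_n * 'I_n},
      #|[set G in regular_graphs n d | B G]|%:R <= delta * #|regular_graphs n d|%:R /\
      forall G, G \in regular_graphs n d -> ~~ B G -> nb_dist R G (t n) < eps.
Proof.
case/andP=> eps0 eps1 c10 hc1 ht delta0.
have e2 : 0 < eps ^+ 2 by rewrite exprn_gt0.
have e21 : eps ^+ 2 <= 1 by rewrite exprn_ile1 // ltW.
(* The budget eps^2 of [nb_dist_small] is split: a quarter for eta, half for 3N / b^t, a quarter for
   6 / q. *)
pose eta := eps ^+ 2 / 4.
have eta0 : 0 < eta by rewrite divr_gt0.
pose K : R := 2560 + 128 * (d%:R * b%:R ^+ 13) + 4 * b%:R ^+ 27.
(* Bounds the excess of t over 13q, so that t <= 20q once q is at least E. *)
pose E : R := ln d%:R / lb + 13 + `|c2|.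
have bnd (a : R) : exists m : nat, forall M, (m <= M)%N -> a <= M%:R.
  by exists (Num.truncn a).+1 => M h; apply: le_trans (ltW (truncnS_gt a)) _; rewrite ler_nat.
have [m2 hm2] := bnd (6 * d%:R / delta); have [m3 hm3] := bnd (K / eta).
have [m4 hm4] := bnd (24 / eps ^+ 2); have [m5 hm5] := bnd (4 / eps); have [m6 hm6] := bnd E.
pose M := (400 + 2 * (d.+1 * d) + (m2 + (m3 + (m4 + (m5 + m6)))))%N.
have M1 : (400 + 2 * (d.+1 * d) <= M)%N by apply: leq_addr.
have [M2' M3' M4' M5' M6'] : [/\ m2 <= M, m3 <= M, m4 <= M, m5 <= M & m6 <= M]%N.
  by rewrite /M; move: (400 + _)%N => ?; clear; split; lia.
have M2 : 6 * d%:R <= M%:R * delta by rewrite -ler_pdivrMr // hm2.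
have M3 : K <= M%:R * eta by rewrite -ler_pdivrMr // hm3.
have M4 : 24 / eps ^+ 2 <= M%:R by apply: hm4.
have M5 : 4 / eps <= M%:R by apply: hm5.
have M6 : E <= M%:R by apply: hm6.
move: M M1 M2 M3 M4 M5 M6 {M2' M3' M4' M5' M6' hm2 hm3 hm4 hm5 hm6} => M M1 M2 M3 M4 M5 M6.
have [q0 hq0] := poly_le_exp M 13.
exists (maxn n1 (b ^ (13 * maxn q0 M))) => n; rewrite geq_max => /andP[nn1 nb].
have n0 : (0 < n)%N by apply: leq_trans nb; rewrite expn_gt0 (ltnW b_gt1).
(* The largest q with b^(13q) <= n. *)
pose q := (trunc_log b n %/ 13)%N.
have /andP[nT Tn] := trunc_log_bounds b_gt1 n0.
have qq0 : (maxn q0 M <= q)%N.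
  by rewrite /q leq_divRL // mulnC trunc_log_max // b_gt1.
have Mq : (M <= q)%N by apply: leq_trans qq0; apply: leq_maxr.
have MQ : (M * q ^ 13 <= b ^ q)%N.
  apply: leq_trans (hq0 q _) _; first by apply: leq_trans qq0; apply: leq_maxl.
  by rewrite leq_exp2r ?b_gt1 //; apply: leq_trans (leq_trans M1 Mq); rewrite addn_gt0.
have MqR : (M%:R : R) <= q%:R by rewrite ler_nat.
have qpos : (0 < q)%N by apply: leq_trans (leq_trans M1 Mq).
have qR0 : (0 : R) < q%:R by rewrite ltr0n.
have qT : (13 * q <= trunc_log b n)%N by rewrite /q mulnC leq_divM.
have n_ge : (b ^ (13 * q) <= n)%N.
  by apply: leq_trans nT; rewrite leq_exp2l // b_gt1.
have n_le : (n <= b ^ (13 * q + 13))%N.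
  apply: leq_trans (ltnW Tn) _; rewrite leq_exp2l ?b_gt1 //.
  by rewrite -mulnSr mulnC -ltn_divLR.
have N0 : (0 : R) < (d * n)%:R by rewrite ltr0n muln_gt0 n0 (ltnW (ltnW d3)).
have lb0 := lb_gt0.
have [t1 t2] := andP (ht n nn1 n0).
set L := logb _ _ in t1 t2.
have LN : expR (L * lb) = (d * n)%:R by apply: logb_expR.
have L_ge : 13 * q%:R <= L.
  rewrite -(ler_pM2r lb0) -ler_expR LN -(natrM R 13) -pow_expR -natrX ler_nat.
  by apply: leq_trans n_ge _; rewrite leq_pmull // (ltnW (ltnW d3)).
have L_le : L <= ln d%:R / lb + (13 * q%:R + 13).
  rewrite -(ler_pM2r lb0) -ler_expR LN mulrDl divfK ?gt_eqF // expRD lnK; last first.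
    by rewrite posrE ltr0n (ltnW (ltnW d3)).
  rewrite natrM; apply: ler_wpM2l => //.
  have -> : 13 * q%:R + 13 = (13 * q + 13)%:R :> R by rewrite natrD natrM.
  by rewrite -pow_expR -natrX ler_nat.
have t_ge : (7 * q <= t n)%N.
  by rewrite -(ler_nat R) natrM; move: t1 L_ge c10 qR0; lra.
have t_le : (t n <= 20 * q)%N.
  rewrite -(ler_nat R) natrM; have := ler_norm c2; move: t2 L_le M6 MqR qR0; rewrite /E; lra.
have bt : (d * n)%:R * (6 / eps ^+ 2) <= b%:R ^+ t n.
  rewrite pow_expR -LN; apply: (@le_trans _ _ (expR (L * lb) * expR (c1 * lb))).
    by apply: ler_wpM2l => //; apply: expR_ge0.
  by rewrite -expRD ler_expR -mulrDl ler_pM2r.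
have eta01 : 0 < eta <= 1 by rewrite eta0 /eta; move: e21 e2; lra.
exists (bad d q (t n) eta); split.
  exact: (bad_fraction d3 Mq MQ n_ge n_le t_ge t_le eta01 delta0 M1 M2 M3).
move=> G rG goodG; apply: (nb_dist_small d3 qpos rG goodG) => //.
  have h1 : 3 * ((d * n)%:R / b%:R ^+ t n) <= eps ^+ 2 / 2.
    have B0 : (0 : R) < b%:R ^+ t n by rewrite exprn_gt0 // bR_gt0.
    rewrite mulrA ler_pdivrMr //; apply: (@le_trans _ _ (eps ^+ 2 / 2 * ((d * n)%:R * (6 / eps ^+ 2)))).
      move: e2 N0; move: (eps ^+ 2) (d * n)%:R => e N' e2 N0.
      by rewrite le_eqVlt; apply/orP; left; apply/eqP; field; rewrite gt_eqF.
    by apply: ler_wpM2l => //; rewrite divr_ge0 // ltW.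
  have h2 : 6 / q%:R <= eps ^+ 2 / 4.
    have M4q : 24 / eps ^+ 2 <= q%:R := le_trans M4 MqR.
    by rewrite ler_pdivrMr //; rewrite ler_pdivrMr // in M4q; lra.
  by rewrite /eta; lra.
have M5q : 4 / eps <= q%:R := le_trans M5 MqR.
by rewrite ltr_pdivrMr //; rewrite ler_pdivrMr // in M5q; lra.
Qed.

End Logarithms.

(** * Cutoff *)

Section Main.
Variables (R : realType) (d : nat) (eps : R).
Hypotheses (d3 : (2 < d)%N) (eps01 : 0 < eps < 1).
Local Notation b := (d.-1).
Local Notation lb := (ln (b%:R : R)).

Lemma logb_ge0 n : (0 < n)%N -> 0 <= logb b%:R (d * n)%:R :> R.
Proof.
move=> n0; rewrite /logb divr_ge0 ?(ltW (lb_gt0 R d3)) // ln_ge0 // ler1n muln_gt0 n0.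
by rewrite (ltnW (ltnW d3)).
Qed.

Lemma pow_le_logb n (t : nat) (c : R) : (0 < n)%N ->
  t%:R <= logb b%:R (d * n)%:R - c -> b%:R ^+ t / (d * n)%:R <= expR (- c * lb).
Proof.
move=> n0 ht; have N0 : (0 : R) < (d * n)%:R by rewrite ltr0n muln_gt0 n0 (ltnW (ltnW d3)).
rewrite ler_pdivrMr // -[in leRHS](logb_expR d3 N0) -expRD (pow_expR R d3) ler_expR -mulrDl.
by rewrite ler_pM2r ?lb_gt0 // addrC.
Qed.

Lemma cutoff_window : exists2 lambda : R, 0 < lambda &
  whp R d (fun n G =>
    (1 - eps <= nb_dist R G (Num.truncn (logb b%:R (d * n)%:R - lambda))) &&
    (nb_dist R G (Num.truncn (logb b%:R (d * n)%:R + lambda)) <= eps)).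
Proof.
have /andP[eps0 eps1] := eps01.
have e2 : 0 < eps ^+ 2 by rewrite exprn_gt0.
have e2e : eps ^+ 2 <= eps by rewrite expr2 ler_piMl // ltW.
have lb0 := lb_gt0 R d3.
have e6 : 6 / eps <= 6 / eps ^+ 2.
  by apply: ler_wpM2l => //; rewrite lef_pV2 ?posrE.
have e1 : eps^-1 <= 6 / eps.
  by rewrite -{1}[eps^-1]mul1r; apply: ler_wpM2r; rewrite ?invr_ge0 ?(ltW eps0) // ler1n.
have ge1 : 1 <= 6 / eps ^+ 2.
  apply: le_trans e6; apply: le_trans e1.
  by rewrite -[leLHS]invr1 lef_pV2 ?posrE // ltW.
pose c1 := ln (6 / eps ^+ 2) / lb.
have c10 : 0 <= c1 by rewrite divr_ge0 ?(ltW lb0) ?ln_ge0.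
have c1E : expR (c1 * lb) = 6 / eps ^+ 2.
  by rewrite divfK ?gt_eqF // lnK // posrE (lt_le_trans ltr01).
(* The extra 1 makes up for rounding down. *)
exists (c1 + 1); first by rewrite ltr_wpDl.
apply: whp_intro => // delta delta0.
have ht n : (0 <= n)%N -> (0 < n)%N -> logb b%:R (d * n)%:R + c1 <=
    (Num.truncn (logb b%:R (d * n)%:R + (c1 + 1)))%:R <= logb b%:R (d * n)%:R + (c1 + 1).
  move=> _ n0; have x0 : 0 <= logb b%:R (d * n)%:R + (c1 + 1).
    by rewrite !addr_ge0 // logb_ge0.
  rewrite truncn_le x0 andbT; have := truncnS_gt (logb b%:R (d * n)%:R + (c1 + 1)).
  by rewrite -natr1 addrA ltrD2r => /ltW.
have c1' : 6 / eps ^+ 2 <= expR (c1 * lb) by rewrite c1E.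
have [n0 hn0] := eventually_small d3 eps01 c10 c1' ht delta0.
exists (maxn n0 (Num.truncn eps^-1).+1) => n; rewrite geq_max => /andP[nn0 ne] _.
have npos : (0 < n)%N by apply: leq_trans ne.
have [B [hB hG]] := hn0 n nn0; exists B; split=> // G rG nB.
apply/andP; split; last exact/ltW/hG.
apply: le_trans (nb_dist_lower R d3 rG _ npos); rewrite lerD2l lerN2.
(* For a negative time [Num.truncn] returns 0, and the bound at time 0 needs 1 / (dn) <= eps, hence
   the threshold 1 / eps on n. *)
have [neg|pos] := ltP (logb b%:R (d * n)%:R - (c1 + 1)) 0.
  have -> : Num.truncn (logb b%:R (d * n)%:R - (c1 + 1)) = 0%N.
    by rewrite truncn_floor leNgt neg.
  have N0 : (0 : R) < (d * n)%:R by rewrite ltr0n muln_gt0 npos (ltnW (ltnW d3)).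
  rewrite expr0 div1r -[leRHS]invrK lef_pV2 ?posrE ?invr_gt0 //.
  apply: le_trans (ltW (truncnS_gt _)) _; rewrite ler_nat; apply: leq_trans ne _.
  by rewrite leq_pmull // (ltnW (ltnW d3)).
apply: (@le_trans _ _ (expR (- c1 * lb))).
  apply: pow_le_logb => //; apply: (@le_trans _ _ (logb b%:R (d * n)%:R - (c1 + 1))).
    by rewrite truncn_le.
  by rewrite lerD2l lerN2 lerDl.
rewrite mulNr expRN c1E -[leRHS]invrK lef_pV2 ?posrE ?invr_gt0 //.
  exact: le_trans e1 e6.
exact: lt_le_trans ge1.
Qed.

Lemma mixing_time_bounds :
  whp R d (fun n G =>
    (((Num.ceil (logb (b%:R : R) (d * n)%:R)
        - Num.ceil (logb (b%:R : R) (1 / eps)))%:~R : R)%:E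
      <= nb_tmix G (1 - eps))%E &&
    (nb_tmix G eps <=
      ((Num.ceil (logb (b%:R : R) (d * n)%:R)
        + 3 * Num.ceil (logb (b%:R : R) (1 / eps)) + 4)%:~R : R)%:E)%E).
Proof.
have /andP[eps0 eps1] := eps01.
have lb0 := lb_gt0 R d3.
have ie0 : 0 < 1 / eps by rewrite divr_gt0.
have ie1 : 1 <= 1 / eps by rewrite ler_pdivlMr // mul1r ltW.
set l := logb (b%:R : R) (1 / eps).
have lE : expR (l * lb) = 1 / eps by apply: logb_expR.
have l0 : 0 <= l by rewrite /l /logb divr_ge0 ?(ltW lb0) ?ln_ge0.
have lceil : l <= (Num.ceil l)%:~R by apply: ceil_ge.
have lceil' : (Num.ceil l)%:~R <= l + 1.
  by have := ceilB1_lt l; rewrite intrB ltrBlDr => /ltW.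
apply: whp_intro => // delta delta0.
pose T n : int := Num.ceil (logb (b%:R : R) (d * n)%:R) + 3 * Num.ceil l + 4.
have T0 n : (0 < n)%N -> 0 <= T n.
  have cl : 0 <= Num.ceil l by rewrite ceil_ge0 (lt_le_trans _ l0) // ltrN10.
  move=> n0; have cL : 0 <= Num.ceil (logb (b%:R : R) (d * n)%:R).
    by rewrite ceil_ge0 (lt_le_trans _ (logb_ge0 n0)) // ltrN10.
  by rewrite /T !addr_ge0 ?mulr_ge0.
have TE n : (0 < n)%N -> (`|T n|%N%:R : R) = (T n)%:~R.
  by move=> n0; rewrite natr_absz ger0_norm // T0.
(* Rounding up adds at most 1 to the first logarithm and 3 to the tripled one, hence 8. *)
have ht n : (0 <= n)%N -> (0 < n)%N -> logb (b%:R : R) (d * n)%:R + (3 * l + 4) <=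
    (`|T n|%N)%:R <= logb (b%:R : R) (d * n)%:R + (3 * l + 8).
  move=> _ n0; rewrite TE // /T !intrD intrM.
  have := ceil_ge (logb (b%:R : R) (d * n)%:R : R); have := ceilB1_lt (logb (b%:R : R) (d * n)%:R : R).
  rewrite intrB; move: (logb _ _) => L; move: (Num.ceil L)%:~R => cL.
  by move: lceil lceil'; lra.
have c10 : 0 <= 3 * l + 4 by move: l0; lra.
(* b^(3l + 4) is eps^-3 b^4, and b^4 >= 16 exceeds the required 6. *)
have c1' : 6 / eps ^+ 2 <= expR ((3 * l + 4) * lb).
  have -> : (3 * l + 4) * lb = 3%:R * (l * lb) + 4%:R * lb by ring.
  rewrite expRD expRM_natl lE -(pow_expR R d3).
  have b16 : 16 <= b%:R ^+ 4 :> R.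
    have : (2 : R) <= b%:R by rewrite (ler_nat R 2) b_gt1.
    move=> h; have -> : 16 = 2 ^+ 4 :> R by ring.
    by apply: lerXn2r; rewrite ?nnegrE.
  apply: (@le_trans _ _ ((1 / eps) ^+ 3 * 16)); last first.
    by apply: ler_wpM2l => //; rewrite exprn_ge0 // ltW.
  have -> : 6 / eps ^+ 2 = 6 * (1 / eps) ^+ 2 by rewrite expr_div_n expr1n mul1r.
  move: (1 / eps) ie1 => i i1.
  have i23 : i ^+ 2 <= i ^+ 3 by apply: ler_weXn2l.
  have i2 : 0 <= i ^+ 2 by apply: sqr_ge0.
  by lra.
have [n0 hn0] := eventually_small d3 eps01 c10 c1' ht delta0.
exists (maxn n0 1) => n; rewrite geq_max => /andP[nn0 npos] _.
have [B [hB hG]] := hn0 n nn0; exists B; split=> // G rG nB.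
apply/andP; split; last first.
  apply: ereal_inf_lbound; exists `|T n|%N; first exact: hG.
  by rewrite TE.
apply: le_ereal_inf_tmp => _ [t /= ht' <-]; rewrite lee_fin leNgt; apply/negP => tlt.
move: ht'; rewrite ltNge => /negP; apply.
apply: le_trans (nb_dist_lower R d3 rG _ npos); rewrite lerD2l lerN2.
have -> : eps = expR (- l * lb) by rewrite mulNr expRN lE div1r invrK.
apply: pow_le_logb => //; apply: ltW.
(* Integrality turns the strict inequality into a gain of 1, which offsets the rounding of the first
   logarithm. *)
have : (t%:Z + 1)%:~R <= (Num.ceil (logb (b%:R : R) (d * n)%:R) - Num.ceil l)%:~R :> R.
  by rewrite ler_int lezD1 -(ltr_int R).
have := ceilB1_lt (logb (b%:R : R) (d * n)%:R : R).
rewrite !intrB intrD; move: (logb _ _) => L; move: (Num.ceil L)%:~R => cL.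
by move: lceil; rewrite -pmulrn; lra.
Qed.

End Main.

Theorem theorem2 (R : realType) (d : nat) (hd : (3 <= d)%N) :
  nb_cutoff_const_window d (fun n => logb (d%:R - 1 : R) (d * n)%:R) /\
  (forall eps : R, 0 < eps < 1 ->
    whp R d (fun n G =>
      (((Num.ceil (logb (d%:R - 1 : R) (d * n)%:R)
          - Num.ceil (logb (d%:R - 1 : R) (1 / eps)))%:~R : R)%:E
        <= nb_tmix G (1 - eps))%E &&
      (nb_tmix G eps <=
        ((Num.ceil (logb (d%:R - 1 : R) (d * n)%:R)
          + 3 * Num.ceil (logb (d%:R - 1 : R) (1 / eps)) + 4)%:~R : R)%:E)%E)).
Proof.
rewrite pred_natr //; split=> eps eps01; first exact: cutoff_window.
exact: mixing_time_bounds.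
Qed.
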